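(* Consider the $T$-stage stochastic program (MSP) and the SL-MDD algorithm described in the context, with $\alpha\in(0,1)$, $\sigma>0$, $\tau\in\big(0,\tfrac{1+\sqrt{5-4\alpha}}{2}\big]$ and a summable sequence of nonnegative tolerances $\{\varepsilon_k\}_{k\ge0}$. Suppose that the solution set $\bar\Omega_T$ of the KKT system associated with (MSP) is nonempty, and that $P_x^k-Q\preceq\frac{2\alpha}{\sigma}I$ (for all $k$ and all points of $\bar\Omega_T$, with $P_x^k$ as in the context), where $Q=\mathrm{diag}(Q_1,\dots,Q_T)$. Let $\{\varpi^k\}=\{(v^k_{1:T},w^k_{1:T},y^k_{1:T},z^k_{1:T},x^k_{1:T})\}$ be the sequence generated by the algorithm. Then $\{\varpi^k\}$ converges to a point in $\bar\Omega_T$.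
   Context: **Problem (MSP).** Let $T\ge2$ and $d,\ell,N_2,\dots,N_T$ be positive integers. Scenario nodes at stage $t\ge2$ are indexed by $k_{[t]}=(k_2,\dots,k_t)$ with $k_s\in\{1,\dots,N_s\}$; stage 1 has one node; the parent of $k_{[t]}$ is $k_{[t-1]}$; each child has conditional probability $1/N_t$. Each node carries a decision vector in $\mathbb R^d$, a closed proper convex function $\theta_{t,k_{[t]}}$, a convex continuously differentiable function $h_{t,k_{[t]}}$ with Lipschitz gradient, a nonempty closed convex set $\mathcal K_{t,k_{[t]}}\subset\mathbb R^d$, a vector $b_{t}(k_{[t]})\in\mathbb R^\ell$ and linear maps $A_t(k_{[t]})$ and (for $t\ge2$) $B_t(k_{[t]})$ from $\mathbb R^d$ to $\mathbb R^\ell$. Let $x_t$ stack the decisions of all stage-$t$ nodes, $b_t$ stack the $b_t(k_{[t]})$, $\theta_t(x_t)=\frac1{N_2\cdots N_t}\sum_{k_{[t]}}\theta_{t,k_{[t]}}(x_t(k_{[t]}))$, similarly $h_t$, let $\mathcal K_t$ be the product of the $\mathcal K_{t,k_{[t]}}$, $A_t$ the block-diagonal operator of the $A_t(k_{[t]})$, and $(B_tx_{t-1})(k_{[t]})=B_t(k_{[t]})x_{t-1}(k_{[t-1]})$ (for $t=1$ the averages reduce to the single functions $\theta_1,h_1$). The problem is $$\min_{x_1,\dots,x_T}\ \sum_{t=1}^T\big(\theta_t(x_t)+\delta_{\mathcal K_t}(x_t)+h_t(x_t)\big)\quad\text{s.t. }A_1x_1=b_1,\quad B_tx_{t-1}+A_tx_t=b_t,\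 t=2,\dots,T,$$ where $\delta_{\mathcal K_t}$ is the indicator function. A superscript $*$ on a linear map is the adjoint and on a convex function the Fenchel conjugate. **Minorization data.** $Q_t$ are self-adjoint positive semidefinite operators on the space of $x_t$ with $h_t(x_t)\ge h_t(x_t')+\langle\nabla h_t(x_t'),x_t-x_t'\rangle+\frac12\langle x_t-x_t',Q_t(x_t-x_t')\rangle$ for all $x_t,x_t'$. Put $\mathcal W_t=\mathrm{Range}(Q_t)$, $c_t(x_t')=\nabla h_t(x_t')-Q_tx_t'$, $h(x)=\sum_th_t(x_t)$. Convention: $B_{T+1}^*=0$, $y_{T+1}=0$. A subscript $1{:}T$ denotes a $T$-tuple; $v_t,w_t,z_t$ live in the space of $x_t$, $w_t\in\mathcal W_t$, and $y_t$ in the space of $b_t$. It is assumed that $A_1A_1^*\succ0$ and $A_tA_t^*+B_tB_t^*\succ0$ for $t=2,\dots,T$. **Augmented Lagrangian.** For $\sigma>0$, $$\widehat L^{x'_{1:T}}_\sigma(v_{1:T},w_{1:T},y_{1:T},z_{1:T};x_{1:T})=\sum_{t=1}^T\Big(\theta_t^*(-v_t)+\delta^*_{\mathcal K_t}(-z_t)+\tfrac12\langle w_t,Q_tw_t\rangle+\delta_{\mathcal W_t}(w_t)-\langle b_t,y_t\rangle$$ $$+\tfrac\sigma2\|A_t^*y_t+B_{t+1}^*y_{t+1}+v_t+z_t-c_t(x_t')-Q_tw_t+\sigma^{-1}x_t\|^2-h_t(x_t')-\tfrac12\langle x_t',Q_tx_t'\rangle+\langle\nabla h_t(x_t'),x_t'\rangle-\tfrac1{2\sigma}\|x_t\|^2\Big).$$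 **Algorithm (SL-MDD).** Start from any $\varpi^0=(v^0_{1:T},w^0_{1:T},y^0_{1:T},z^0_{1:T},x^0_{1:T})$. Given $\varpi^k$, write $L^k=\widehat L^{x^k_{1:T}}_\sigma(\cdot\,;x^k_{1:T})$ and compute, each time minimizing $L^k$ over a single block: (1a) for $t=1,\dots,T$: $\tilde w_t^{k+1}\approx\arg\min_{w_t}L^k(v^k_{1:T},(\tilde w^{k+1}_{\le t-1},w_t,w^k_{\ge t+1}),y^k_{1:T},z^k_{1:T})$; (1b) for $t=1,\dots,T$: $v_t^{k+1}\approx\arg\min_{v_t}L^k((v^{k+1}_{\le t-1},v_t,v^k_{\ge t+1}),\tilde w^{k+1}_{1:T},y^k_{1:T},z^k_{1:T})$; (1c) for $t=T,\dots,1$: $w_t^{k+1}\approx\arg\min_{w_t}L^k(v^{k+1}_{1:T},(\tilde w^{k+1}_{\le t-1},w_t,w^{k+1}_{\ge t+1}),y^k_{1:T},z^k_{1:T})$; (2a) for $t=1,\dots,T$: $\tilde y_t^{k+1}\approx\arg\min_{y_t}L^k(v^{k+1}_{1:T},w^{k+1}_{1:T},(\tilde y^{k+1}_{\le t-1},y_t,y^k_{\ge t+1}),z^k_{1:T})$; (2b) for $t=1,\dots,T$: $z_t^{k+1}\approx\arg\min_{z_t}L^k(v^{k+1}_{1:T},w^{k+1}_{1:T},\tilde y^{k+1}_{1:T},(z^{k+1}_{\le t-1},z_t,z^k_{\ge t+1}))$; (2c) for $t=T,\dots,1$: $y_t^{k+1}\approx\arg\min_{y_t}L^k(v^{k+1}_{1:T},w^{k+1}_{1:T},(\tilde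 y^{k+1}_{\le t-1},y_t,y^{k+1}_{\ge t+1}),z^{k+1}_{1:T})$; (3) for $t=1,\dots,T$: $x_t^{k+1}=x_t^k+\tau\sigma\big(A_t^*y_t^{k+1}+B_{t+1}^*y_{t+1}^{k+1}+z_t^{k+1}+v_t^{k+1}-c_t(x_t^k)-Q_tw_t^{k+1}\big)$. Here ''$\approx$'' means inexact minimization: the partial subdifferential of $L^k$ with respect to the block being updated, evaluated at the computed block and the indicated values of the other blocks, contains a vector of norm at most $\varepsilon_k$. **KKT set.** $\bar\Omega_T$ is the set of $(v_{1:T},w_{1:T},y_{1:T},z_{1:T},x_{1:T})$ such that $A_1x_1=b_1$; $B_tx_{t-1}+A_tx_t=b_t$ for $2\le t\le T$; and for $1\le t\le T$: $\nabla h_t(x_t)-A_t^*y_t-B_{t+1}^*y_{t+1}-v_t-z_t=0$, $x_t\in\partial\theta_t^*(-v_t)$, $x_t\in\partial\delta^*_{\mathcal K_t}(-z_t)$, $w_t\in\mathcal W_t$, $Q_tw_t=Q_tx_t$. **The operators $P_x^k$.** For a point of $\bar\Omega_T$ with $x$-component $\bar x$ and an iterate $x^k=(x_1^k;\dots;x_T^k)$, $P_x^k$ is a self-adjoint operator in the convex hull of the generalized (Clarke) Hessians $\partial^2h$ at points of the segment $[\bar x,x^k]$ such that $\nabla h(x^k)-\nabla h(\bar x)=P_x^k(x^k-\bar x)$ and $Q\preceq P_x^k$ (such an operator exists by Clarke's mean value theorem and the lower bound defining $Q_t$). *)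

(* Defs.v *)
From HB Require Import structures.
From mathcomp Require Import all_boot all_order all_algebra.
From mathcomp Require Import all_classical all_reals all_analysis.
Set Implicit Arguments.
Unset Strict Implicit.
Unset Printing Implicit Defensive.
Import Order.TTheory GRing.Theory Num.Theory.
Import numFieldNormedType.Exports.
Local Open Scope classical_set_scope.
Local Open Scope ring_scope.

(* All finite-dimensional spaces are matrix spaces with the Frobenius inner
   product; the norm notation of the library is the sup norm there, hence the
   separate Euclidean norm [enorm]. *)
Section Euclidean.
Context {R : realType}.

Definition inner m n (x y : 'M[R]_(m, n)) : R := \sum_i \sum_j x i j * y i j.

Definition enorm m n (x : 'M[R]_(m, n)) : R := Num.sqrt (inner x x).

Definition adj m n p q (F : 'M[R]_(m, n) -> 'M[R]_(p, q)) (y : 'M[R]_(p, q)) :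
    'M[R]_(m, n) :=
  \matrix_(i, j) inner (F (delta_mx i j)) y.

Lemma adjP m n p q (F : {linear 'M[R]_(m, n) -> 'M[R]_(p, q)}) x y :
  inner (F x) y = inner x (adj F y).
Proof.
have innerDl (a b c : 'M[R]_(p, q)) : inner (a + b) c = inner a c + inner b c.
  rewrite /inner -big_split; apply: eq_bigr => i _; rewrite -big_split.
  by apply: eq_bigr => j _; rewrite mxE mulrDl.
have innerZl s (a c : 'M[R]_(p, q)) : inner (s *: a) c = s * inner a c.
  rewrite /inner big_distrr; apply: eq_bigr => i _; rewrite big_distrr.
  by apply: eq_bigr => j _; rewrite mxE /= mulrA.
have inner0l (c : 'M[R]_(p, q)) : inner 0 c = 0.
  by rewrite -[X in inner X c](scale0r c) innerZl mul0r.
have inner_suml I (r : seq I) (f : I -> 'M[R]_(p, q)) c :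
    inner (\sum_(k <- r) f k) c = \sum_(k <- r) inner (f k) c.
  by elim/big_rec2 : _ => [|k a b _ <-]; [exact: inner0l|exact: innerDl].
rewrite [in LHS](matrix_sum_delta x) linear_sum inner_suml.
apply: eq_bigr => i _; rewrite linear_sum inner_suml; apply: eq_bigr => j _.
by rewrite linearZ innerZl mxE.
Qed.

Definition self_adjoint m n (F : 'M[R]_(m, n) -> 'M[R]_(m, n)) : Prop :=
  forall x y, inner (F x) y = inner x (F y).

Definition pos_semidef m n (F : 'M[R]_(m, n) -> 'M[R]_(m, n)) : Prop :=
  forall x, 0 <= inner x (F x).

Definition pos_def m n (F : 'M[R]_(m, n) -> 'M[R]_(m, n)) : Prop :=
  forall x, x != 0 -> 0 < inner x (F x).

(* F \preceq G *)
Definition loewner_le m n (F G : 'M[R]_(m, n) -> 'M[R]_(m, n)) : Prop :=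
  pos_semidef (fun x => G x - F x).

Definition gradient m n (f : 'M[R]_(m, n) -> R) (x : 'M[R]_(m, n)) :
    'M[R]_(m, n) :=
  \matrix_(i, j) 'D_(delta_mx i j) (f : _ -> R^o) x.

Definition proper_fun m n (f : 'M[R]_(m, n) -> \bar R) : Prop :=
  (forall x, f x != -oo%E) /\ exists x, f x != +oo%E.

Definition convex_efun m n (f : 'M[R]_(m, n) -> \bar R) : Prop :=
  forall (x y : 'M[R]_(m, n)) (s : R), 0 <= s <= 1 ->
    (f (s *: x + (1 - s) *: y)%R <= s%:E * f x + (1 - s)%:E * f y)%E.

Definition fenchel m n (f : 'M[R]_(m, n) -> \bar R) (v : 'M[R]_(m, n)) :
    \bar R :=
  ereal_sup [set ((inner x v)%:E - f x)%E | x in [set: 'M[R]_(m, n)]].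

Definition indicator m n (C : set 'M[R]_(m, n)) (x : 'M[R]_(m, n)) : \bar R :=
  if `[< C x >] then 0%E else +oo%E.

Definition subdiff m n (f : 'M[R]_(m, n) -> \bar R) (x : 'M[R]_(m, n)) :
    set 'M[R]_(m, n) :=
  [set g | f x \is a fin_num /\
           forall x', (f x + (inner g (x' - x)%R)%:E <= f x')%E].

Lemma subdiff_cst_add m n (c : \bar R) (f : 'M[R]_(m, n) -> \bar R) x :
  c \is a fin_num -> subdiff (fun u => c + f u)%E x = subdiff f x.
Proof.
case: c => [c| |]// _; apply/seteqP; split=> g [fx fg]; split.
- by move: fx; case: (f x).
- by move=> x'; have := fg x'; rewrite -addeA leeD2lE.
- by move: fx; case: (f x).
- by move=> x'; rewrite -addeA leeD2lE.
Qed.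

Definition convex_hull (V : lmodType R) (S : set V) : set V :=
  [set u | exists n (c : 'I_n -> R) (s : 'I_n -> V),
     [/\ forall i, 0 <= c i, \sum_i c i = 1, forall i, S (s i)
       & u = \sum_i c i *: s i]].

(* Operators are functions between matrix spaces; pointwise convergence of
   linear operators in finite dimension is convergence in operator norm. *)
Definition bouligand_jacobian m n (G : 'M[R]_(m, n) -> 'M[R]_(m, n))
    (x : 'M[R]_(m, n)) : set ('M[R]_(m, n) -> 'M[R]_(m, n)) :=
  [set H | exists u : nat -> 'M[R]_(m, n),
     [/\ u i @[i --> \oo] --> x, forall i, differentiable G (u i)
       & forall e, 'd G (u i) e @[i --> \oo] --> H e]].

Definition clarke_hessian m n (f : 'M[R]_(m, n) -> R) (x : 'M[R]_(m, n)) :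
    set ('M[R]_(m, n) -> 'M[R]_(m, n)) :=
  convex_hull (bouligand_jacobian (gradient f) x).

Definition segment m n (x y : 'M[R]_(m, n)) : set 'M[R]_(m, n) :=
  [set x + s *: (y - x) | s in [set s : R | 0 <= s <= 1]].

End Euclidean.

(* Stages are numbered 0, ..., T-1 instead of 1, ..., T. [node N t] is the set
   of scenario nodes of stage [t] and [N t] the number of children of each of
   them, so that N_2, ..., N_T are [N 0], ..., [N T.-2]. *)
Fixpoint node (N : nat -> nat) (t : nat) : finType :=
  if t is s.+1 then (node N s * 'I_(N s))%type else unit.

Definition parent N t (k : node N t.+1) : node N t := k.1.

(* The families are indexed by all naturals, but only the entries of the stages
   t < stages are ever used. [Bmap] is indexed by the child nodes: its value at
   a node of stage [t.+1] acts on the decision of the parent at stage [t]. *)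
Record msp (R : realType) := MSP {
  stages : nat;
  xdim : nat;
  bdim : nat;
  branch : nat -> nat;
  theta : forall t, node branch t -> 'rV[R]_xdim -> \bar R;
  hfun : forall t, node branch t -> 'rV[R]_xdim -> R;
  Kset : forall t, node branch t -> set 'rV[R]_xdim;
  bvec : forall t, node branch t -> 'rV[R]_bdim;
  Amap : forall t, node branch t -> {linear 'rV[R]_xdim -> 'rV[R]_bdim};
  Bmap : forall t, node branch t.+1 -> {linear 'rV[R]_xdim -> 'rV[R]_bdim} }.

Section StageSpaces.
Context {R : realType} (P : msp R).

Notation T := (stages P).
Notation N := (branch P).

(* One row per scenario node. *)
Definition xspace (t : nat) : Type := 'M[R]_(#|node N t|, xdim P).
Definition yspace (t : nat) : Type := 'M[R]_(#|node N t|, bdim P).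

Definition at_node m t (x : 'M[R]_(#|node N t|, m)) (k : node N t) : 'rV[R]_m :=
  row (enum_rank k) x.

Definition prob (t : nat) : R := (\prod_(s < t) N s)%:R^-1.

Definition msp_standing : Prop :=
  [/\ (2 <= T)%N, (0 < xdim P)%N, (0 < bdim P)%N
    & forall t, (t.+1 < T)%N -> (0 < N t)%N] /\
  forall (t : 'I_T) (k : node N t),
  [/\ [/\ proper_fun (theta k), lower_semicontinuous (theta k)
        & convex_efun (theta k)],
      [/\ convex_function [set: convex_lmodType 'rV[R]_(xdim P)]
            (hfun k : _ -> R^o),
          forall x, differentiable (hfun k : _ -> R^o) x,
          continuous (gradient (hfun k))
        & [lipschitz (gradient (hfun k)) x | x in setT]]
    & [/\ Kset k !=set0, closed (Kset k)
        & convex_set (Kset k : set (convex_lmodType _))]].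

Definition theta_ t (x : xspace t) : \bar R :=
  ((prob t)%:E * \sum_(k : node N t) theta k (at_node x k))%E.

Definition h_ t (x : xspace t) : R :=
  prob t * \sum_(k : node N t) hfun k (at_node x k).

Definition K_ t : set (xspace t) :=
  [set x | forall k : node N t, Kset k (at_node x k)].

Definition b_ t : yspace t := \matrix_(i < #|node N t|) bvec (enum_val i).

Definition A_ t (x : xspace t) : yspace t :=
  \matrix_(i < #|node N t|) Amap (enum_val i) (at_node x (enum_val i)).

Definition B_ t (x : xspace t) : yspace t.+1 :=
  \matrix_(i < #|node N t.+1|)
    Bmap (enum_val i) (at_node x (parent (enum_val i))).

Definition xtuple : Type := forall t : 'I_T, xspace t.
Definition ytuple : Type := forall t : 'I_T, yspace t.

(* B_{t+1}^* y_{t+1}, and 0 at the last stage. *)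
Definition Badj_next (y : ytuple) (t : 'I_T) : xspace t :=
  match @idP (t.+1 < T)%N with
  | ReflectT lt_tT => adj (@B_ t) (y (Ordinal lt_tT))
  | ReflectF _ => 0
  end.

Record iterate := Iterate {
  it_v : xtuple; it_w : xtuple; it_y : ytuple; it_z : xtuple; it_x : xtuple }.

Definition constraint_qualification : Prop :=
  pos_def (fun y => A_ (adj (@A_ 0) y)) /\
  forall t, (t.+1 < T)%N ->
    pos_def (fun y => A_ (adj (@A_ t.+1) y) + B_ (adj (@B_ t) y)).

Definition xfull : Type := 'M[R]_(\sum_(t < T) #|node N t|, xdim P).

Definition stack (x : xtuple) : xfull := \mxcol_(t < T) x t.

Definition h_full (x : xfull) : R := \sum_(t < T) h_ (submxcol x t).

Section WithQ.
Variable Q : forall t : 'I_T, {linear xspace t -> xspace t}.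

Definition minorization : Prop :=
  forall t, [/\ self_adjoint (Q t), pos_semidef (Q t)
    & forall x x' : xspace t,
        h_ x' + inner (gradient (@h_ t) x') (x - x')
          + 2^-1 * inner (x - x') (Q t (x - x')) <= h_ x].

Definition W_ (t : 'I_T) : set (xspace t) := range (Q t).

Definition c_ (t : 'I_T) (x : xspace t) : xspace t :=
  gradient (@h_ t) x - Q t x.

Definition Qdiag (x : xfull) : xfull := \mxcol_(t < T) Q t (submxcol x t).

Definition dual_residual (x' : xtuple) (v w : xtuple) (y : ytuple) (z : xtuple)
    (t : 'I_T) : xspace t :=
  adj (@A_ t) (y t) + Badj_next y t + v t + z t - c_ (x' t) - Q t (w t).

Definition augL (sigma : R) (x' : xtuple) (v w : xtuple) (y : ytuple)
    (z : xtuple) (x : xtuple) : \bar R :=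
  (\sum_(t < T)
     (fenchel (@theta_ t) (- v t)%R + fenchel (indicator (@K_ t)) (- z t)%R
      + (2^-1 * inner (w t) (Q t (w t)))%R%:E + indicator (@W_ t) (w t)
      + (- inner (b_ t) (y t)
         + sigma / 2
           * enorm (dual_residual x' v w y z t + sigma^-1 *: x t) ^+ 2
         - h_ (x' t) - 2^-1 * inner (x' t) (Q t (x' t))
         + inner (gradient (@h_ t) (x' t)) (x' t)
         - (2 * sigma)^-1 * enorm (x t) ^+ 2)%R%:E))%E.

(* The finite-valued summands of [augL]. *)
Definition augL_fin (sigma : R) (x' : xtuple) (v w : xtuple) (y : ytuple)
    (z : xtuple) (x : xtuple) : R :=
  \sum_(t < T)
    (2^-1 * inner (w t) (Q t (w t))
     + (- inner (b_ t) (y t)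
        + sigma / 2
          * enorm (dual_residual x' v w y z t + sigma^-1 *: x t) ^+ 2
        - h_ (x' t) - 2^-1 * inner (x' t) (Q t (x' t))
        + inner (gradient (@h_ t) (x' t)) (x' t)
        - (2 * sigma)^-1 * enorm (x t) ^+ 2)).

(* [augL] as a function of a single block, without the extended-valued summands
   of the other blocks. Those are constant in the block, so that the partial
   subdifferential of [augL] is the subdifferential of these functions (lemmas
   [psubdiff_*]). Dropping them matters only when one of them is +oo, as at a
   starting point outside the domain of [augL], where [augL] is +oo identically
   in the block. *)
Definition augL_v sigma x' (v w : xtuple) (y : ytuple) (z x : xtuple)
    (t : 'I_T) (u : xspace t) : \bar R :=
  (fenchel (@theta_ t) (- u)%R
   + (augL_fin sigma x' (eqtype.dfwith v u) w y z x)%:E)%E.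

Definition augL_w sigma x' (v w : xtuple) (y : ytuple) (z x : xtuple)
    (t : 'I_T) (u : xspace t) : \bar R :=
  (indicator (@W_ t) u + (augL_fin sigma x' v (eqtype.dfwith w u) y z x)%:E)%E.

Definition augL_y sigma x' (v w : xtuple) (y : ytuple) (z x : xtuple)
    (t : 'I_T) (u : yspace t) : \bar R :=
  (augL_fin sigma x' v w (eqtype.dfwith y u) z x)%:E.

Definition augL_z sigma x' (v w : xtuple) (y : ytuple) (z x : xtuple)
    (t : 'I_T) (u : xspace t) : \bar R :=
  (fenchel (indicator (@K_ t)) (- u)%R
   + (augL_fin sigma x' v w y (eqtype.dfwith z u) x)%:E)%E.

Definition nonsmooth_v (D : pred 'I_T) (v : xtuple) : \bar R :=
  (\sum_(t < T | D t) fenchel (@theta_ t) (- v t)%R)%E.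
Definition nonsmooth_w (D : pred 'I_T) (w : xtuple) : \bar R :=
  (\sum_(t < T | D t) indicator (@W_ t) (w t))%E.
Definition nonsmooth_z (D : pred 'I_T) (z : xtuple) : \bar R :=
  (\sum_(t < T | D t) fenchel (indicator (@K_ t)) (- z t)%R)%E.

Lemma augLE sigma x' v w y z x :
  augL sigma x' v w y z x =
  (nonsmooth_v xpredT v + nonsmooth_w xpredT w + nonsmooth_z xpredT z
   + (augL_fin sigma x' v w y z x)%:E)%E.
Proof.
rewrite /nonsmooth_v /nonsmooth_w /nonsmooth_z /augL_fin -sumEFin -!big_split.
apply: eq_bigr => t _ /=; rewrite [in RHS]EFinD [in RHS]addeA.
congr (_ + _)%E; rewrite [in LHS]addeAC; congr (_ + _)%E.
by rewrite addeAC.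
Qed.

Lemma dfwith_sum (I : finType) (X : I -> Type) (F : forall i, X i -> \bar R)
    (f : forall i, X i) i (u : X i) :
  (\sum_j F j (eqtype.dfwith f u j) = F i u + \sum_(j | j != i) F j (f j))%E.
Proof.
rewrite (bigD1 i)//= dfwith_in; congr (_ + _)%E.
by apply: eq_bigr => j ji; rewrite dfwith_out// eq_sym.
Qed.

Lemma psubdiff_v sigma x' (v w : xtuple) (y : ytuple) (z x : xtuple)
    (t : 'I_T) u :
  (nonsmooth_v (fun s => s != t) v + nonsmooth_w xpredT w
   + nonsmooth_z xpredT z)%E \is a fin_num ->
  subdiff (fun u : xspace t => augL sigma x' (eqtype.dfwith v u) w y z x) u =
  subdiff (@augL_v sigma x' v w y z x t) u.
Proof.
move=> /subdiff_cst_add E; rewrite -[RHS]E.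
congr (subdiff _ u); apply/funext => u'.
rewrite augLE /augL_v.
have -> : nonsmooth_v xpredT (eqtype.dfwith v u') =
    (fenchel (@theta_ t) (- u')%R + nonsmooth_v (fun s => s != t) v)%E.
  exact: (dfwith_sum (fun (t : 'I_T) (a : xspace t) =>
    fenchel (@theta_ t) (- a)%R)).
rewrite [in RHS]addeA; congr (_ + _)%E.
by rewrite [in RHS]addeC !addeA.
Qed.

Lemma psubdiff_w sigma x' (v w : xtuple) (y : ytuple) (z x : xtuple)
    (t : 'I_T) u :
  (nonsmooth_v xpredT v + nonsmooth_w (fun s => s != t) w
   + nonsmooth_z xpredT z)%E \is a fin_num ->
  subdiff (fun u : xspace t => augL sigma x' v (eqtype.dfwith w u) y z x) u =
  subdiff (@augL_w sigma x' v w y z x t) u.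
Proof.
move=> /subdiff_cst_add E; rewrite -[RHS]E.
congr (subdiff _ u); apply/funext => u'.
rewrite augLE /augL_w.
have -> : nonsmooth_w xpredT (eqtype.dfwith w u') =
    (indicator (@W_ t) u' + nonsmooth_w (fun s => s != t) w)%E.
  exact: (dfwith_sum (fun (t : 'I_T) (a : xspace t) =>
    indicator (@W_ t) a)).
rewrite [in RHS]addeA; congr (_ + _)%E.
rewrite [in RHS]addeAC; congr (_ + _)%E.
by rewrite -[in RHS]addeA; congr (_ + _)%E; exact: addeC.
Qed.

Lemma psubdiff_y sigma x' (v w : xtuple) (y : ytuple) (z x : xtuple)
    (t : 'I_T) u :
  (nonsmooth_v xpredT v + nonsmooth_w xpredT w
   + nonsmooth_z xpredT z)%E \is a fin_num ->
  subdiff (fun u : yspace t => augL sigma x' v w (eqtype.dfwith y u) z x) u =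
  subdiff (@augL_y sigma x' v w y z x t) u.
Proof.
move=> /subdiff_cst_add E; rewrite -[RHS]E.
congr (subdiff _ u); apply/funext => u'.
exact: augLE.
Qed.

Lemma psubdiff_z sigma x' (v w : xtuple) (y : ytuple) (z x : xtuple)
    (t : 'I_T) u :
  (nonsmooth_v xpredT v + nonsmooth_w xpredT w
   + nonsmooth_z (fun s => s != t) z)%E \is a fin_num ->
  subdiff (fun u : xspace t => augL sigma x' v w y (eqtype.dfwith z u) x) u =
  subdiff (@augL_z sigma x' v w y z x t) u.
Proof.
move=> /subdiff_cst_add E; rewrite -[RHS]E.
congr (subdiff _ u); apply/funext => u'.
rewrite augLE /augL_z.
have -> : nonsmooth_z xpredT (eqtype.dfwith z u') =
    (fenchel (indicator (@K_ t)) (- u')%R + nonsmooth_z (fun s => s != t) z)%E.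
  exact: (dfwith_sum (fun (t : 'I_T) (a : xspace t) =>
    fenchel (indicator (@K_ t)) (- a)%R)).
rewrite [in RHS]addeA; congr (_ + _)%E.
by rewrite -[in RHS]addeA; congr (_ + _)%E; exact: addeC.
Qed.

Definition approx_argmin m n (eps : R) (f : 'M[R]_(m, n) -> \bar R)
    (u : 'M[R]_(m, n)) : Prop :=
  exists2 g, subdiff f u g & enorm g <= eps.

(* The tuple with the entries of [lo] before stage [t] and of [hi] from [t] on;
   the entry at [t] itself is always overwritten by the block variable. *)
Definition splice (X : 'I_T -> Type) (lo hi : forall t, X t) (t : 'I_T) :
    forall s, X s :=
  fun s => if (s < t)%N then lo s else hi s.

Definition slmdd_step (sigma tau eps : R) (p p' : iterate) : Prop :=
  let x := it_x p in
  exists (wt : xtuple) (yt : ytuple),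
  [/\ forall t, approx_argmin eps
        (@augL_w sigma x (it_v p) (splice wt (it_w p) t)
           (it_y p) (it_z p) x t) (wt t),
      forall t, approx_argmin eps
        (@augL_v sigma x (splice (it_v p') (it_v p) t) wt
           (it_y p) (it_z p) x t) (it_v p' t)
    & forall t, approx_argmin eps
        (@augL_w sigma x (it_v p') (splice wt (it_w p') t)
           (it_y p) (it_z p) x t) (it_w p' t)] /\
  [/\ forall t, approx_argmin eps
        (@augL_y sigma x (it_v p') (it_w p') (splice yt (it_y p) t)
           (it_z p) x t) (yt t),
      forall t, approx_argmin eps
        (@augL_z sigma x (it_v p') (it_w p') yt
           (splice (it_z p') (it_z p) t) x t) (it_z p' t),
      forall t, approx_argmin eps
        (@augL_y sigma x (it_v p') (it_w p') (splice yt (it_y p') t)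
           (it_z p') x t) (it_y p' t)
    & forall t, it_x p' t = x t + (tau * sigma) *:
        dual_residual x (it_v p') (it_w p') (it_y p') (it_z p') t].

Definition kkt_set : set iterate :=
  [set p | [/\ forall t : 'I_T, t = 0%N :> nat -> A_ (it_x p t) = b_ t,
      forall t (lt_tT : (t.+1 < T)%N),
        B_ (it_x p (Ordinal (ltnW lt_tT))) + A_ (it_x p (Ordinal lt_tT))
        = b_ t.+1
    & forall t : 'I_T,
      [/\ gradient (@h_ t) (it_x p t) - adj (@A_ t) (it_y p t)
            - Badj_next (it_y p) t - it_v p t - it_z p t = 0,
          subdiff (fenchel (@theta_ t)) (- it_v p t) (it_x p t),
          subdiff (fenchel (indicator (@K_ t))) (- it_z p t) (it_x p t),
          @W_ t (it_w p t)
        & Q t (it_w p t) = Q t (it_x p t)]]].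

Definition mean_value_hessian (x xbar : xfull) (H : {linear xfull -> xfull}) :
    Prop :=
  [/\ self_adjoint H,
      convex_hull
        (\bigcup_(z in segment xbar x) clarke_hessian h_full z) (H : _ -> _),
      gradient h_full x - gradient h_full xbar = H (x - xbar)
    & loewner_le Qdiag H].

End WithQ.

Definition iterates_cvg (p : nat -> iterate) (pbar : iterate) : Prop :=
  forall t : 'I_T,
  [/\ it_v (p k) t @[k --> \oo] --> it_v pbar t,
      it_w (p k) t @[k --> \oo] --> it_w pbar t,
      it_y (p k) t @[k --> \oo] --> it_y pbar t,
      it_z (p k) t @[k --> \oo] --> it_z pbar t
    & it_x (p k) t @[k --> \oo] --> it_x pbar t].

End StageSpaces.

(* Main.v *)
(** The method is an inexact symmetric Gauss-Seidel ADMM for the majorized dual.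
    Within each of the two blocks [(v, w)] and [(y, z)], the two sweeps produce
    the exact minimizer of the augmented Lagrangian plus a proximal term, up to
    an error of order [eps_k]: with [A A^* = D + L + L^*] the proximal operator
    of the second block is [sigma N^* D^-1 N], [N (y, z) = L^* y + A z].

    For a KKT point with components [xb], [qb] ([q := A^* y + z]), ..., a
    Lyapunov function combining [|x_k - xb|^2], [|q_k - qb|^2], the two
    proximal seminorms and [|r_k|^2] ([r_k] the dual residual) decreases up to a
    summable error. The gradient of [h] is evaluated at the old [x_k]; the cross
    term this creates is controlled by [G = P_x - Q <= (2 alpha / sigma) I], which
    costs a factor [1 - alpha] in the usual ADMM estimate and explains the bound
    on [tau]. Boundedness, an ultrafilter limit (which is a KKT point because the
    graphs of the subdifferentials are closed), and the same Lyapunov function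
    at that limit point give the convergence of the whole sequence. *)
Require Import Defs.
From HB Require Import structures.
From mathcomp Require Import all_boot all_order all_algebra.
From mathcomp Require Import all_classical all_reals all_analysis.
From mathcomp Require Import ring lra.
Set Implicit Arguments.
Unset Strict Implicit.
Unset Printing Implicit Defensive.
Import Order.TTheory GRing.Theory Num.Theory.
Import numFieldNormedType.Exports.
Local Open Scope classical_set_scope.
Local Open Scope ring_scope.

(** * Euclidean structure of matrix spaces *)

(** The descent estimate of one step contains [|r + q - q'|^2], whose cross term [<r, q' - q>] has
    no sign. It is bounded by subtracting the [(y, z)] optimality conditions of two consecutive
    steps, so the Lyapunov function belongs to a pair of iterates and keeps the residual and the
    proximal length of the last move. The loss is exactly [alpha] because an operator
    [0 <= G <= c I] is cocoercive, [|G x|^2 <= c <x, G x>]: the nonnegative term [<x, G x>] then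
    pays for completing a square. The tolerances multiply distances to the KKT point, about which
    nothing is known beforehand. These distances are at most linear in the square root of the
    Lyapunov function, so the recursion closes by a discrete Gronwall argument. The Lyapunov
    function sees [v] only through a seminorm, [w] not at all, and [y], [z] only through [q] and
    [N (y, z)]. The missing norms are recovered from the injectivity of [D + L] for [y], from [w]
    lying in the range of [Q], and from the definition of the residual for [v]. *)

Section InnerTheory.
Context {R : realType}.

Section Fixed.
Variables m n : nat.
Implicit Types x y z : 'M[R]_(m, n).

Lemma innerC x y : inner x y = inner y x.
Proof. by apply: eq_bigr => i _; apply: eq_bigr => j _; rewrite mulrC. Qed.

Lemma innerDl x y z : inner (x + y) z = inner x z + inner y z.
Proof.
rewrite /inner -big_split; apply: eq_bigr => i _; rewrite -big_split.
by apply: eq_bigr => j _; rewrite mxE mulrDl.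
Qed.

Lemma innerZl s x z : inner (s *: x) z = s * inner x z.
Proof.
rewrite /inner big_distrr; apply: eq_bigr => i _; rewrite big_distrr.
by apply: eq_bigr => j _; rewrite mxE /= mulrA.
Qed.

Lemma innerNl x z : inner (- x) z = - inner x z.
Proof. by rewrite -scaleN1r innerZl mulN1r. Qed.

Lemma inner0l z : inner 0 z = 0.
Proof. by rewrite -(scale0r z) innerZl mul0r. Qed.

Lemma innerDr x y z : inner z (x + y) = inner z x + inner z y.
Proof. by rewrite innerC innerDl !(innerC z). Qed.

Lemma innerZr s x z : inner z (s *: x) = s * inner z x.
Proof. by rewrite innerC innerZl (innerC z). Qed.

Lemma innerNr x z : inner z (- x) = - inner z x.
Proof. by rewrite innerC innerNl (innerC z). Qed.

Lemma inner0r z : inner z 0 = 0.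
Proof. by rewrite innerC inner0l. Qed.

Definition innerE :=
  (innerDl, innerDr, innerNl, innerNr, innerZl, innerZr, inner0l, inner0r).

Lemma inner_ge0 x : 0 <= inner x x.
Proof. by apply: sumr_ge0 => i _; apply: sumr_ge0 => j _; rewrite -expr2 sqr_ge0. Qed.

Lemma inner_eq0 x : inner x x = 0 -> x = 0.
Proof.
move=> /eqP; rewrite psumr_eq0 => [/allP h|i _]; last first.
  by apply: sumr_ge0 => j _; rewrite -expr2 sqr_ge0.
apply/matrixP => i j; rewrite mxE; have := h i (mem_index_enum i).
rewrite implyTb psumr_eq0 => [/allP/(_ j (mem_index_enum j))|k _]; last first.
  by rewrite -expr2 sqr_ge0.
by rewrite implyTb mulf_eq0 orbb => /eqP.
Qed.

Lemma innerP x y : (forall z, inner x z = inner y z) -> x = y.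
Proof.
move=> h; apply/subr0_eq/inner_eq0; rewrite innerDl innerNl h; exact: subrr.
Qed.

Lemma enorm_ge0 x : 0 <= enorm x.
Proof. exact: sqrtr_ge0. Qed.

Lemma enorm_sqr x : enorm x ^+ 2 = inner x x.
Proof. by rewrite sqr_sqrtr// inner_ge0. Qed.

Lemma enorm_le x c : 0 <= c -> inner x x <= c ^+ 2 -> enorm x <= c.
Proof. by move=> c0 h; rewrite -(@ler_pXn2r _ 2)// ?nnegrE ?enorm_ge0// enorm_sqr. Qed.

Lemma cauchy_schwarz x y : `|inner x y| <= enorm x * enorm y.
Proof.
rewrite -(@ler_pXn2r _ 2)// ?nnegrE ?mulr_ge0 ?enorm_ge0// real_normK ?num_real//.
rewrite exprMn !enorm_sqr.
have [y0|y0] := eqVneq (inner y y) 0.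
  by rewrite (inner_eq0 y0) !inner0r expr0n mulr0.
have yp : 0 < inner y y by rewrite lt_neqAle eq_sym y0 inner_ge0.
have := inner_ge0 (inner y y *: x - inner x y *: y); rewrite !innerE (innerC y x).
set a := inner x x; set b := inner y y in yp *; set c := inner x y.
move=> h; rewrite -subr_ge0 -(pmulr_rge0 _ yp); lra.
Qed.

Lemma inner_le x y : inner x y <= enorm x * enorm y.
Proof. exact: le_trans (ler_norm _) (cauchy_schwarz x y). Qed.

Lemma enormD x y : enorm (x + y) <= enorm x + enorm y.
Proof.
apply: enorm_le; first by rewrite addr_ge0 ?enorm_ge0.
rewrite !innerE (innerC y x) sqrrD !enorm_sqr.
have := inner_le x y; lra.
Qed.

Lemma enormZ s x : enorm (s *: x) = `|s| * enorm x.
Proof. by rewrite /enorm !innerE mulrA -expr2 sqrtrM ?sqr_ge0// sqrtr_sqr. Qed.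

Lemma enormN x : enorm (- x) = enorm x.
Proof. by rewrite -scaleN1r enormZ normrN1 mul1r. Qed.

Lemma enormB x y : enorm (x - y) <= enorm x + enorm y.
Proof. by rewrite -(enormN y); exact: enormD. Qed.

Lemma enorm0 : enorm (0 : 'M[R]_(m, n)) = 0.
Proof. by rewrite /enorm inner0l sqrtr0. Qed.

Lemma coord_le_enorm x i j : `|x i j| <= enorm x.
Proof.
rewrite -(@ler_pXn2r _ 2)// ?nnegrE ?enorm_ge0// real_normK ?num_real// enorm_sqr.
rewrite /inner (bigD1 i)//= (bigD1 j)//= -expr2 -addrA lerDl addr_ge0//.
  by apply: sumr_ge0 => k _; rewrite -expr2 sqr_ge0.
by apply: sumr_ge0 => l _; apply: sumr_ge0 => k _; rewrite -expr2 sqr_ge0.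
Qed.

End Fixed.

Definition linear_pack m n p q (f : 'M[R]_(m, n) -> 'M[R]_(p, q))
    (fl : linear f) : {linear 'M[R]_(m, n) -> 'M[R]_(p, q)} :=
  HB.pack f (GRing.isLinear.Build R _ _ *:%R f fl).

Lemma adj_is_linear m n p q (f : {linear 'M[R]_(m, n) -> 'M[R]_(p, q)}) :
  linear (adj f).
Proof. by move=> s x y; apply: innerP => z; rewrite !innerE ![inner (adj _ _) _]innerC -!adjP !innerE. Qed.

Lemma lin_bounded m n p q (f : {linear 'M[R]_(m, n) -> 'M[R]_(p, q)}) :
  exists2 C, 0 <= C & forall x, enorm (f x) <= C * enorm x.
Proof.
exists (\sum_i \sum_j enorm (f (delta_mx i j))).
  by apply: sumr_ge0 => i _; apply: sumr_ge0 => j _; exact: enorm_ge0.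
move=> x; have esum I (r : seq I) (F : I -> 'M[R]_(p, q)) :
    enorm (\sum_(i <- r) F i) <= \sum_(i <- r) enorm (F i).
  elim/big_ind2 : _ => [|a b c d ab cd|//]; first by rewrite enorm0.
  by apply: le_trans (enormD _ _) _; exact: lerD.
rewrite [in X in X <= _](matrix_sum_delta x) linear_sum mulr_suml.
apply: le_trans (esum _ _ _) _; apply: ler_sum => i _.
rewrite linear_sum mulr_suml; apply: le_trans (esum _ _ _) _.
apply: ler_sum => j _; rewrite linearZ enormZ mulrC.
by apply: ler_wpM2l; [exact: enorm_ge0|exact: coord_le_enorm].
Qed.

(** Obtained from the pseudo-inverse of the matrix of [f]. It serves to bound preimages, to invert
    definite operators and to see that ranges are closed. *)
Lemma lin_pseudo_inverse m n p q (f : {linear 'M[R]_(m, n) -> 'M[R]_(p, q)}) :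
  exists g : {linear 'M[R]_(p, q) -> 'M[R]_(m, n)}, forall x, f (g (f x)) = f x.
Proof.
pose g y : 'M[R]_(m, n) := vec_mx (mxvec y *m pinvmx (lin_mx f)).
have gl : linear g by move=> s x y; rewrite /g !linearP mulmxDl linearD /= -scalemxAl linearZ.
exists (linear_pack gl) => x /=; apply: (can_inj mxvecK).
rewrite -mul_vec_lin /g vec_mxK -mul_vec_lin mulmxKpV//; exact: submxMl.
Qed.

(** Since [x - g (f x)] lies in the kernel of [f], hence of [h], one has [h x = h (g (f x))]. This
    turns injectivity statements into the quantitative bounds used below. *)
Lemma lin_ker_le m n p q r s (f : {linear 'M[R]_(m, n) -> 'M[R]_(p, q)})
    (h : {linear 'M[R]_(m, n) -> 'M[R]_(r, s)}) :
  (forall x, f x = 0 -> h x = 0) ->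
  exists2 C, 0 <= C & forall x, enorm (h x) <= C * enorm (f x).
Proof.
move=> fh; have [g fg] := lin_pseudo_inverse f.
have [C C0 hC] := lin_bounded h; have [D D0 gD] := lin_bounded g.
exists (C * D); first exact: mulr_ge0.
move=> x; have /fh : f (x - g (f x)) = 0 by rewrite linearB /= fg subrr.
rewrite linearB /= => /subr0_eq ->; apply: le_trans (hC _) _.
by rewrite -mulrA; apply: ler_wpM2l.
Qed.

(** Nonnegativity of the form at [x - c^-1 S x], combined with the upper bound at [S x]. The main
    application is [S = P_x - Q] with [c = 2 alpha / sigma]. *)
Lemma psd_cocoercive m n (S : {linear 'M[R]_(m, n) -> 'M[R]_(m, n)}) c x :
  self_adjoint S -> pos_semidef S -> 0 < c ->
  (forall y, inner y (S y) <= c * inner y y) ->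
  inner (S x) (S x) <= c * inner x (S x).
Proof.
move=> Ss Sp c0 Sc; set y := S x.
have SZ t u : S (t *: u) = t *: S u by exact: linearZ.
have h := Sp (x - c^-1 *: y).
rewrite linearB SZ !innerE -/y in h; rewrite -(Ss x y) -/y in h.
have yy := Sc y; set t := c^-1 in h.
have t0 : 0 < t by rewrite invr_gt0.
have tC : t * c = 1 by rewrite mulVf// gt_eqF.
have tt : t * (t * inner y (S y)) <= t * inner y y.
  apply: (ler_wpM2l (ltW t0)).
  have := ler_wpM2l (ltW t0) yy; rewrite mulrA tC mul1r; exact.
have : t * inner y y <= inner x y by lra.
by move=> /(ler_wpM2l (ltW c0)); rewrite mulrA [_ * t]mulrC tC mul1r.
Qed.

Lemma psd_image_le m n (S : {linear 'M[R]_(m, n) -> 'M[R]_(m, n)}) :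
  self_adjoint S -> pos_semidef S ->
  exists2 C, 0 <= C & forall x, inner (S x) (S x) <= C * inner x (S x).
Proof.
move=> Ss Sp; have [C C0 SC] := lin_bounded S.
have Cp : 0 < C + 1 by rewrite ltr_wpDl.
exists (C + 1) => [|x]; first exact: ltW.
apply: psd_cocoercive => // y; apply: le_trans (inner_le _ _) _.
rewrite -enorm_sqr expr2 mulrC mulrA; apply: ler_wpM2r; first exact: enorm_ge0.
apply: le_trans (SC y) _; apply: ler_wpM2r; first exact: enorm_ge0.
by rewrite lerDl.
Qed.

(** Definiteness makes [D] injective, so its generalized inverse is a genuine one. It is applied to
    the block diagonal of the Gram operator and to [I + sigma Q]. *)
Lemma posdef_inverse m n (D : {linear 'M[R]_(m, n) -> 'M[R]_(m, n)}) :
  self_adjoint D -> pos_def D ->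
  exists K : {linear 'M[R]_(m, n) -> 'M[R]_(m, n)},
    [/\ cancel D K, cancel K D, self_adjoint K & pos_def K].
Proof.
move=> Ds Dp; have [K DK] := lin_pseudo_inverse D.
have D0 x : D x = 0 -> x = 0.
  by move=> Dx; apply/eqP/negPn/negP => /Dp; rewrite Dx inner0r ltxx.
have KD : cancel D K.
  by move=> x; apply/subr0_eq/D0; rewrite linearB /= DK subrr.
have Ka : adj K =1 K.
  move=> x; rewrite -[LHS]KD; congr (K _).
  by apply: innerP => u; rewrite Ds innerC -adjP KD innerC.
have Ks : self_adjoint K by move=> x y; rewrite adjP Ka.
have DKc : cancel K D.
  by move=> x; apply: innerP => u; rewrite Ds Ks KD.
exists K; split => // x x0; rewrite -{1}(DKc x) Ds; rewrite -Ds innerC.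
by apply: Dp; apply: contra_neq x0 => Kx; rewrite -(DKc x) Kx linear0.
Qed.

End InnerTheory.

(** * Convergence of matrices along filters *)

Section MatrixFilters.
Context {R : realType} {T : Type} {F : set_system T} {FF : Filter F}.

Lemma mx_cvgP m n (u : T -> 'M[R]_(m, n))
    (l : 'M[R]_(m, n)) :
  u @ F --> l <-> forall i j, u k i j @[k --> F] --> l i j.
Proof.
split=> [ul i j|ul].
  exact: (cvg_comp _ _ ul (@coord_continuous R m n i j l)).
apply/cvg_ballP => e e0.
have : \forall k \near F, forall i j, ball (l i j) e (u k i j).
  apply: filter_forall => i; apply: filter_forall => j.
  by move/cvg_ballP : (ul i j); apply.
by apply: filterS => k h; split.
Qed.

Lemma mx_cvgD m n (u w : T -> 'M[R]_(m, n)) (l p : 'M[R]_(m, n)) :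
  u @ F --> l -> w @ F --> p -> u k + w k @[k --> F] --> l + p.
Proof.
move=> /mx_cvgP ul /mx_cvgP wp; apply/mx_cvgP => i j; rewrite mxE.
by under eq_fun => k do rewrite mxE; exact: cvgD.
Qed.

Lemma mx_cvgZ m n (s : T -> R) (u : T -> 'M[R]_(m, n)) (s' : R) (l : 'M[R]_(m, n)) :
  s @ F --> s' -> u @ F --> l -> s k *: u k @[k --> F] --> s' *: l.
Proof.
move=> ss /mx_cvgP ul; apply/mx_cvgP => i j; rewrite mxE.
by under eq_fun => k do rewrite mxE; exact: cvgM.
Qed.

Lemma mx_cvgN m n (u : T -> 'M[R]_(m, n)) (l : 'M[R]_(m, n)) :
  u @ F --> l -> - u k @[k --> F] --> - l.
Proof.
move=> ul; rewrite -scaleN1r; under eq_fun => k do rewrite -scaleN1r.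
by apply: mx_cvgZ => //; exact: cvg_cst.
Qed.

Lemma mx_cvgB m n (u w : T -> 'M[R]_(m, n)) (l p : 'M[R]_(m, n)) :
  u @ F --> l -> w @ F --> p -> u k - w k @[k --> F] --> l - p.
Proof. by move=> ul wp; apply: mx_cvgD => //; exact: mx_cvgN. Qed.

Lemma cvg_inner m n (u w : T -> 'M[R]_(m, n))
    (l p : 'M[R]_(m, n)) :
  u @ F --> l -> w @ F --> p -> inner (u k) (w k) @[k --> F] --> inner l p.
Proof.
move=> /mx_cvgP ul /mx_cvgP wp.
rewrite /inner; apply: cvg_big => [|i _]; first exact: add_continuous.
apply: cvg_big => [|j _]; first exact: add_continuous.
exact: cvgM.
Qed.

Lemma cvg_lin m n p q (f : {linear 'M[R]_(m, n) -> 'M[R]_(p, q)})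
    (u : T -> 'M[R]_(m, n)) (l : 'M[R]_(m, n)) :
  u @ F --> l -> f (u k) @[k --> F] --> f l.
Proof.
move=> ul; apply/mx_cvgP => i j.
(* Through the adjoint, every entry of [f x] is the inner product of [x] with a fixed matrix. *)
have e (y : 'M[R]_(p, q)) : y i j = inner y (delta_mx i j).
  rewrite /inner (bigD1 i)//= (bigD1 j)//= mxE !eqxx mulr1 !big1 ?addr0//.
    by move=> a ai; rewrite big1// => b _; rewrite mxE (negbTE ai) mulr0.
  by move=> b bj; rewrite mxE eqxx (negbTE bj) mulr0.
rewrite e (adjP f).
under eq_fun => k do rewrite e (adjP f).
by apply: cvg_inner => //; exact: cvg_cst.
Qed.

Lemma cvg_lin0 m n p q (f : {linear 'M[R]_(m, n) -> 'M[R]_(p, q)})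
    (u : T -> 'M[R]_(m, n)) :
  u @ F --> (0 : 'M[R]_(m, n)) -> f (u k) @[k --> F] --> (0 : 'M[R]_(p, q)).
Proof. by rewrite -[X in _ -> _ --> X](linear0 f); exact: cvg_lin. Qed.

Lemma cvg_inner0 m n (u w : T -> 'M[R]_(m, n)) (p : 'M[R]_(m, n)) :
  u @ F --> (0 : 'M[R]_(m, n)) -> w @ F --> p ->
  inner (u k) (w k) @[k --> F] --> 0.
Proof. by move=> u0 wp; have := cvg_inner u0 wp; rewrite inner0l. Qed.

Lemma mx_cvg_enorm m n (u : T -> 'M[R]_(m, n))
    (l : 'M[R]_(m, n)) :
  u @ F --> l <-> enorm (u k - l) @[k --> F] --> 0.
Proof.
split=> [ul|ul].
  have ul0 : u k - l @[k --> F] --> (0 : 'M[R]_(m, n)).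
    by rewrite -(subrr l); apply: mx_cvgB => //; exact: cvg_cst.
  have := cvg_inner ul0 ul0; rewrite inner0l => h.
  have := cvg_comp _ _ h (@sqrt_continuous R 0); rewrite sqrtr0; exact.
apply/mx_cvgP => i j; apply/cvgrPdist_le => e e0.
move/cvgrPdist_le : ul => /(_ e e0); apply: filterS => k.
rewrite sub0r normrN ger0_norm ?enorm_ge0// distrC; apply: le_trans.
by have := coord_le_enorm (u k - l) i j; rewrite !mxE.
Qed.

Lemma mx_cvg_le m n (u : T -> 'M[R]_(m, n)) (l : 'M[R]_(m, n)) (v : T -> R) :
  (forall k, enorm (u k - l) <= v k) -> v @ F --> 0 -> u @ F --> l.
Proof.
move=> uv v0; apply/mx_cvg_enorm.
apply: (squeeze_cvgr (nearW _ _) (cvg_cst 0) v0) => k.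
by rewrite enorm_ge0 uv.
Qed.

Lemma mx_cvg0_sqr m n (u : T -> 'M[R]_(m, n)) (v : T -> R) :
  (forall k, inner (u k) (u k) <= v k) -> v @ F --> 0 ->
  u @ F --> (0 : 'M[R]_(m, n)).
Proof.
move=> uv v0; apply: (@mx_cvg_le _ _ _ _ (fun k => Num.sqrt (v k))) => [k|].
  by rewrite subr0; apply: ler_wsqrtr.
by have := cvg_comp _ _ v0 (@sqrt_continuous R 0); rewrite sqrtr0.
Qed.

End MatrixFilters.
Arguments cvg_lin {R T F FF m n p q} f {u l}.
Arguments cvg_lin0 {R T F FF m n p q} f {u}.

Lemma mx_cvg_unique {R : realType} {T : Type} (F : set_system T) m n
    (u : T -> 'M[R]_(m, n)) (l p : 'M[R]_(m, n)) :
  ProperFilter F -> u @ F --> l -> u @ F --> p -> l = p.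
Proof.
move=> FF /mx_cvgP ul /mx_cvgP up; apply/matrixP => i j.
exact: (@cvg_unique _ (@Rhausdorff R) _ _ _ _ (ul i j) (up i j)).
Qed.

(** * Limits along ultrafilters *)

Section UltraLimits.
Context {R : realType}.

Lemma ultra_fmap (T S : Type) (f : T -> S) (U : set_system T) :
  UltraFilter U -> UltraFilter (f @ U).
Proof.
move=> UU; split; first exact: fmap_proper_filter.
move=> G GP fUG; apply/seteqP; split => // A GA.
have [//|UA] := in_ultra_setVsetC (f @^-1` A) UU.
have /filter_ex[x [//]] : G (A `&` ~` A) by apply: filterI => //; exact: fUG.
Qed.

(** Each entry stays in the compact interval [[-C, C]], where every ultrafilter converges. One
    ultrafilter thus serves all the sequences at once, without successive extractions. *)
Lemma bounded_ultra_cvg (T : Type) (U : set_system T) m n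
    (u : T -> 'M[R]_(m, n)) C :
  UltraFilter U -> (forall k, enorm (u k) <= C) ->
  exists l : 'M[R]_(m, n), u @ U --> l.
Proof.
move=> UU uC.
have coord i j : exists l : R, u k i j @[k --> U] --> l.
  have := @segment_compact R (- C) C; rewrite compact_ultra => cpt.
  have /cpt[|l [_ ul]] := ultra_fmap (fun k => u k i j) UU; last by exists l.
  apply: (@filterE _ U) => k /=.
  rewrite in_itv /= -ler_norml; exact: le_trans (coord_le_enorm _ _ _) (uC k).
exists (\matrix_(i, j) xget 0 [set l : R | u k i j @[k --> U] --> l]).
apply/mx_cvgP => i j; rewrite mxE.
exact: (@xgetPex _ 0 [set l : R | u k i j @[k --> U] --> l] (coord i j)).
Qed.

End UltraLimits.

(** * Summably perturbed recursions and the choice of weights *)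

Section SummablePerturbation.
Context {R : realType}.

(** A discrete Gronwall argument bounds [a]. The perturbation is then additive and summable, so [a]
    minus a multiple of the partial sums of [e] is eventually nonincreasing and bounded below, and
    [d] is squeezed by the increments of [a]. The factor [1 + a k + a k.+1] reflects that the error
    of a step grows with the distance of both iterates to the solution. *)
Lemma summable_recursion (a d e : nat -> R) C :
  (forall k, 0 <= a k) -> (forall k, 0 <= d k) -> (forall k, 0 <= e k) ->
  cvgn (series e) -> 0 <= C ->
  (forall k, a k.+1 + d k <= a k + C * e k * (1 + a k + a k.+1)) ->
  cvgn a /\ d @ \oo --> 0.
Proof.
move=> a0 d0 e0 cvge C0 rec.
have e_cvg0 := cvg_series_cvg_0 cvge.
have Snd : nondecreasing_seq (series e).
  by apply: nondecreasing_series => k _ _; exact: e0.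
pose M := limn (series e).
have SM k : series e k <= M by exact: nondecreasing_cvgn_le.
have S0 k : 0 <= series e k by rewrite /series /=; apply: sumr_ge0.
have SS k : series e k.+1 = series e k + e k by rewrite seriesSr.
(* From [N] on the term in [a k.+1] can be absorbed on the left. The factor 4 in the exponential
   comes from [1 + c <= (1 + 4 c) (1 - c)], valid for [0 <= c <= 1/2]. *)
have [N _ hN] : \forall k \near \oo, C * e k <= 2^-1.
  have : C * e k @[k --> \oo] --> C * 0 by apply: cvgMr.
  rewrite mulr0 => /cvgrPdist_le /(_ 2^-1); rewrite invr_gt0 ltr0n => /(_ isT).
  apply: filterS => k; rewrite sub0r normrN; exact: le_trans (ler_norm _).
pose E k := expR (4 * C * series e k).
have aE k : 1 + a (N + k)%N <= (1 + a N) * E (N + k)%N.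
  elim: k => [|k ih].
    rewrite addn0 ler_peMr//; first by rewrite addr_ge0.
    by rewrite -[leLHS]expR0 ler_expR mulr_ge0// mulr_ge0.
  rewrite addnS; set j := (N + k)%N in ih *.
  have cj : C * e j <= 2^-1 by apply: hN; rewrite /j /= leq_addr.
  have c0 : 0 <= C * e j by rewrite mulr_ge0.
  have step : 1 + a j.+1 <= (1 + a j) * (1 + 4 * (C * e j)).
    have := rec j; have := d0 j; have := a0 j; have := a0 j.+1.
    set c := C * e j in cj c0 *; set x := a j; set y := a j.+1 => y0 x0 dj0 hr.
    have h1 : (1 + y) * (1 - c) <= (1 + x) * (1 + c) by lra.
    have h2 : (1 + c) <= (1 + 4 * c) * (1 - c) by nra.
    have c1 : 0 < 1 - c by lra.
    rewrite -(ler_pM2r c1); apply: le_trans h1 _.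
    rewrite -mulrA; apply: ler_wpM2l => //; lra.
  apply: le_trans step _; rewrite /E SS [4 * C * (_ + _)]mulrDr expRD [leRHS]mulrA.
  apply: ler_pM => //; first by rewrite addr_ge0.
    by rewrite addr_ge0// mulr_ge0.
  by rewrite mulrA; exact: expR_ge1Dx.
pose B := (1 + a N) * expR (4 * C * M).
have aB k : 1 + a (N + k)%N <= B.
  apply: le_trans (aE k) _; apply: ler_wpM2l; first by rewrite addr_ge0.
  by rewrite ler_expR ler_wpM2l// mulr_ge0.
have B0 : 0 <= B by apply: le_trans (aB 0); rewrite addr_ge0.
have rec' k : a (N + k).+1 + d (N + k)%N <= a (N + k)%N + 2 * C * B * e (N + k)%N.
  apply: le_trans (rec _) _; rewrite lerD2l.
  have -> : 2 * C * B * e (N + k)%N = C * e (N + k)%N * (2 * B) by ring.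
  apply: ler_wpM2l; first by rewrite mulr_ge0.
  have := aB k; have := aB k.+1; rewrite addnS; have := a0 (N + k)%N; lra.
pose b k := a (k + N)%N - 2 * C * B * series e (k + N)%N.
have CB : 0 <= 2 * C * B by apply: mulr_ge0 => //; exact: mulr_ge0.
have bcvg : cvgn b.
  apply: nonincreasing_is_cvgn.
    apply/nonincreasing_seqP => k; rewrite /b addSn SS.
    have := rec' k; rewrite addnC; have := d0 (k + N)%N.
    set u := a (k + N).+1; set v := a (k + N)%N; set w := e _; set s := series e _.
    set D := 2 * C * B; lra.
  exists (- (2 * C * B * M)) => _ [k _ <-]; rewrite /b.
  have := a0 (k + N)%N; have := ler_wpM2l CB (SM (k + N)%N); lra.
have acvg : cvgn a.
  have : cvgn (fun k => b k + 2 * C * B * series e (k + N)%N).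
    apply: is_cvgD => //; apply: is_cvgMr.
    by move/cvg_ex : cvge => [l sl]; apply/cvg_ex; exists l; rewrite cvg_shiftn.
  move/cvg_ex => [l hl]; apply/cvg_ex; exists l; rewrite -(cvg_shiftn N).
  by apply: cvg_trans hl; apply: near_eq_cvg; near=> k; rewrite /b subrK.
split=> //; rewrite -(cvg_shiftn N).
have h k : 0 <= d (k + N)%N <=
    a (k + N)%N - a (k + N).+1 + 2 * C * B * e (k + N)%N.
  by rewrite d0 /=; have := rec' k; rewrite addnC; lra.
apply: (squeeze_cvgr (nearW _ h)); first exact: cvg_cst.
have -> : 0 = limn a - limn a + 2 * C * B * 0 :> R by rewrite subrr mulr0 addr0.
apply: cvgD; last by apply: cvgMr; rewrite (cvg_shiftn N e).
apply: cvgB; first by rewrite (cvg_shiftn N a).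
by rewrite (cvg_shiftn N (fun k => a k.+1)) (cvg_shiftS a).
Unshelve. all: by end_near.
Qed.

(* For [1 < tau] the bound on [tau] reads
   [(tau - 1)^2 + (tau - 1) <= 1 - alpha]; a suitable [mu] is slightly larger
   than [tau - 1]. *)
Lemma step_weights (alpha tau : R) : 0 < alpha < 1 ->
  0 < tau <= (1 + Num.sqrt (5 - 4 * alpha)) / 2 ->
  exists mu c : R, [/\ 0 < mu, 0 < c,
    tau - 1 + (1 - alpha) * (`|1 - tau| * mu) + c <= 1 - alpha
    & (1 - alpha) * (`|1 - tau| / mu) + c <= 1 - alpha].
Proof.
move=> /andP[a0 a1] /andP[t0 tle].
suff [mu [m0 h1 h2]] : exists mu : R, [/\ 0 < mu,
    tau - 1 + (1 - alpha) * (`|1 - tau| * mu) < 1 - alpha & `|1 - tau| < mu].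
  have h3 : `|1 - tau| / mu < 1 by rewrite ltr_pdivrMr// mul1r.
  set p := (1 - alpha) * (`|1 - tau| * mu) in h1 *.
  set s := `|1 - tau| / mu in h3 *.
  (* [c] is the slack in the two strict inequalities; it becomes the coefficient of the
     dissipation. *)
  have [c [c0 c1 c2]] : exists c : R, [/\ 0 < c, c <= 1 - alpha - (tau - 1) - p
      & c <= (1 - alpha) * (1 - s)].
    exists (Num.min (1 - alpha - (tau - 1) - p) ((1 - alpha) * (1 - s))).
    rewrite !ge_min !lexx orbT lt_min mulr_gt0 ?andbT ?subr_gt0//.
    by split=> //; lra.
  by exists mu, c; split; rewrite // -?/p -?/s; lra.
have [t1|t1] := leP tau 1.
  exists 1; rewrite ger0_norm ?subr_ge0// mulr1 ltr01; split=> //; nra.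
rewrite ler0_norm ?subr_le0 ?ltW// opprB; set d := tau - 1.
have dp : 0 < d by rewrite subr_gt0.
have hd : d * d + d <= 1 - alpha.
  have h : (2 * tau - 1) ^+ 2 <= 5 - 4 * alpha.
    rewrite -(@sqr_sqrtr _ (5 - 4 * alpha)); last by lra.
    by rewrite ler_pXn2r ?nnegrE ?sqrtr_ge0//; lra.
  by rewrite /d; lra.
set beta := 1 - alpha in hd *.
have bp : 0 < beta by rewrite subr_gt0.
have b1 : beta < 1 by rewrite /beta; lra.
(* Strictness comes from [beta < 1], that is from [0 < alpha]; this is what admits the right end
   point of the range of [tau]. *)
have hs : d + beta * (d * d) < beta.
  have : 0 < (1 - beta) * (d * d) by rewrite !mulr_gt0// subr_gt0.
  by move=> ?; lra.
(* The midpoint between [d] and [(beta - d) / (beta d)], the two numbers that [mu] has to separate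
   strictly. *)
exists (d + (beta - d - beta * (d * d)) / (2 * (beta * d))).
have bd : 0 < beta * d by exact: mulr_gt0.
have num : 0 < (beta - d - beta * (d * d)) / (2 * (beta * d)).
  by apply: divr_gt0; [lra|rewrite mulr_gt0].
split; [by rewrite addr_gt0| |by rewrite ltrDl].
set q := _ / _ in num *.
have : beta * (d * q) = (beta - d - beta * (d * d)) / 2.
  by rewrite /q; field; rewrite ?gt_eqF.
move=> e.
have -> : d + beta * (d * (d + q)) = d + beta * (d * d) + beta * (d * q) by ring.
by rewrite e; lra.
Qed.

End SummablePerturbation.

(** * Inexact proximal ADMM *)

Section VectorInequalities.
Context {R : realType} {m n : nat}.
Implicit Types x y : 'M[R]_(m, n).

Lemma inner_subsq x y :
  inner (x - y) (x - y) = inner x x + inner y y - 2 * inner x y.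
Proof. by rewrite !innerE (innerC y x); ring. Qed.

(** Polarization; it turns the proximal terms of the optimality conditions into telescoping
    differences. *)
Lemma three_points (S : {linear 'M[R]_(m, n) -> 'M[R]_(m, n)}) u u' (c : 'M[R]_(m, n)) :
  self_adjoint S ->
  2 * inner (S (u' - u)) (u' - c) =
  inner (u' - c) (S (u' - c)) - inner (u - c) (S (u - c))
  + inner (u' - u) (S (u' - u)).
Proof.
move=> Ss; have -> : u' - u = u' - c - (u - c) by rewrite opprB addrA subrK.
move: (u' - c) (u - c) => x y; rewrite !linearB /= !innerE !Ss.
by rewrite -(Ss y x) (innerC (S y) x); ring.
Qed.

Lemma psd_young (S : {linear 'M[R]_(m, n) -> 'M[R]_(m, n)}) x y :
  self_adjoint S -> pos_semidef S ->
  2 * inner (S x) y <= inner x (S x) + inner y (S y).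
Proof.
move=> Ss Sp; have := Sp (x - y).
rewrite linearB !innerE -(Ss x y) (innerC y (S x)) => h; lra.
Qed.

Lemma young x y mu : 0 < mu ->
  2 * `|inner x y| <= mu * inner x x + inner y y / mu.
Proof.
move=> m0; have sqrt0 := ltW m0.
have pos s : s ^+ 2 = 1 -> 2 * (s * inner x y) <= mu * inner x x + inner y y / mu.
  move=> s1; have := inner_ge0 (mu *: x - s *: y).
  rewrite !innerE (innerC y x) => h.
  have {}h : 0 <= mu * (mu * inner x x) - 2 * mu * (s * inner x y) + s ^+ 2 * inner y y.
    by rewrite expr2; lra.
  rewrite s1 mul1r in h; rewrite -(ler_pM2l m0) mulrDr.
  have -> : mu * (inner y y / mu) = inner y y by rewrite mulrC divfK// gt_eqF.
  lra.
have [xy|xy] := ler0P (inner x y).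
  by rewrite -mulN1r; apply: pos; rewrite sqrrN expr1n.
by rewrite -[inner x y]mul1r; apply: pos; rewrite expr1n.
Qed.

(** Here [xe], [qe], [qe'] are the errors of [x] and of the old and new [q], [gx] is the gap
    [(P_x - Q) xe], and the last two hypotheses come from the two blocks. With [s = r + qe - qe'],
    polarization gives [<s, r - qe'> + <r, qe'> = (|s|^2 + |r|^2 + |qe'|^2 - |qe|^2) / 2]. The cross
    term [sigma <s, gx>] is absorbed by [<xe, gx>] at the price of [sigma alpha / 2] times
    [|s|^2]. *)
Lemma admm_inequality (alpha sigma tau X1 X2 : R) (xe r qe qe' gx : 'M[R]_(m, n)) :
  0 < alpha -> 0 < sigma -> 0 < tau ->
  inner gx gx <= 2 * alpha / sigma * inner xe gx ->
  inner (xe + sigma *: (r + qe - qe')) (r + gx - qe') <= X1 ->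
  inner (xe + sigma *: r) qe' <= X2 ->
  (2 * tau * sigma)^-1 * (inner (xe + (tau * sigma) *: r) (xe + (tau * sigma) *: r)
     - inner xe xe)
  + sigma / 2 * (inner qe' qe' - inner qe qe)
  + sigma / 2 * ((1 - tau) * inner r r)
  + sigma / 2 * ((1 - alpha) * inner (r + qe - qe') (r + qe - qe')) <= X1 + X2.
Proof.
move=> a0 s0 t0 hg h1 h2.
have -> : (2 * tau * sigma)^-1 *
    (inner (xe + (tau * sigma) *: r) (xe + (tau * sigma) *: r) - inner xe xe) =
    inner xe r + tau * sigma / 2 * inner r r.
  by rewrite !innerE (innerC r xe); field; rewrite ?gt_eqF.
(* This is [|s + gx / alpha|^2 >= 0] scaled by [sigma alpha / 2]; with this weight the last term is
   at most [<xe, gx>] by cocoercivity. *)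
have hs : 0 <= sigma * alpha / 2 * inner (r + qe - qe') (r + qe - qe')
    + sigma * inner (r + qe - qe') gx + sigma / (2 * alpha) * inner gx gx.
  have := inner_ge0 (r + qe - qe' + alpha^-1 *: gx).
  move: (r + qe - qe') => s; rewrite !innerE (innerC gx s) => h.
  have c0 : 0 <= sigma * alpha / 2 by rewrite divr_ge0// mulr_ge0// ltW.
  have := mulr_ge0 c0 h; congr (0 <= _); field; by rewrite gt_eqF.
have hg' : sigma / (2 * alpha) * inner gx gx <= inner xe gx.
  have c0 : 0 <= sigma / (2 * alpha) by rewrite divr_ge0 ?mulr_ge0// ltW.
  apply: le_trans (ler_wpM2l c0 hg) _; rewrite le_eqVlt; apply/orP; left; apply/eqP.
  by field; rewrite ?gt_eqF.
move: h1 h2 hs; rewrite !innerE !(innerC r xe, innerC qe xe, innerC qe' xe,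
  innerC gx xe, innerC qe r, innerC qe' r, innerC gx r, innerC qe' qe,
  innerC gx qe, innerC gx qe').
move: hg'; set g2 := sigma / _ * _ => hg' h1 h2 hs; lra.
Qed.

End VectorInequalities.

Record primal_dual (R : realType) (m n p q : nat) := PrimalDual {
  pd_v : 'M[R]_(m, n); pd_w : 'M[R]_(m, n); pd_y : 'M[R]_(p, q);
  pd_z : 'M[R]_(m, n); pd_x : 'M[R]_(m, n) }.

Section ProximalADMM.
Context {R : realType} {m n p q : nat}.
Notation E := 'M[R]_(m, n).
Notation F := 'M[R]_(p, q).
Notation state := (primal_dual R m n p q).
Variables (As : {linear F -> E}) (A : {linear E -> F}).
Variables (Q S : {linear E -> E}) (K L U : {linear F -> F}).
Variables (grad : E -> E) (b : F) (MV MZ : E -> E -> Prop).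
Variables (alpha sigma tau : R).

Definition pd_q (s : state) : E := As (pd_y s) + pd_z s.
Definition pd_n (s : state) : F := U (pd_y s) + A (pd_z s).
Definition pd_residual (s s' : state) : E :=
  As (pd_y s') + pd_z s' + pd_v s' - (grad (pd_x s) - Q (pd_x s)) - Q (pd_w s').
(* [(P_x - Q) (x_s - x_s')] for the mean value Hessian [P_x]. *)
Definition pd_gap (s s' : state) : E :=
  grad (pd_x s) - grad (pd_x s') - Q (pd_x s - pd_x s').

(** The relations [MV v x] and [MZ z x] stand for [x] being a subgradient of the conjugate at [-v],
    resp. [-z]. This sign is why both are assumed antitone. *)
Definition pd_kkt (s : state) : Prop :=
  [/\ A (pd_x s) = b, grad (pd_x s) = As (pd_y s) + pd_v s + pd_z s,
      MV (pd_v s) (pd_x s), MZ (pd_z s) (pd_x s)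
    & range Q (pd_w s) /\ Q (pd_w s) = Q (pd_x s)].

(** Optimality conditions of the two joint minimizations, with errors [e], [a], [f], [g] in [w],
    [v], [z], [y]. The block [(v, w)] is minimized with the old [q], so it sees the residual
    [r + (q - q')]; the block [(y, z)] sees [r]. The adjoint of [N] has the components [L] in [y]
    and [As] in [z], which explains the two proximal terms in [K]. *)
Definition prox_step (eps : R) (s s' : state) : Prop :=
  let r := pd_residual s s' in
  [/\ pd_x s' = pd_x s + (tau * sigma) *: r, range Q (pd_w s')
    & exists e a f g, [/\ enorm e <= eps, enorm a <= eps, enorm f <= eps
                        & enorm g <= eps] /\
      [/\ Q (pd_w s') - Q (pd_x s + sigma *: (r + (pd_q s - pd_q s'))) = e,
          MV (pd_v s') (pd_x s + sigma *: (r + (pd_q s - pd_q s'))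
                        + S (pd_v s' - pd_v s) + a),
          MZ (pd_z s') (pd_x s + sigma *: r
                        + sigma *: As (K (pd_n s' - pd_n s)) + f)
        & A (pd_x s + sigma *: r) - b
          + sigma *: L (K (pd_n s' - pd_n s)) = g]].

Hypothesis adjA : forall x y, inner (A x) y = inner x (As y).
Hypothesis adjLU : forall y y', inner (L y) y' = inner y (U y').
Hypothesis Qsa : self_adjoint Q.
Hypothesis Qpsd : pos_semidef Q.
Hypothesis Ssa : self_adjoint S.
Hypothesis Spsd : pos_semidef S.
Hypothesis Ksa : self_adjoint K.
Hypothesis Kpd : pos_def K.
Hypothesis MV_mono : forall v x v' x',
  MV v x -> MV v' x' -> inner (x - x') (v - v') <= 0.
Hypothesis MZ_mono : forall z x z' x',
  MZ z x -> MZ z' x' -> inner (x - x') (z - z') <= 0.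
Hypothesis y_bound : exists2 C, 0 <= C & forall (y : F) (z : E),
  enorm y <= C * (enorm (As y + z) + enorm (U y + A z)).
Hypothesis alpha01 : 0 < alpha < 1.
Hypothesis sigma_gt0 : 0 < sigma.
Hypothesis tau_gt0 : 0 < tau.

Let kn (u : F) := inner u (K u).
Let sn (u : E) := inner u (S u).

Let cocoercive s t :=
  inner (pd_gap s t) (pd_gap s t) <=
  2 * alpha / sigma * inner (pd_x s - pd_x t) (pd_gap s t).

Lemma kn_ge0 u : 0 <= kn u.
Proof.
have [->|u0] := eqVneq u 0; first by rewrite /kn inner0l.
exact: ltW (Kpd u0).
Qed.

Lemma sn_ge0 u : 0 <= sn u. Proof. exact: Spsd. Qed.

Lemma prox_step_descent eps s s' t :
  prox_step eps s s' -> pd_kkt t -> cocoercive s t ->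
  (2 * tau * sigma)^-1 *
    (inner (pd_x s' - pd_x t) (pd_x s' - pd_x t)
     - inner (pd_x s - pd_x t) (pd_x s - pd_x t))
  + sigma / 2 * (inner (pd_q s' - pd_q t) (pd_q s' - pd_q t)
                 - inner (pd_q s - pd_q t) (pd_q s - pd_q t))
  + sigma / 2 * (kn (pd_n s' - pd_n t) - kn (pd_n s - pd_n t)
                 + kn (pd_n s' - pd_n s))
  + (sn (pd_v s' - pd_v t) - sn (pd_v s - pd_v t) + sn (pd_v s' - pd_v s)) / 2
  + inner (pd_w s' - pd_w t) (Q (pd_w s' - pd_w t))
  + sigma / 2 * ((1 - tau) * inner (pd_residual s s') (pd_residual s s'))
  + sigma / 2 * ((1 - alpha) *
      inner (pd_residual s s' + pd_q s - pd_q s')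
            (pd_residual s s' + pd_q s - pd_q s'))
  <= eps * (enorm (pd_v s' - pd_v t) + enorm (pd_w s' - pd_w t)
            + (enorm (pd_z s' - pd_z t) + enorm (pd_y s' - pd_y t))).
Proof.
move=> [xE _ [e [a [f [g [[le_e le_a le_f le_g] [we va zf yg]]]]]]].
move=> [At gt vt zt [_ wt]] coco.
set r := pd_residual s s' in xE we va zf yg *.
set gx := pd_gap s t in coco.
set dn := pd_n s' - pd_n s in zf yg *.
set dv := pd_v s' - pd_v s in va *.
have xsE : pd_x s' - pd_x t = pd_x s - pd_x t + (tau * sigma) *: r.
  by rewrite xE addrAC.
have qsE : pd_q s - pd_q s' = pd_q s - pd_q t - (pd_q s' - pd_q t).
  by rewrite opprB addrA subrK.
have rsE : r + pd_q s - pd_q s' = r + (pd_q s - pd_q t) - (pd_q s' - pd_q t).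
  by rewrite -addrA qsE addrA.
(* The KKT equations of [t] replace [grad (pd_x t)] and [Q (pd_x t)], so that only the variables of
   the first block remain. *)
have pE : r + gx - (pd_q s' - pd_q t) =
    pd_v s' - pd_v t - Q (pd_w s' - pd_w t).
  rewrite /r /gx /pd_residual /pd_gap gt /pd_q (linearB Q) (linearB Q) wt.
  by apply/matrixP => i j; rewrite !mxE; ring.
rewrite xsE rsE.
set xe := pd_x s - pd_x t in xsE coco *.
(* The error of the multiplier seen by the block [(v, w)]; for the block [(y, z)] it is
   [xe + sigma *: r]. *)
set xh := xe + sigma *: (r + (pd_q s - pd_q t) - (pd_q s' - pd_q t)).
have xhE : pd_x s + sigma *: (r + (pd_q s - pd_q s')) - pd_x t = xh.
  by rewrite qsE /xh /xe; apply/matrixP => i j; rewrite !mxE; ring.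
have X1 : inner xh (r + gx - (pd_q s' - pd_q t)) <=
    - inner (S dv) (pd_v s' - pd_v t) + eps * enorm (pd_v s' - pd_v t)
    - inner (pd_w s' - pd_w t) (Q (pd_w s' - pd_w t))
    + eps * enorm (pd_w s' - pd_w t).
  rewrite pE innerDr innerNr.
  have := MV_mono va vt.
  rewrite (_ : _ - pd_x t = xh + S dv + a); last first.
    by rewrite -xhE; apply/matrixP => i j; rewrite !mxE; ring.
  rewrite innerDl (innerDl xh) => h1.
  have -> : inner xh (Q (pd_w s' - pd_w t)) =
      inner (pd_w s' - pd_w t) (Q (pd_w s' - pd_w t)) - inner e (pd_w s' - pd_w t).
    rewrite -Qsa -xhE linearB /= -wt (innerC _ (Q _)) -innerNl -innerDl.
    congr (inner _ _); rewrite -we linearB /=.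
    by apply/matrixP => i j; rewrite !mxE; ring.
  have h2 := inner_le e (pd_w s' - pd_w t).
  have h3 := ler_wpM2r (enorm_ge0 (pd_w s' - pd_w t)) le_e.
  have h4 := inner_le (- a) (pd_v s' - pd_v t).
  rewrite enormN innerNl in h4.
  have h5 := ler_wpM2r (enorm_ge0 (pd_v s' - pd_v t)) le_a.
  lra.
have X2 : inner (xe + sigma *: r) (pd_q s' - pd_q t) <=
    - (sigma * inner (K dn) (pd_n s' - pd_n t))
    + eps * (enorm (pd_z s' - pd_z t) + enorm (pd_y s' - pd_y t)).
  have -> : pd_q s' - pd_q t = As (pd_y s' - pd_y t) + (pd_z s' - pd_z t).
    by rewrite /pd_q (linearB As); apply/matrixP => i j; rewrite !mxE; ring.
  have -> : pd_n s' - pd_n t = U (pd_y s' - pd_y t) + A (pd_z s' - pd_z t).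
    rewrite /pd_n (linearB A) (linearB U).
    by apply/matrixP => i j; rewrite !mxE; ring.
  rewrite innerDr [inner (K _) _]innerDr -adjLU (innerC (K dn)) (adjA _ (K dn)).
  rewrite -(adjA _ (pd_y s' - pd_y t)).
  have := MZ_mono zf zt.
  rewrite (_ : _ - pd_x t = xe + sigma *: r + sigma *: As (K dn) + f); last first.
    by rewrite /xe; apply/matrixP => i j; rewrite !mxE; ring.
  rewrite innerDl (innerDl (xe + sigma *: r)) innerZl => h1.
  have -> : A (xe + sigma *: r) = g - sigma *: L (K dn).
    rewrite -yg addrK -At -(linearB A); congr (A _).
    by rewrite /xe; apply/matrixP => i j; rewrite !mxE; ring.
  rewrite innerDl innerNl innerZl.
  have h2 := inner_le (- f) (pd_z s' - pd_z t).
  rewrite enormN innerNl in h2.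
  have h3 := ler_wpM2r (enorm_ge0 (pd_z s' - pd_z t)) le_f.
  have h4 := inner_le g (pd_y s' - pd_y t).
  have h5 := ler_wpM2r (enorm_ge0 (pd_y s' - pd_y t)) le_g.
  rewrite [inner _ (As (K dn))]innerC; lra.
have [a0 _] := andP alpha01.
have := admm_inequality a0 sigma_gt0 tau_gt0 coco X1 X2.
have := three_points (pd_v s) (pd_v s') (pd_v t) Ssa.
have := three_points (pd_n s) (pd_n s') (pd_n t) Ksa.
rewrite -/dn -/dv /kn /sn => k3 s3.
have k3' : sigma * inner (K dn) (pd_n s' - pd_n t) = sigma / 2 *
  (inner (pd_n s' - pd_n t) (K (pd_n s' - pd_n t))
   - inner (pd_n s - pd_n t) (K (pd_n s - pd_n t)) + inner dn (K dn)).
  by rewrite -k3; field.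
lra.
Qed.

(** Subtracting the [(y, z)] conditions of two consecutive steps eliminates the KKT point. As
    [x' = x + tau sigma r], the multipliers they see differ by [sigma (r' - (1 - tau) r)], and
    monotonicity together with Young's inequality for [K] gives the bound. It controls the cross
    term left by [prox_step_descent]. *)
Lemma prox_step_consecutive eps eps' s s' s'' :
  prox_step eps s s' -> prox_step eps' s' s'' ->
  sigma * inner (pd_residual s' s'' - (1 - tau) *: pd_residual s s')
                (pd_q s'' - pd_q s') <=
  sigma / 2 * (kn (pd_n s' - pd_n s) - kn (pd_n s'' - pd_n s'))
  + (eps + eps') * (enorm (pd_z s'' - pd_z s') + enorm (pd_y s'' - pd_y s')).
Proof.
move=> [xE _ [_ [_ [f [g [[_ _ le_f le_g] [_ _ zf yg]]]]]]].
move=> [_ _ [_ [_ [f' [g' [[_ _ le_f' le_g'] [_ _ zf' yg']]]]]]].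
set r := pd_residual s s' in xE zf yg *.
set r' := pd_residual s' s'' in zf' yg' *.
set dn := pd_n s' - pd_n s in zf yg *.
set dn' := pd_n s'' - pd_n s' in zf' yg' *.
have xcE : pd_x s' + sigma *: r' - (pd_x s + sigma *: r) =
    sigma *: (r' - (1 - tau) *: r).
  by rewrite xE; apply/matrixP => i j; rewrite !mxE; ring.
have -> : pd_q s'' - pd_q s' = As (pd_y s'' - pd_y s') + (pd_z s'' - pd_z s').
  by rewrite /pd_q (linearB As); apply/matrixP => i j; rewrite !mxE; ring.
have dnE : dn' = U (pd_y s'' - pd_y s') + A (pd_z s'' - pd_z s').
  rewrite /dn' /pd_n (linearB A) (linearB U).
  by apply/matrixP => i j; rewrite !mxE; ring.
rewrite -innerZl -xcE innerDr -adjA.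
have -> : A (pd_x s' + sigma *: r' - (pd_x s + sigma *: r)) =
    g' - g - sigma *: L (K dn' - K dn).
  rewrite (linearB A) (linearB L) -yg -yg'.
  by apply/matrixP => i j; rewrite !mxE; ring.
have := MZ_mono zf' zf.
rewrite (_ : _ - (_ + f) = pd_x s' + sigma *: r' - (pd_x s + sigma *: r)
    + sigma *: As (K dn' - K dn) + (f' - f)); last first.
  by rewrite (linearB As); apply/matrixP => i j; rewrite !mxE; ring.
set dz := pd_z s'' - pd_z s' in dnE *; set dy := pd_y s'' - pd_y s' in dnE *.
rewrite innerDl (innerDl _ (sigma *: _)) innerZl (innerC (As _)) -adjA => h1.
rewrite innerDl innerNl innerZl adjLU.
have := psd_young dn dn' Ksa => /(_ (fun u => kn_ge0 u)) => h2.
have h3 : inner (K dn' - K dn) dn' =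
    inner (K dn' - K dn) (U dy) + inner (A dz) (K dn' - K dn).
  by rewrite {2}dnE innerDr (innerC (A dz)).
rewrite [in LHS]innerDl innerNl (innerC (K dn') dn') in h3.
have e1 := inner_le (f - f') dz; have e2 := inner_le (g' - g) dy.
have e3 : enorm (f - f') <= eps + eps'.
  by apply: le_trans (enormB _ _) _; exact: lerD.
have e4 : enorm (g' - g) <= eps + eps'.
  by apply: le_trans (enormB _ _) _; rewrite addrC; exact: lerD.
have := ler_wpM2r (enorm_ge0 dz) e3; have := ler_wpM2r (enorm_ge0 dy) e4.
have e5 : inner (f - f') dz = - inner (f' - f) dz by rewrite -innerNl opprB.
have h4 : sigma * (inner (K dn' - K dn) (U dy) + inner (A dz) (K dn' - K dn)) >=
    sigma / 2 * (kn dn' - kn dn).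
  rewrite -h3 -mulrA; apply: ler_wpM2l; first exact: ltW.
  by rewrite /kn; lra.
rewrite mulrDr in h4.
move=> h5 h6; lra.
Qed.

Variables mu c : R.
Hypothesis mu_gt0 : 0 < mu.
Hypothesis c_gt0 : 0 < c.
Hypothesis weight_r :
  tau - 1 + (1 - alpha) * (`|1 - tau| * mu) + c <= 1 - alpha.
Hypothesis weight_q : (1 - alpha) * (`|1 - tau| / mu) + c <= 1 - alpha.

(** The last summand does not depend on [t]: it pays in advance for the cross term of the next step,
    as produced by [prox_step_consecutive] and by Young's inequality with weight [mu]. *)
Definition lyapunov (t s s' : state) : R :=
  (2 * tau * sigma)^-1 * inner (pd_x s' - pd_x t) (pd_x s' - pd_x t)
  + sigma / 2 * inner (pd_q s' - pd_q t) (pd_q s' - pd_q t)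
  + sigma / 2 * kn (pd_n s' - pd_n t) + sn (pd_v s' - pd_v t) / 2
  + sigma / 2 * ((1 - alpha) *
      (`|1 - tau| * mu * inner (pd_residual s s') (pd_residual s s')
       + kn (pd_n s' - pd_n s))).

Definition dissipation (t s s' : state) : R :=
  sigma / 2 * (c * (inner (pd_residual s s') (pd_residual s s')
                    + inner (pd_q s' - pd_q s) (pd_q s' - pd_q s)))
  + inner (pd_w s' - pd_w t) (Q (pd_w s' - pd_w t))
  + sigma / 2 * kn (pd_n s' - pd_n s) + sn (pd_v s' - pd_v s) / 2.

(** Expand [|r' - dq|^2] in [prox_step_descent], bound [<r', dq>] by [prox_step_consecutive], and
    split the remaining [(1 - tau) <r, dq>] by Young's inequality. [weight_r] and [weight_q] say
    that the coefficients of [|r'|^2] and [|dq|^2] still leave [c], after the new Lyapunov term in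
    [|r'|^2] has been paid. *)
Lemma lyapunov_descent eps eps' t s s' s'' :
  prox_step eps s s' -> prox_step eps' s' s'' -> pd_kkt t -> cocoercive s' t ->
  lyapunov t s' s'' + dissipation t s' s'' <= lyapunov t s s'
  + (eps' * (enorm (pd_v s'' - pd_v t) + enorm (pd_w s'' - pd_w t)
            + (enorm (pd_z s'' - pd_z t) + enorm (pd_y s'' - pd_y t)))
     + (1 - alpha) * ((eps + eps') *
         (enorm (pd_z s'' - pd_z s') + enorm (pd_y s'' - pd_y s')))).
Proof.
move=> st st' kt coco.
have h1 := prox_step_descent st' kt coco.
have h2 := prox_step_consecutive st st'.
rewrite /lyapunov /dissipation.
set err1 := eps' * _ in h1 *; set err2 := (eps + eps') * _ in h2 *.
set r' := pd_residual s' s'' in h1 h2 *; set r := pd_residual s s' in h1 h2 *.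
set dq := pd_q s'' - pd_q s' in h2 *.
have rdq : r' + pd_q s' - pd_q s'' = r' - dq by rewrite /dq opprB [RHS]addrA.
rewrite rdq in h1.
rewrite (inner_subsq r' dq) in h1.
have b0 : 0 <= 1 - alpha by have [_ /ltW] := andP alpha01; rewrite subr_ge0.
have s0 : 0 <= sigma / 2 by rewrite divr_ge0// ltW.
have sb0 : 0 <= sigma / 2 * (1 - alpha) by exact: mulr_ge0.
rewrite innerDl innerNl innerZl in h2.
have h3 : 2 * ((1 - tau) * inner r dq) <=
    `|1 - tau| * (mu * inner r r + inner dq dq / mu).
  apply: le_trans (ler_wpM2l (normr_ge0 _) (young r dq mu_gt0)).
  by rewrite [leRHS]mulrCA -normrM ler_pM2l// ler_norm.
have h3' := ler_wpM2l sb0 h3.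
have h4 := ler_wpM2l s0 (ler_wpM2r (inner_ge0 r') weight_r).
have h5 := ler_wpM2l s0 (ler_wpM2r (inner_ge0 dq) weight_q).
have h2' := ler_wpM2l b0 h2.
move: h1 h2' h3' h4 h5.
set rr' := inner r' r'; set qq := inner dq dq; set rr := inner r r.
set rq' := inner r' dq; set rq := inner r dq.
set a1 := inner (pd_x s' - _) _; set a2 := inner (pd_x s'' - _) _.
set i2 := (2 * tau * sigma)^-1; set im := mu^-1.
set k1 := kn (pd_n s' - pd_n s); set k2 := kn (pd_n s'' - pd_n s').
move=> h1 h2' h3' h4 h5; lra.
Qed.

(** The part of the distance to [t] that the Lyapunov function controls in norm, as opposed to a
    seminorm. *)
Definition deviation (t s : state) : R :=
  enorm (pd_x s - pd_x t) + enorm (pd_q s - pd_q t) + enorm (pd_n s - pd_n t).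

Lemma deviation_ge0 t s : 0 <= deviation t s.
Proof. by rewrite !addr_ge0// enorm_ge0. Qed.

Lemma yz_deviation : exists2 C, 0 <= C & forall t s,
  enorm (pd_y s - pd_y t) + enorm (pd_z s - pd_z t) <= C * deviation t s.
Proof.
have [C C0 hC] := y_bound; have [D D0 hD] := lin_bounded As.
have DC0 : 0 <= D * C by exact: mulr_ge0.
exists (C + 1 + D * C); first by rewrite !addr_ge0.
move=> t s.
have yq : As (pd_y s - pd_y t) + (pd_z s - pd_z t) = pd_q s - pd_q t.
  by rewrite /pd_q (linearB As); apply/matrixP => i j; rewrite !mxE; ring.
have yn : U (pd_y s - pd_y t) + A (pd_z s - pd_z t) = pd_n s - pd_n t.
  rewrite /pd_n (linearB A) (linearB U).
  by apply/matrixP => i j; rewrite !mxE; ring.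
have h1 := hC (pd_y s - pd_y t) (pd_z s - pd_z t); rewrite yq yn in h1.
have h2 : enorm (pd_z s - pd_z t) <=
    enorm (pd_q s - pd_q t) + D * enorm (pd_y s - pd_y t).
  rewrite -[pd_z s - pd_z t](addKr (As (pd_y s - pd_y t))) yq addrC.
  by apply: le_trans (enormB _ _) _; rewrite lerD2l hD.
have h3 := ler_wpM2l D0 h1.
have x0 := enorm_ge0 (pd_x s - pd_x t).
have h4 : 0 <= enorm (pd_n s - pd_n t) := enorm_ge0 _.
have := mulr_ge0 C0 x0; have := mulr_ge0 DC0 x0.
rewrite /deviation; lra.
Qed.

(** [w] is recovered from [Q w] because [Q] is injective on its range, and [v] from the definition
    of the residual, which itself equals [(x' - x) / (tau sigma)]. Only the new iterate is
    estimated, since the old [v] and [w] may be arbitrary. *)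
Lemma vw_deviation : exists2 C, 0 <= C & forall eps t s s',
  prox_step eps s s' -> pd_kkt t -> cocoercive s t ->
  enorm (pd_v s' - pd_v t) + enorm (pd_w s' - pd_w t)
  <= C * (deviation t s + deviation t s' + eps).
Proof.
have [D D0 hD] := lin_bounded Q.
have [W W0 hW] : exists2 C, 0 <= C & forall x, enorm (Q x) <= C * enorm (Q (Q x)).
  have qql : linear (Q \o Q) by move=> k x y /=; rewrite !linearP.
  apply: (@lin_ker_le _ _ _ _ _ _ _ (linear_pack qql) Q) => x /= QQ.
  by apply: inner_eq0; rewrite Qsa QQ inner0r.
pose B := 1 + 2 * tau^-1 + 2 * sigma.
have ti : 0 <= tau^-1 by rewrite invr_ge0 ltW.
have s0 := ltW sigma_gt0.
have B0 : 0 <= B by rewrite /B; lra.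
pose G := 2 * alpha / sigma.
have G0 : 0 <= G.
  by have [a0 _] := andP alpha01; rewrite divr_ge0 ?mulr_ge0// ltW.
pose H := 2 * (tau * sigma)^-1 + G + 1.
have ts0 : 0 < (tau * sigma)^-1 by rewrite invr_gt0 mulr_gt0.
have H0 : 0 <= H by rewrite /H; lra.
pose W1 := (D * B + 1) * W.
have W10 : 0 <= W1 by rewrite mulr_ge0// addr_ge0// mulr_ge0.
have DW0 : 0 <= D * W1 by exact: mulr_ge0.
exists (H + D * W1 + W1); first by rewrite addr_ge0// addr_ge0.
move=> eps t s s' [xE ws [e [a [f [g [[le_e _ _ _] [we _ _ _]]]]]]].
move=> [At gt vt zt [wtW wt]] coco.
have eps0 : 0 <= eps by apply: le_trans le_e; exact: enorm_ge0.
set M := deviation t s + deviation t s' + eps.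
set r := pd_residual s s' in xE we.
have [x0 x0' q0 q0'] : [/\ 0 <= enorm (pd_x s - pd_x t),
    0 <= enorm (pd_x s' - pd_x t), 0 <= enorm (pd_q s - pd_q t)
    & 0 <= enorm (pd_q s' - pd_q t)] by split; exact: enorm_ge0.
have n0 : 0 <= enorm (pd_n s - pd_n t) by exact: enorm_ge0.
have n0' : 0 <= enorm (pd_n s' - pd_n t) by exact: enorm_ge0.
have xM : enorm (pd_x s - pd_x t) + enorm (pd_x s' - pd_x t)
    + (enorm (pd_q s - pd_q t) + enorm (pd_q s' - pd_q t)) + eps <= M.
  by rewrite /M /deviation; lra.
have M0 : 0 <= M by lra.
have rE : r = (tau * sigma)^-1 *: ((pd_x s' - pd_x t) - (pd_x s - pd_x t)).
  have -> : (pd_x s' - pd_x t) - (pd_x s - pd_x t) = (tau * sigma) *: r.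
    by rewrite xE; apply/matrixP => i j; rewrite !mxE; ring.
  by rewrite scalerA mulVf ?scale1r// gt_eqF// mulr_gt0.
have r_le : enorm r <= (tau * sigma)^-1 * (enorm (pd_x s - pd_x t) + enorm (pd_x s' - pd_x t)).
  rewrite rE enormZ gtr0_norm//; apply: ler_wpM2l; first exact: ltW.
  by rewrite [leRHS]addrC; exact: enormB.
pose xh := pd_x s - pd_x t + tau^-1 *: ((pd_x s' - pd_x t) - (pd_x s - pd_x t))
  + sigma *: ((pd_q s - pd_q t) - (pd_q s' - pd_q t)).
have xh_le : enorm xh <= B * M.
  apply: le_trans (enormD _ _) _; rewrite enormZ gtr0_norm//.
  apply: le_trans (lerD (enormD _ _) (lexx _)) _.
  rewrite enormZ ger0_norm//.
  have h1 := ler_wpM2l ti (enormB (pd_x s' - pd_x t) (pd_x s - pd_x t)).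
  have h2 := ler_wpM2l (ltW sigma_gt0) (enormB (pd_q s - pd_q t) (pd_q s' - pd_q t)).
  have h3 : tau^-1 * (enorm (pd_x s' - pd_x t) + enorm (pd_x s - pd_x t)) <= tau^-1 * (2 * M).
    by apply: ler_wpM2l => //; lra.
  have h4 : sigma * (enorm (pd_q s - pd_q t) + enorm (pd_q s' - pd_q t)) <= sigma * (2 * M).
    by apply: ler_wpM2l; [exact: ltW|lra].
  rewrite /B; lra.
have Qw : Q (pd_w s' - pd_w t) = Q xh + e.
  have -> : xh = pd_x s + sigma *: (r + (pd_q s - pd_q s')) - pd_x t.
    have sr : sigma *: r = tau^-1 *: ((pd_x s' - pd_x t) - (pd_x s - pd_x t)).
      by rewrite rE scalerA; congr (_ *: _); field; rewrite ?gt_eqF.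
    rewrite [sigma *: (r + _)]scalerDr sr /xh.
    by apply/matrixP => i j; rewrite !mxE; ring.
  by rewrite -we !(linearB Q) wt; apply/matrixP => i j; rewrite !mxE; ring.
have w_le : enorm (pd_w s' - pd_w t) <= W1 * M.
  have [u _ wE] : range Q (pd_w s' - pd_w t).
    case: ws wtW => u _ <- [u' _ <-]; exists (u - u') => //.
    by rewrite linearB.
  rewrite -wE; apply: le_trans (hW _) _; rewrite wE Qw /W1 [(_ + 1) * W]mulrC -mulrA.
  apply: ler_wpM2l => //; apply: le_trans (enormD _ _) _.
  have := hD xh; have := ler_wpM2l D0 xh_le.
  by move=> h1 h2; lra.
have g_le : enorm (pd_gap s t) <= G * enorm (pd_x s - pd_x t).
  have := coco; rewrite /cocoercive -enorm_sqr -/G.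
  have := ler_wpM2l G0 (inner_le (pd_x s - pd_x t) (pd_gap s t)).
  have := enorm_ge0 (pd_gap s t).
  set u := enorm (pd_gap s t); set z := enorm (pd_x s - pd_x t).
  move=> u0 h1 h2; have [->|u1] := eqVneq u 0; first exact: mulr_ge0.
  have up : 0 < u by rewrite lt_neqAle eq_sym u1.
  by rewrite -(ler_pM2r up) -expr2 -mulrA; exact: le_trans h2 h1.
have vE : pd_v s' - pd_v t =
    r + pd_gap s t - (pd_q s' - pd_q t) + Q (pd_w s' - pd_w t).
  rewrite /r /pd_residual /pd_gap gt /pd_q (linearB Q) (linearB Q) wt.
  by apply/matrixP => i j; rewrite !mxE; ring.
have v_le : enorm (pd_v s' - pd_v t) <= (H + D * W1) * M.
  rewrite vE; apply: le_trans (enormD _ _) _.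
  apply: le_trans (lerD (enormB _ _) (hD _)) _.
  apply: le_trans (lerD (lerD (enormD _ _) (lexx _)) (lexx _)) _.
  have h1 := ler_wpM2l D0 w_le.
  have h2 : (tau * sigma)^-1 * (enorm (pd_x s - pd_x t) + enorm (pd_x s' - pd_x t))
      <= (tau * sigma)^-1 * (2 * M).
    by apply: ler_wpM2l; [exact: ltW|lra].
  have h3 : G * enorm (pd_x s - pd_x t) <= G * M by apply: ler_wpM2l => //; lra.
  rewrite /H; lra.
by rewrite [leRHS]mulrDl; exact: lerD.
Qed.

Lemma lyapunov_ge0 t s s' : 0 <= lyapunov t s s'.
Proof.
have [_ /ltW b0] := andP alpha01; rewrite -subr_ge0 in b0.
have s0 : 0 <= sigma / 2 by rewrite divr_ge0// ltW.
have c0 : 0 <= (2 * tau * sigma)^-1 by rewrite invr_ge0 !mulr_ge0// ltW.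
rewrite /lyapunov addr_ge0//; last first.
  apply: mulr_ge0 => //; apply: mulr_ge0 => //; apply: addr_ge0; last exact: kn_ge0.
  by apply: mulr_ge0 (inner_ge0 _); apply: mulr_ge0 => //; exact: ltW.
apply: addr_ge0; last by rewrite divr_ge0// sn_ge0.
apply: addr_ge0; last by rewrite mulr_ge0// kn_ge0.
by apply: addr_ge0; apply: mulr_ge0 => //; exact: inner_ge0.
Qed.

Lemma dissipation_ge0 t s s' : 0 <= dissipation t s s'.
Proof.
have s0 : 0 <= sigma / 2 by rewrite divr_ge0// ltW.
rewrite /dissipation addr_ge0//; last by rewrite divr_ge0// sn_ge0.
apply: addr_ge0; last by rewrite mulr_ge0// kn_ge0.
apply: addr_ge0; last exact: Qpsd.
by rewrite !mulr_ge0 ?addr_ge0 ?inner_ge0// ltW.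
Qed.

Lemma kn_coercive : exists2 C, 0 <= C & forall u, inner u u <= C * kn u.
Proof.
have Kps : pos_semidef K by move=> u; exact: kn_ge0.
have [C C0 hC] := psd_image_le Ksa Kps.
have [D D0 hD] : exists2 D, 0 <= D & forall u : F, enorm u <= D * enorm (K u).
  have idl : linear (idfun : F -> F) by [].
  apply: (@lin_ker_le _ _ _ _ _ _ _ K (linear_pack idl)) => x /= Kx.
  by apply/eqP/negPn/negP => /Kpd; rewrite Kx inner0r ltxx.
exists (D ^+ 2 * C); first by rewrite mulr_ge0// exprn_ge0.
move=> u; rewrite -enorm_sqr.
have : enorm u ^+ 2 <= (D * enorm (K u)) ^+ 2.
  by rewrite ler_pXn2r ?nnegrE ?mulr_ge0 ?enorm_ge0.
move=> /le_trans; apply; rewrite exprMn enorm_sqr -mulrA.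
by apply: ler_wpM2l; [exact: exprn_ge0|exact: hC].
Qed.

Lemma deviation_le_lyapunov : exists2 C, 0 <= C & forall t s s',
  deviation t s' ^+ 2 <= C * lyapunov t s s'.
Proof.
have [C C0 hC] := kn_coercive.
have s2 : 0 < sigma / 2 by rewrite divr_gt0.
have ts : 0 < 2 * tau * sigma by rewrite !mulr_gt0.
have [_ /ltW b0] := andP alpha01; rewrite -subr_ge0 in b0.
exists (3 * (2 * tau * sigma + (sigma / 2)^-1 + C * (sigma / 2)^-1)).
  by rewrite mulr_ge0// !addr_ge0 ?mulr_ge0 ?invr_ge0// ltW.
move=> t s s'; set M := lyapunov t s s'.
have x0 := inner_ge0 (pd_x s' - pd_x t); have q0 := inner_ge0 (pd_q s' - pd_q t).
have n0 := kn_ge0 (pd_n s' - pd_n t); have v0 := sn_ge0 (pd_v s' - pd_v t).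
have r0 : 0 <= sigma / 2 * ((1 - alpha) *
      (`|1 - tau| * mu * inner (pd_residual s s') (pd_residual s s')
       + kn (pd_n s' - pd_n s))).
  apply: mulr_ge0; first exact: ltW.
  apply: mulr_ge0 => //; apply: addr_ge0; last exact: kn_ge0.
  by apply: mulr_ge0 (inner_ge0 _); apply: mulr_ge0 => //; exact: ltW.
have hx : inner (pd_x s' - pd_x t) (pd_x s' - pd_x t) <= 2 * tau * sigma * M.
  rewrite -ler_pdivrMl// /M /lyapunov.
  have h1 := mulr_ge0 (ltW s2) q0; have h2 := mulr_ge0 (ltW s2) n0.
  by move: r0; set z := sigma / 2 * ((1 - alpha) * _) => r0; lra.
have ix : 0 <= (2 * tau * sigma)^-1 * inner (pd_x s' - pd_x t) (pd_x s' - pd_x t).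
  by rewrite mulr_ge0// invr_ge0 ltW.
have hq : inner (pd_q s' - pd_q t) (pd_q s' - pd_q t) <= (sigma / 2)^-1 * M.
  rewrite ler_pdivlMl// /M /lyapunov.
  have h2 := mulr_ge0 (ltW s2) n0.
  by move: r0 ix; set z := sigma / 2 * ((1 - alpha) * _); set z' := _^-1 * _ => r0 ix; lra.
have hn : kn (pd_n s' - pd_n t) <= (sigma / 2)^-1 * M.
  rewrite ler_pdivlMl// /M /lyapunov.
  have h2 := mulr_ge0 (ltW s2) q0.
  by move: r0 ix; set z := sigma / 2 * ((1 - alpha) * _); set z' := _^-1 * _ => r0 ix; lra.
have hn' := le_trans (hC _) (ler_wpM2l C0 hn).
move: hx hq hn'; rewrite -!enorm_sqr /deviation.
set u := enorm _; set v := enorm _; set w := enorm _ => hx hq hn'.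
have : (u + v + w) ^+ 2 <= 3 * (u ^+ 2 + v ^+ 2 + w ^+ 2).
  have := sqr_ge0 (u - v); have := sqr_ge0 (u - w); have := sqr_ge0 (v - w); lra.
move=> /le_trans; apply; rewrite -[leRHS]mulrA; apply: ler_wpM2l => //.
by move: hx hq hn'; set i := (sigma / 2)^-1 => hx hq hn'; lra.
Qed.

Variables (eps : nat -> R) (st : nat -> state).
Hypothesis eps_ge0 : forall k, 0 <= eps k.
Hypothesis eps_summable : cvgn (series eps).
Hypothesis steps : forall k, prox_step (eps k) (st k) (st k.+1).
Hypothesis gaps : forall k t, pd_kkt t -> cocoercive (st k) t.

Let lyap t k := lyapunov t (st k) (st k.+1).
Let diss t k := dissipation t (st k.+1) (st k.+2).

(** The errors are tolerances times distances, hence linear in [deviation], whereas [lyapunov]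
    dominates its square. They are therefore at most a multiple of
    [E k * (1 + lyap t k + lyap t k.+1)], as [summable_recursion] requires. *)
Lemma lyapunov_cvg t : pd_kkt t -> cvgn (lyap t) /\ diss t @ \oo --> 0.
Proof.
move=> kt.
have [CY CY0 hY] := yz_deviation; have [CV CV0 hV] := vw_deviation.
have [CD CD0 hD] := deviation_le_lyapunov.
have Snd : nondecreasing_seq (series eps).
  by apply: nondecreasing_series => k _ _; exact: eps_ge0.
pose M := limn (series eps).
have epsM k : eps k <= M.
  apply: le_trans (nondecreasing_cvgn_le Snd eps_summable k.+1).
  rewrite seriesSr lerDr /series /=; apply: sumr_ge0 => i _; exact: eps_ge0.
have M0 : 0 <= M by apply: le_trans (epsM 0).
pose E k := eps k + eps k.+1.
have E0 k : 0 <= E k by rewrite addr_ge0.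
have E_summable : cvgn (series E).
  apply: (@is_cvg_seriesD _ eps (fun k => eps k.+1)) => //.
  have -> : series (fun k => eps k.+1) = (fun k => series eps k.+1 - eps 0).
    apply/funext => k; elim: k => [|k ih].
      by rewrite /series /= big_geq// big_nat1 subrr.
    by rewrite seriesSr ih [series eps k.+2]seriesSr addrAC.
  apply: is_cvgB; last exact: is_cvg_cst.
  move/cvg_ex : eps_summable => [l hl]; apply/cvg_ex; exists l.
  by rewrite (cvg_shiftS (series eps)).
pose B := 2 + CD.
have dB s s' : deviation t s' <= B + CD * lyapunov t s s'.
  have := hD t s s'; have := sqr_ge0 (deviation t s' - 1).
  have := mulr_ge0 CD0 (lyapunov_ge0 t s s').
  rewrite /B; have := deviation_ge0 t s'; move: (deviation t s') => d; nra.
have B0 : 0 <= B by rewrite addr_ge0.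
pose G := CV + CY + 2 * CY.
have G0 : 0 <= G by rewrite /G; lra.
have H0 : 0 <= 2 * B + M + CD by lra.
apply: (@summable_recursion _ (lyap t) (diss t) E (G * (2 * B + M + CD))) => //.
- by move=> k; exact: lyapunov_ge0.
- by move=> k; exact: dissipation_ge0.
- exact: mulr_ge0.
move=> k; apply: le_trans (lyapunov_descent (steps k) (steps k.+1) kt (gaps _ kt)) _.
rewrite lerD2l.
set s := st k.+1; set s' := st k.+2.
have d0 := deviation_ge0 t s; have d0' := deviation_ge0 t s'.
pose D := deviation t s + deviation t s' + M.
have DM : 0 <= D by rewrite /D; lra.
have hv : enorm (pd_v s' - pd_v t) + enorm (pd_w s' - pd_w t) <= CV * D.
  apply: le_trans (hV _ _ _ _ (steps k.+1) kt (gaps _ kt)) _.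
  by apply: ler_wpM2l => //; rewrite lerD2l.
have hy : enorm (pd_z s' - pd_z t) + enorm (pd_y s' - pd_y t) <= CY * D.
  rewrite addrC; apply: le_trans (hY _ _) _; apply: ler_wpM2l => //.
  by rewrite /D; lra.
have hz : enorm (pd_z s' - pd_z s) + enorm (pd_y s' - pd_y s) <= 2 * CY * D.
  have h1 := hY t s; have h2 := hY t s'.
  have h3 : CY * deviation t s <= CY * D by apply: ler_wpM2l => //; rewrite /D; lra.
  have h4 : CY * deviation t s' <= CY * D by apply: ler_wpM2l => //; rewrite /D; lra.
  have h5 : enorm (pd_z s' - pd_z s) <= enorm (pd_z s' - pd_z t) + enorm (pd_z s - pd_z t).
    by rewrite -[pd_z s' - _](subrKA (pd_z t)) -[X in _ + X]opprB; exact: enormB.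
  have h6 : enorm (pd_y s' - pd_y s) <= enorm (pd_y s' - pd_y t) + enorm (pd_y s - pd_y t).
    by rewrite -[pd_y s' - _](subrKA (pd_y t)) -[X in _ + X]opprB; exact: enormB.
  lra.
have h1 := ler_wpM2l (eps_ge0 k.+1) (lerD hv hy).
have h2 := ler_wpM2l (E0 k) hz.
have GD : 0 <= G * D by exact: mulr_ge0.
have h3 : eps k.+1 * (CV * D + CY * D) <= E k * (CV * D + CY * D).
  apply: ler_wpM2r; first by apply: addr_ge0; exact: mulr_ge0.
  by rewrite /E lerDr.
have [a0 a1] := andP alpha01.
have h4 : (1 - alpha) * (E k * (enorm (pd_z s' - pd_z s) + enorm (pd_y s' - pd_y s)))
    <= E k * (2 * CY * D).
  apply: le_trans h2; rewrite -[leRHS]mul1r; apply: ler_wpM2r; last by lra.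
  by rewrite mulr_ge0// addr_ge0// enorm_ge0.
have h5 : D <= (2 * B + M + CD) * (1 + lyap t k + lyap t k.+1).
  have := dB (st k) s; have := dB s s'; rewrite -/(lyap t k) -/(lyap t k.+1).
  have l0 : 0 <= lyap t k by exact: lyapunov_ge0.
  have l0' : 0 <= lyap t k.+1 by exact: lyapunov_ge0.
  rewrite /D; have := mulr_ge0 B0 l0; have := mulr_ge0 B0 l0'.
  have := mulr_ge0 M0 l0; have := mulr_ge0 M0 l0'; lra.
have h6 := ler_wpM2l (mulr_ge0 (E0 k) G0) h5.
have h7 : E k * G * D = E k * (CV * D + CY * D) + E k * (2 * CY * D).
  by rewrite /G; ring.
rewrite [leRHS](_ : _ = E k * G * ((2 * B + M + CD) * (1 + lyap t k + lyap t k.+1))); last by ring.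
apply: le_trans h6; rewrite h7; apply: lerD; last exact: h4.
exact: le_trans h1 h3.
Qed.

Hypothesis grad_continuous : continuous grad.
Hypothesis MV_closed : forall (G : set_system nat) (v x : nat -> E) (vl xl : E),
  ProperFilter G -> (forall k, MV (v k) (x k)) ->
  v @ G --> vl -> x @ G --> xl -> MV vl xl.
Hypothesis MZ_closed : forall (G : set_system nat) (v x : nat -> E) (vl xl : E),
  ProperFilter G -> (forall k, MZ (v k) (x k)) ->
  v @ G --> vl -> x @ G --> xl -> MZ vl xl.

Lemma dissipation_vanishing t : pd_kkt t ->
  [/\ pd_residual (st k.+1) (st k.+2) @[k --> \oo] --> (0 : E),
      pd_q (st k.+2) - pd_q (st k.+1) @[k --> \oo] --> (0 : E),
      pd_n (st k.+2) - pd_n (st k.+1) @[k --> \oo] --> (0 : F)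
    & S (pd_v (st k.+2) - pd_v (st k.+1)) @[k --> \oo] --> (0 : E)].
Proof.
move=> kt; have [_ d_cvg0] := lyapunov_cvg kt.
have s2 : 0 < sigma / 2 by rewrite divr_gt0.
have scaled C : C * diss t k @[k --> \oo] --> 0.
  have : C * diss t k @[k --> \oo] --> C * 0.
    by apply: cvgM; [exact: cvg_cst|exact: d_cvg0].
  by rewrite mulr0.
have terms k : [/\
    inner (pd_residual (st k.+1) (st k.+2)) (pd_residual (st k.+1) (st k.+2))
      <= (sigma / 2 * c)^-1 * diss t k,
    inner (pd_q (st k.+2) - pd_q (st k.+1)) (pd_q (st k.+2) - pd_q (st k.+1))
      <= (sigma / 2 * c)^-1 * diss t k,
    kn (pd_n (st k.+2) - pd_n (st k.+1)) <= (sigma / 2)^-1 * diss t k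
    & sn (pd_v (st k.+2) - pd_v (st k.+1)) <= 2 * diss t k].
  have sc := mulr_gt0 s2 c_gt0; rewrite !ler_pdivlMl// /diss /dissipation.
  set r := pd_residual _ _; set dq := pd_q _ - _; set dn := pd_n _ - _.
  set dv := pd_v _ - _; set dw := pd_w _ - _.
  have h1 := mulr_ge0 (ltW sc) (inner_ge0 r).
  have h2 := mulr_ge0 (ltW sc) (inner_ge0 dq).
  have h3 := mulr_ge0 (ltW s2) (kn_ge0 dn).
  have h4 := sn_ge0 dv; have h5 := Qpsd dw.
  by split; lra.
have [CK CK0 hK] := kn_coercive.
have [CS CS0 hS] := psd_image_le Ssa Spsd.
split.
- by apply: (mx_cvg0_sqr _ (scaled (sigma / 2 * c)^-1)) => k; have [] := terms k.
- by apply: (mx_cvg0_sqr _ (scaled (sigma / 2 * c)^-1)) => k; have [] := terms k.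
- apply: (mx_cvg0_sqr _ (scaled (CK * (sigma / 2)^-1))) => k.
  rewrite -mulrA; apply: le_trans (hK _) _.
  by apply: ler_wpM2l => //; have [] := terms k.
- apply: (mx_cvg0_sqr _ (scaled (CS * 2))) => k.
  rewrite -mulrA; apply: le_trans (hS _) _.
  by apply: ler_wpM2l => //; have [] := terms k.
Qed.

(** The shifts arise because [lyap t k] controls the iterate [k.+1], and [vw_deviation] needs two
    controlled iterates in a row. *)
Lemma prox_admm_bounded t : pd_kkt t -> exists B, forall k,
  [/\ enorm (pd_x (st k.+1)) <= B, enorm (pd_y (st k.+2)) <= B,
      enorm (pd_z (st k.+2)) <= B, enorm (pd_v (st k.+2)) <= B
    & enorm (pd_w (st k.+2)) <= B].
Proof.
move=> kt; have [l_cvg _] := lyapunov_cvg kt.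
have [CY CY0 hY] := yz_deviation; have [CV CV0 hV] := vw_deviation.
have [CD CD0 hD] := deviation_le_lyapunov.
have [M [_ lM]] := cvg_seq_bounded l_cvg.
have {}lM k : lyap t k <= M + 1.
  apply: le_trans (ler_norm _) _; apply: lM => //; by rewrite ltrDl.
have [N [_ eN]] := cvg_seq_bounded (cvgP _ (cvg_series_cvg_0 eps_summable)).
have {}eN k : eps k <= N + 1.
  apply: le_trans (ler_norm _) _; apply: eN => //; by rewrite ltrDl.
pose D := 1 + CD * (M + 1).
have dD k : deviation t (st k.+1) <= D.
  have := hD t (st k) (st k.+1); have := ler_wpM2l CD0 (lM k).
  rewrite /D /lyap; have := sqr_ge0 (deviation t (st k.+1) - 1).
  move: (deviation t _) => d; move: (CD * lyapunov _ _ _) => l; nra.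
pose B := D + CY * D + CV * (D + D + (N + 1))
  + (enorm (pd_x t) + enorm (pd_y t) + enorm (pd_z t) + enorm (pd_v t) + enorm (pd_w t)).
have shift m' n' (u v : 'M[R]_(m', n')) : enorm u <= enorm (u - v) + enorm v.
  by rewrite -{1}(subrK v u); exact: enormD.
exists B => k.
have D0 : 0 <= D by apply: le_trans (dD k); exact: deviation_ge0.
have N0 : 0 <= N + 1 by apply: le_trans (eN 0).
have hx : enorm (pd_x (st k.+1) - pd_x t) <= D.
  apply: le_trans (dD k); rewrite /deviation -addrA lerDl.
  by rewrite addr_ge0// enorm_ge0.
have hy := le_trans (hY t (st k.+2)) (ler_wpM2l CY0 (dD k.+1)).
have hv : enorm (pd_v (st k.+2) - pd_v t) + enorm (pd_w (st k.+2) - pd_w t)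
    <= CV * (D + D + (N + 1)).
  apply: le_trans (hV _ _ _ _ (steps k.+1) kt (gaps _ kt)) _.
  by apply: ler_wpM2l => //; apply: lerD => //; apply: lerD.
have y0 := enorm_ge0 (pd_y (st k.+2) - pd_y t).
have z0 := enorm_ge0 (pd_z (st k.+2) - pd_z t).
have v0 := enorm_ge0 (pd_v (st k.+2) - pd_v t).
have w0 := enorm_ge0 (pd_w (st k.+2) - pd_w t).
have [[x1 y1] [z1 v1] w1] : [/\ 0 <= enorm (pd_x t) /\ 0 <= enorm (pd_y t),
    0 <= enorm (pd_z t) /\ 0 <= enorm (pd_v t) & 0 <= enorm (pd_w t)].
  by split; rewrite ?enorm_ge0//; split; exact: enorm_ge0.
have CYD := mulr_ge0 CY0 D0.
have CVD : 0 <= CV * (D + D + (N + 1)) by apply: mulr_ge0 => //; lra.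
rewrite /B; split.
- have := shift _ _ (pd_x (st k.+1)) (pd_x t); lra.
- have := shift _ _ (pd_y (st k.+2)) (pd_y t); lra.
- have := shift _ _ (pd_z (st k.+2)) (pd_z t); lra.
- have := shift _ _ (pd_v (st k.+2)) (pd_v t); lra.
- have := shift _ _ (pd_w (st k.+2)) (pd_w t); lra.
Qed.

(** Along an ultrafilter finer than [\oo] all components converge, while the residual, the proximal
    moves and the errors tend to 0; the limit of the optimality conditions is the KKT system. The
    exported limits are those that occur in the Lyapunov function. *)
Lemma prox_admm_cluster t : pd_kkt t ->
  exists (G : set_system nat) (l : state), [/\ ProperFilter G,
    \oo `<=` G, pd_kkt l & [/\ pd_x (st k.+2) @[k --> G] --> pd_x l,
      pd_q (st k.+2) @[k --> G] --> pd_q l,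
      pd_n (st k.+2) @[k --> G] --> pd_n l
    & pd_v (st k.+2) @[k --> G] --> pd_v l]].
Proof.
move=> kt; have [B hB] := prox_admm_bounded kt.
have [r0 dq0 dn0 dv0] := dissipation_vanishing kt.
have [G [UG ooG]] := @ultraFilterLemma nat \oo _.
have PG : ProperFilter G by exact: ultra_proper.
have onG m' n' (u : nat -> 'M[R]_(m', n')) (l : 'M[R]_(m', n')) :
    u @ \oo --> l -> u @ G --> l by move=> ul Z /ul; exact: ooG.
have {}r0 := onG _ _ _ _ r0; have {}dq0 := onG _ _ _ _ dq0.
have {}dn0 := onG _ _ _ _ dn0; have {}dv0 := onG _ _ _ _ dv0.
have limG m' n' (u : nat -> 'M[R]_(m', n')) : (forall k, enorm (u k) <= B) ->
    exists l : 'M[R]_(m', n'), u @ G --> l.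
  by move=> uB; exact: bounded_ultra_cvg uB.
have [xl hx] := limG _ _ (fun k => pd_x (st k.+1)) (fun k => let: And5 h _ _ _ _ := hB k in h).
have [yl hy] := limG _ _ (fun k => pd_y (st k.+2)) (fun k => let: And5 _ h _ _ _ := hB k in h).
have [zl hz] := limG _ _ (fun k => pd_z (st k.+2)) (fun k => let: And5 _ _ h _ _ := hB k in h).
have [vl hv] := limG _ _ (fun k => pd_v (st k.+2)) (fun k => let: And5 _ _ _ h _ := hB k in h).
have [wl hw] := limG _ _ (fun k => pd_w (st k.+2)) (fun k => let: And5 _ _ _ _ h := hB k in h).
have sr0 (s' : R) (u : nat -> E) : u @ G --> (0 : E) -> s' *: u k @[k --> G] --> (0 : E).
  by move=> u0; rewrite -[X in _ --> X](scaler0 _ s'); apply: mx_cvgZ => //; exact: cvg_cst.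
have sr0F (s' : R) (u : nat -> F) : u @ G --> (0 : F) -> s' *: u k @[k --> G] --> (0 : F).
  by move=> u0; rewrite -[X in _ --> X](scaler0 _ s'); apply: mx_cvgZ => //; exact: cvg_cst.
have K0 : K (pd_n (st k.+2) - pd_n (st k.+1)) @[k --> G] --> (0 : F).
  by exact: (cvg_lin0 K dn0).
have AsK0 : As (K (pd_n (st k.+2) - pd_n (st k.+1))) @[k --> G] --> (0 : E).
  by exact: (cvg_lin0 As K0).
have LK0 : L (K (pd_n (st k.+2) - pd_n (st k.+1))) @[k --> G] --> (0 : F).
  by exact: (cvg_lin0 L K0).
have e_cvg0 : eps k.+1 @[k --> G] --> 0.
  have : eps k.+1 @[k --> \oo] --> 0.
    by rewrite (cvg_shiftS eps); exact: cvg_series_cvg_0.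
  by move=> h Z /h; exact: ooG.
have err0 m' n' (u : nat -> 'M[R]_(m', n')) :
    (forall k, enorm (u k) <= eps k.+1) -> u @ G --> (0 : 'M[R]_(m', n')).
  by move=> ue; apply: (mx_cvg_le _ e_cvg0) => k; rewrite subr0.
pose r k := pd_residual (st k.+1) (st k.+2).
pose xc k := pd_x (st k.+1) + sigma *: r k.
pose xh k := pd_x (st k.+1) + sigma *: (r k + (pd_q (st k.+1) - pd_q (st k.+2))).
have hxc : xc k @[k --> G] --> xl.
  by rewrite -[xl]addr0; apply: mx_cvgD => //; exact: sr0.
have hxh : xh k @[k --> G] --> xl.
  rewrite -[xl]addr0; apply: mx_cvgD => //; apply: sr0.
  rewrite -[0]addr0; apply: mx_cvgD => //; rewrite -oppr0.
  by under eq_fun => k do rewrite -opprB; exact: mx_cvgN.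
have /choice[er her] : forall k, exists er : E * E * E * F,
  [/\ enorm er.1.1.1 <= eps k.+1, enorm er.1.1.2 <= eps k.+1,
      enorm er.1.2 <= eps k.+1 & enorm er.2 <= eps k.+1] /\
  [/\ Q (pd_w (st k.+2)) - Q (xh k) = er.1.1.1,
      MV (pd_v (st k.+2)) (xh k + S (pd_v (st k.+2) - pd_v (st k.+1)) + er.1.1.2),
      MZ (pd_z (st k.+2)) (xc k + sigma *: As (K (pd_n (st k.+2) - pd_n (st k.+1)))
                          + er.1.2)
    & A (xc k) - b + sigma *: L (K (pd_n (st k.+2) - pd_n (st k.+1))) = er.2].
  move=> k; have [_ _ [e [a [f [g h]]]]] := steps k.+1.
  by exists (e, a, f, g).
have xl2 : pd_x (st k.+2) @[k --> G] --> xl.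
  rewrite -[xl]addr0; under eq_fun => k do
    rewrite (let: And3 h _ _ := steps k.+1 in h).
  by apply: mx_cvgD => //; exact: sr0.
have Qwl : Q wl = Q xl.
  apply/subr0_eq/(@mx_cvg_unique _ _ G _ _ (fun k => Q (pd_w (st k.+2)) - Q (xh k))).
    by apply: mx_cvgB; exact: cvg_lin.
  by apply: err0 => k; have [[he _ _ _] [-> _ _ _]] := her k.
(* The range of [Q] is closed: the continuous map [Q \o g] is the identity on it. *)
have wlW : range Q wl.
  have [g Qg] := lin_pseudo_inverse Q; exists (g wl) => //.
  have h1 : Q (g (pd_w (st k.+2))) @[k --> G] --> Q (g wl).
    by apply: cvg_lin; exact: cvg_lin.
  apply: (mx_cvg_unique PG h1); apply: cvg_trans hw; apply: near_eq_cvg.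
  by near=> k; have [_ [u _ <-] _] := steps k.+1; rewrite Qg.
exists G, (PrimalDual vl wl yl zl xl).
have hq : pd_q (st k.+2) @[k --> G] --> As yl + zl.
  by apply: mx_cvgD => //; exact: cvg_lin.
split; [exact: PG|exact: ooG| |]; last first.
  split; [exact: xl2|exact: hq| |exact: hv].
  by apply: mx_cvgD; exact: cvg_lin.
split; [| | | |by split].
- apply/subr0_eq/(@mx_cvg_unique _ _ G _ _ (fun k => A (xc k) - b)).
    by apply: mx_cvgB; [exact: cvg_lin|exact: cvg_cst].
  have -> : (fun k => A (xc k) - b) = (fun k => (er k).2 -
      sigma *: L (K (pd_n (st k.+2) - pd_n (st k.+1)))).
    by apply/funext => k; have [_ [_ _ _ <-]] := her k; rewrite addrK.
  rewrite -[0]subr0; apply: mx_cvgB; last exact: sr0F.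
  by apply: err0 => k; have [[]] := her k.
- have hg : grad (pd_x (st k.+1)) @[k --> G] --> grad xl.
    exact: (cvg_comp _ _ hx (@grad_continuous xl)).
  have hr : r k @[k --> G] --> As yl + zl + vl - (grad xl - Q xl) - Q wl.
    apply: mx_cvgB; last exact: cvg_lin.
    apply: mx_cvgB; first by apply: mx_cvgD.
    by apply: mx_cvgB => //; exact: cvg_lin.
  have := mx_cvg_unique PG hr r0; rewrite Qwl => h.
  apply/subr0_eq; rewrite -[RHS]oppr0 -h.
  by apply/matrixP => i j; rewrite !mxE; ring.
- have hMV k : MV (pd_v (st k.+2))
      (xh k + S (pd_v (st k.+2) - pd_v (st k.+1)) + (er k).1.1.2).
    by have [_ []] := her k.
  apply: (MV_closed PG hMV hv).
  rewrite -[xl]addr0; apply: mx_cvgD; last by apply: err0 => k; have [[]] := her k.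
  by rewrite -[xl]addr0; exact: mx_cvgD hxh dv0.
- have hMZ k : MZ (pd_z (st k.+2))
      (xc k + sigma *: As (K (pd_n (st k.+2) - pd_n (st k.+1))) + (er k).1.2).
    by have [_ []] := her k.
  apply: (MZ_closed PG hMZ hz).
  rewrite -[xl]addr0; apply: mx_cvgD; last by apply: err0 => k; have [[]] := her k.
  by rewrite -[xl]addr0; apply: (mx_cvgD hxc); exact: sr0.
Unshelve. all: by end_near.
Qed.

Theorem prox_admm_cvg : (exists t, pd_kkt t) -> exists2 l, pd_kkt l &
  [/\ pd_v (st k) @[k --> \oo] --> pd_v l, pd_w (st k) @[k --> \oo] --> pd_w l,
      pd_y (st k) @[k --> \oo] --> pd_y l, pd_z (st k) @[k --> \oo] --> pd_z l
    & pd_x (st k) @[k --> \oo] --> pd_x l].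
Proof.
move=> [t kt]; have [G [l [PG ooG kl [hx hq hn hv]]]] := prox_admm_cluster kt.
exists l; first exact: kl.
have [r0 _ dn0 _] := dissipation_vanishing kl.
have [l_cvg _] := lyapunov_cvg kl.
(* The whole sequence [lyap l] converges, so its limit may be computed along [G], where every term
   tends to 0. *)
have lyap_cvg0 : lyap l @ \oo --> 0.
  suff <- : limn (lyap l) = 0 by [].
  have h1 : lyap l k.+1 @[k --> G] --> limn (lyap l).
    have : lyap l k.+1 @[k --> \oo] --> limn (lyap l) by rewrite (cvg_shiftS (lyap l)).
    by move=> h Z /h; exact: ooG.
  apply: (@cvg_unique _ (@Rhausdorff R) _ _ _ _ h1).
  have onG m' n' (u : nat -> 'M[R]_(m', n')) (z : 'M[R]_(m', n')) :
    u @ \oo --> z -> u @ G --> z by move=> ul Z /ul; exact: ooG.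
  have sq m' n' (u : nat -> 'M[R]_(m', n')) (z : 'M[R]_(m', n'))
      (H : {linear 'M[R]_(m', n') -> 'M[R]_(m', n')}) :
      u @ G --> z -> inner (u k - z) (H (u k - z)) @[k --> G] --> 0.
    move=> uz; have uz0 : u k - z @[k --> G] --> (0 : 'M[R]_(m', n')).
      by rewrite -(subrr z); apply: mx_cvgB => //; exact: cvg_cst.
    by apply: (cvg_inner0 uz0); exact: cvg_lin0 uz0.
  have idE : linear (idfun : E -> E) by [].
  have c0 (s' : R) (u : nat -> R) : u @ G --> 0 -> s' * u k @[k --> G] --> 0.
    move=> u0; have : s' * u k @[k --> G] --> s' * 0.
      by apply: cvgM => //; exact: cvg_cst.
    by rewrite mulr0.
  have p0 (u v : nat -> R) : u @ G --> 0 -> v @ G --> 0 -> u k + v k @[k --> G] --> 0.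
    by move=> u0 v0; rewrite -[X in _ --> X](addr0 (0 : R)); exact: cvgD.
  apply: (p0); last first.
    do 2 apply: (c0); apply: (p0).
      apply: (c0); exact: cvg_inner0 (onG _ _ _ _ r0) (onG _ _ _ _ r0).
    apply: (cvg_inner0 (onG _ _ _ _ dn0)); exact: cvg_lin0 (onG _ _ _ _ dn0).
  apply: (p0); last by under eq_fun => k do rewrite mulrC; apply: (c0); exact: sq.
  apply: (p0); last by apply: (c0); exact: sq.
  apply: (p0); apply: (c0).
    exact: (sq _ _ _ _ (linear_pack idE) hx).
  exact: (sq _ _ _ _ (linear_pack idE) hq).
have [CY CY0 hY] := yz_deviation; have [CV CV0 hV] := vw_deviation.
have [CD CD0 hD] := deviation_le_lyapunov.
have scale0 C (u : nat -> R) : u @ \oo --> 0 -> C * u k @[k --> \oo] --> 0.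
  move=> u0; have : C * u k @[k --> \oo] --> C * 0.
    by apply: cvgM => //; exact: cvg_cst.
  by rewrite mulr0.
have dev0 : deviation l (st k.+1) @[k --> \oo] --> 0.
  have h : Num.sqrt (CD * lyap l k) @[k --> \oo] --> 0.
    by have := cvg_comp _ _ (scale0 CD _ lyap_cvg0) (@sqrt_continuous R 0); rewrite sqrtr0.
  apply: (squeeze_cvgr (nearW _ _) (cvg_cst 0) h) => k.
  rewrite deviation_ge0/= -[leLHS]ger0_norm ?deviation_ge0// -sqrtr_sqr.
  by apply: ler_wsqrtr; exact: hD.
have dev1 : deviation l (st k.+2) @[k --> \oo] --> 0.
  by rewrite (cvg_shiftS (fun k => deviation l (st k.+1))).
have eps0 : eps k.+1 @[k --> \oo] --> 0.
  by rewrite (cvg_shiftS eps); exact: cvg_series_cvg_0.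
have vw0 : CV * (deviation l (st k.+1) + deviation l (st k.+2) + eps k.+1)
    @[k --> \oo] --> 0.
  apply: scale0; rewrite -[X in _ --> X](addr0 (0 : R)); apply: cvgD => //.
  by rewrite -[X in _ --> X](addr0 (0 : R)); exact: cvgD.
have yz0 := scale0 CY _ dev0.
have vw k := hV _ _ _ _ (steps k.+1) kl (gaps k.+1 kl).
split.
(* The estimate for [v] and [w] starts at the iterate of index 2, hence two shifts; one is enough
   for [y], [z] and [x]. *)
- rewrite -(cvg_shiftS (fun k => pd_v (st k))) -(cvg_shiftS (fun k => pd_v (st k.+1))).
  apply: (mx_cvg_le _ vw0) => k; apply: le_trans (vw k).
  by rewrite lerDl enorm_ge0.
- rewrite -(cvg_shiftS (fun k => pd_w (st k))) -(cvg_shiftS (fun k => pd_w (st k.+1))).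
  apply: (mx_cvg_le _ vw0) => k; apply: le_trans (vw k).
  by rewrite lerDr enorm_ge0.
- rewrite -(cvg_shiftS (fun k => pd_y (st k))).
  apply: (mx_cvg_le _ yz0) => k; apply: le_trans (hY l _).
  by rewrite lerDl enorm_ge0.
- rewrite -(cvg_shiftS (fun k => pd_z (st k))).
  apply: (mx_cvg_le _ yz0) => k; apply: le_trans (hY l _).
  by rewrite lerDr enorm_ge0.
- rewrite -(cvg_shiftS (fun k => pd_x (st k))).
  apply: (mx_cvg_le _ dev0) => k.
  by rewrite /deviation -addrA lerDl addr_ge0// enorm_ge0.
Qed.

End ProximalADMM.

(** * Symmetric Gauss-Seidel sweeps *)

Section SymmetricGaussSeidel.
Context {R : realType} {m n p q : nat}.
Notation E := 'M[R]_(m, n).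
Notation F := 'M[R]_(p, q).
Notation state := (primal_dual R m n p q).
Variables (As : {linear F -> E}) (A : {linear E -> F}).
Variables (Q : {linear E -> E}) (D L U : {linear F -> F}).
Variables (grad : E -> E) (b : F) (MV MZ : E -> E -> Prop).
Variables (alpha sigma tau : R).

(** The conditions of all sweeps on stacked vectors. In the application the [v], [w] and [z] blocks
    of different stages decouple, so only [y] needs the splitting [D + L + U]: the forward sweep has
    the old [y] above the diagonal, and the backward sweep keeps the forward values [yt] below
    it. *)
Definition sgs_step (eps : R) (s s' : state) : Prop :=
  let x := pd_x s in
  let c := grad x - Q x in
  exists (wt : E) (yt : F) ev ez,
  [/\ enorm ev <= eps /\ enorm ez <= eps,
      [/\ enorm (Q wt - Q (x + sigma *:
            (As (pd_y s) + pd_v s + pd_z s - c - Q wt))) <= eps,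
          MV (pd_v s')
            (x + sigma *: (As (pd_y s) + pd_v s' + pd_z s - c - Q wt) - ev),
          enorm (Q (pd_w s') - Q (x + sigma *:
            (As (pd_y s) + pd_v s' + pd_z s - c - Q (pd_w s')))) <= eps
        & range Q (pd_w s')],
      [/\ enorm (A (x + sigma *: (pd_v s' + pd_z s - c - Q (pd_w s'))) - b
            + sigma *: (D yt + L yt + U (pd_y s))) <= eps,
          MZ (pd_z s')
            (x + sigma *: (As yt + pd_v s' + pd_z s' - c - Q (pd_w s')) - ez)
        & enorm (A (x + sigma *: (pd_v s' + pd_z s' - c - Q (pd_w s'))) - b
            + sigma *: (D (pd_y s') + L yt + U (pd_y s'))) <= eps]
    & pd_x s' = x + (tau * sigma) *: pd_residual As Q grad s s'].

Hypothesis adjA : forall x y, inner (A x) y = inner x (As y).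
Hypothesis AAsE : forall y, A (As y) = D y + L y + U y.
Hypothesis adjLU : forall y y', inner (L y) y' = inner y (U y').
Hypothesis Dsa : self_adjoint D.
Hypothesis Dpd : pos_def D.
Hypothesis Qsa : self_adjoint Q.
Hypothesis Qpsd : pos_semidef Q.
Hypothesis sigma_gt0 : 0 < sigma.

(** [D + L] is injective, because [|As y|^2 = - <y, D y>] on its kernel. Since
    [(D + L) y = A (As y + z) - (U y + A z)], the vector [y] is controlled by the two quantities on
    the right. *)
Lemma sgs_y_bound : exists2 C, 0 <= C & forall (y : F) (z : E),
  enorm y <= C * (enorm (As y + z) + enorm (U y + A z)).
Proof.
have [B B0 hB] := lin_bounded A.
have DLl : linear (fun y => D y + L y).
  by move=> k x y; rewrite !linearP scalerDr addrACA.
have idl : linear (idfun : F -> F) by [].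
have [C C0 hC] : exists2 C, 0 <= C & forall y, enorm y <= C * enorm (D y + L y).
  apply: (lin_ker_le (f := linear_pack DLl) (h := linear_pack idl)) => y /= DLy.
  apply/eqP/negPn/negP => /Dpd Dy.
  have h1 : inner y (D y) + inner y (L y) = 0 by rewrite -innerDr DLy inner0r.
  have Uy : inner (U y) y = inner y (L y) by rewrite innerC -adjLU innerC.
  have := inner_ge0 (As y); rewrite -adjA AAsE !innerDl Uy.
  rewrite (innerC (D y)) (innerC (L y)); lra.
exists (C * (B + 1)); first by rewrite mulr_ge0// addr_ge0.
move=> y z.
apply: le_trans (hC y) _; rewrite -mulrA; apply: ler_wpM2l => //.
have -> : D y + L y = A (As y + z) - (U y + A z).
  by rewrite linearD /= AAsE; apply/matrixP => i j; rewrite !mxE; ring.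
apply: le_trans (enormB _ _) _.
have := hB (As y + z); have := enorm_ge0 (As y + z).
have := mulr_ge0 B0 (enorm_ge0 (U y + A z)); lra.
Qed.

(* The two Gauss-Seidel sweeps in [w], resp. [y], amount to one joint
   minimization with the proximal operators
   [sigma^2 (I + sigma Q)^-1 Q] in [v], resp. [sigma N^T D^-1 N] in [(y, z)]
   with [N (y, z) = U y + A z]. *)
Lemma sgs_prox_step : exists (S : {linear E -> E}) (K : {linear F -> F}) C,
  [/\ self_adjoint S, pos_semidef S, self_adjoint K, pos_def K & 0 <= C] /\
  forall eps s s', sgs_step eps s s' ->
    prox_step As A Q S K L U grad b MV MZ sigma tau (C * eps) s s'.
Proof.
have [K [DK KD Ksa Kpd]] := posdef_inverse Dsa Dpd.
have Il : linear (fun x : E => x + sigma *: Q x).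
  by move=> k x y; apply/matrixP => i j; rewrite (linearP Q) !mxE; ring.
have IsqE x : linear_pack Il x = x + sigma *: Q x by [].
have Isa : self_adjoint (linear_pack Il).
  by move=> x y; rewrite !IsqE innerDl innerDr innerZl innerZr Qsa.
have Ipd : pos_def (linear_pack Il).
  move=> x x0; rewrite IsqE innerDr innerZr.
  apply: ltr_wpDr; first by apply: mulr_ge0; [exact: ltW|exact: Qpsd].
  rewrite lt_neqAle inner_ge0 andbT eq_sym; apply: contra_neq x0.
  exact: inner_eq0.
have [J [IJ JI Jsa _]] := posdef_inverse Isa Ipd.
have JE x : J x + sigma *: Q (J x) = x by rewrite -IsqE JI.
have JQ x : J (Q x) = Q (J x).
  rewrite -[RHS]IJ; congr (J _); rewrite IsqE -{1}(JE x) linearD; congr (_ + _).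
  by rewrite linearZ_LR.
have Sl : linear (fun x => (sigma ^+ 2) *: J (Q x)).
  by move=> k x y; rewrite !linearP !scalerA mulrC.
have SE x : linear_pack Sl x = (sigma ^+ 2) *: J (Q x) by [].
have [CJ CJ0 hJ] := lin_bounded J; have [CK CK0 hK] := lin_bounded K.
have [CA CA0 hA] := lin_bounded As; have [CL CL0 hL] := lin_bounded L.
have AK0 := mulr_ge0 CA0 CK0; have LK0 := mulr_ge0 CL0 CK0.
have sJ0 := mulr_ge0 (ltW sigma_gt0) CJ0.
(* The constant dominates the four error bounds obtained at the end of the proof. *)
exists (linear_pack Sl), K, (1 + 2 * (sigma * CJ) + 2 * (CA * CK) + 2 * (CL * CK)).
split.
  split=> //; last by lra.
    by move=> x y; rewrite !SE innerZl innerZr Jsa Qsa JQ.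
  move=> x; rewrite SE innerZr mulr_ge0 ?sqr_ge0// JQ -{1}(JE x) innerDl innerZl.
  apply: addr_ge0; first exact: Qpsd.
  by apply: mulr_ge0; [exact: ltW|exact: inner_ge0].
move=> eps s s' [wt [yt [e3 [e5 [[l3 l5] [l1 E3 l2 wW] [l4 E5 l6] xE]]]]].
move: l1; move E1 : (Q wt - _) => e1 l1.
move: l2; move E2 : (Q (pd_w s') - _) => e2 l2.
move: l4; move E4 : (A _ - b + _) => e4 l4.
move: l6; move E6 : (A _ - b + _) => e6 l6.
have eps0 : 0 <= eps by apply: le_trans l1; exact: enorm_ge0.
split=> //.
set c := grad _ - _ in E1 E2 E3 E4 E5 E6.
set x := pd_x s in E1 E2 E3 E4 E5 E6 xE *.
have cE : grad (pd_x s) - Q (pd_x s) = c by [].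
set dn := pd_n A U s' - pd_n A U s.
have AZ k u : A (k *: u) = k *: A u by exact: linearZ_LR.
have QZ k u : Q (k *: u) = k *: Q u by exact: linearZ_LR.
have KZ k u : K (k *: u) = k *: K u by exact: linearZ_LR.
have JZ k u : J (k *: u) = k *: J u by exact: linearZ_LR.
have AsZ k u : As (k *: u) = k *: As u by exact: linearZ_LR.
have LZ k u : L (k *: u) = k *: L u by exact: linearZ_LR.
(* Difference of the conditions of the two sweeps in [y]: the terms in [L] cancel, leaving
   [D (y' - yt) = sigma^-1 (e6 - e4) - dn]. *)
have dE : pd_y s' - yt = sigma^-1 *: K (e6 - e4) - K dn.
  rewrite -[LHS]DK -KZ -(linearB K); congr (K _).
  have -> : dn = U (pd_y s') - U (pd_y s) + (A (pd_z s') - A (pd_z s)).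
    by rewrite /dn /pd_n; apply/matrixP => i j; rewrite !mxE; ring.
  have Az : A (x + sigma *: (pd_v s' + pd_z s' - c - Q (pd_w s'))) =
      A (x + sigma *: (pd_v s' + pd_z s - c - Q (pd_w s')))
      + sigma *: (A (pd_z s') - A (pd_z s)).
    rewrite -(linearB A) -AZ -(linearD A); congr (A _).
    by apply/matrixP => i j; rewrite !mxE; ring.
  rewrite -E4 -E6 Az (linearB D).
  by apply/matrixP => i j; rewrite !mxE; field; rewrite gt_eqF.
(* Likewise for [w]: [(I + sigma Q) Q (w' - wt) = sigma Q (v' - v) + (e2 - e1)], and [J] inverts the
   operator on the left. *)
have wE : sigma *: Q (pd_w s' - wt) =
    linear_pack Sl (pd_v s' - pd_v s) + sigma *: J (e2 - e1).
  rewrite SE expr2 -scalerA -scalerDr; congr (_ *: _).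
  rewrite -[LHS]IJ -JZ -(linearD J); congr (J _); rewrite IsqE -E2 -E1.
  have -> : Q (x + sigma *: (As (pd_y s) + pd_v s' + pd_z s - c - Q (pd_w s'))) =
      Q (x + sigma *: (As (pd_y s) + pd_v s + pd_z s - c - Q wt))
      + sigma *: Q (pd_v s' - pd_v s) - sigma *: Q (Q (pd_w s' - wt)).
    rewrite -!QZ -(linearD Q) -(linearB Q); congr (Q _).
    rewrite QZ (linearB Q).
    by apply/matrixP => i j; rewrite !mxE; ring.
  rewrite {1}(linearB Q).
  by apply/matrixP => i j; rewrite !mxE; ring.
(* The errors that remain in the conditions of [w], [v], [z], [y] once [wt] and [yt] are
   eliminated. *)
exists e2, (sigma *: J (e2 - e1) - e3), (- As (K (e6 - e4)) - e5),
  (e6 + L (K (e6 - e4))).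
have le21 : enorm (e2 - e1) <= eps + eps by apply: le_trans (enormB _ _) _; exact: lerD.
have le64 : enorm (e6 - e4) <= eps + eps by apply: le_trans (enormB _ _) _; exact: lerD.
have hJe : enorm (sigma *: J (e2 - e1)) <= sigma * CJ * (eps + eps).
  rewrite enormZ gtr0_norm// -mulrA; apply: ler_wpM2l; first exact: ltW.
  by apply: le_trans (hJ _) _; exact: ler_wpM2l.
have hKe : enorm (K (e6 - e4)) <= CK * (eps + eps).
  by apply: le_trans (hK _) _; exact: ler_wpM2l.
have hAe : enorm (As (K (e6 - e4))) <= CA * CK * (eps + eps).
  by rewrite -mulrA; apply: le_trans (hA _) _; exact: ler_wpM2l.
have hLe : enorm (L (K (e6 - e4))) <= CL * CK * (eps + eps).
  by rewrite -mulrA; apply: le_trans (hL _) _; exact: ler_wpM2l.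
have k1 := mulr_ge0 sJ0 eps0; have k2 := mulr_ge0 AK0 eps0.
have k3 := mulr_ge0 LK0 eps0.
split; split.
- by apply: le_trans l2 _; lra.
- by apply: le_trans (enormB _ _) _; lra.
- by apply: le_trans (enormB _ _) _; rewrite enormN; lra.
- by apply: le_trans (enormD _ _) _; lra.
- rewrite -[RHS]E2 /pd_residual /pd_q cE; congr (_ - Q (_ + _ *: _)).
  by apply/matrixP => i j; rewrite !mxE; ring.
- move: E3; congr (MV _ _).
  have -> : x + sigma *: (pd_residual As Q grad s s' + (pd_q As s - pd_q As s'))
      + linear_pack Sl (pd_v s' - pd_v s) + (sigma *: J (e2 - e1) - e3) =
    x + sigma *: (pd_residual As Q grad s s' + (pd_q As s - pd_q As s'))
      + sigma *: Q (pd_w s' - wt) - e3 by rewrite wE !addrA.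
  rewrite /pd_residual /pd_q cE (linearB Q (pd_w s')).
  by apply/matrixP => i j; rewrite !mxE; ring.
- move: E5; congr (MZ _ _).
  have Ady : sigma *: As (pd_y s' - yt) = As (K (e6 - e4)) - sigma *: As (K dn).
    rewrite dE (linearB As) AsZ scalerBr scalerA divff ?scale1r// gt_eqF//.
  have -> : As (K (e6 - e4)) = sigma *: As (pd_y s' - yt) + sigma *: As (K dn).
    by rewrite Ady subrK.
  rewrite /pd_residual cE (linearB As).
  by apply/matrixP => i j; rewrite !mxE; ring.
- have Ldy : sigma *: L (pd_y s' - yt) = L (K (e6 - e4)) - sigma *: L (K dn).
    rewrite dE (linearB L) LZ scalerBr scalerA divff ?scale1r// gt_eqF//.
  have -> : L (K (e6 - e4)) = sigma *: L (pd_y s' - yt) + sigma *: L (K dn).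
    by rewrite Ldy subrK.
  have -> : A (x + sigma *: pd_residual As Q grad s s') =
      A (x + sigma *: (pd_v s' + pd_z s' - c - Q (pd_w s')))
      + sigma *: A (As (pd_y s')).
    rewrite -AZ -(linearD A); congr (A _); rewrite /pd_residual cE.
    by apply/matrixP => i j; rewrite !mxE; ring.
  rewrite -E6 AAsE (linearB L).
  by apply/matrixP => i j; rewrite !mxE; ring.
Qed.

Hypothesis MV_mono : forall v x v' x',
  MV v x -> MV v' x' -> inner (x - x') (v - v') <= 0.
Hypothesis MZ_mono : forall z x z' x',
  MZ z x -> MZ z' x' -> inner (x - x') (z - z') <= 0.
Hypothesis MV_closed : forall (G : set_system nat) (v x : nat -> E) (vl xl : E),
  ProperFilter G -> (forall k, MV (v k) (x k)) ->
  v @ G --> vl -> x @ G --> xl -> MV vl xl.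
Hypothesis MZ_closed : forall (G : set_system nat) (v x : nat -> E) (vl xl : E),
  ProperFilter G -> (forall k, MZ (v k) (x k)) ->
  v @ G --> vl -> x @ G --> xl -> MZ vl xl.
Hypothesis grad_continuous : continuous grad.
Hypothesis alpha01 : 0 < alpha < 1.
Hypothesis tau_bounds : 0 < tau <= (1 + Num.sqrt (5 - 4 * alpha)) / 2.

Theorem sgs_admm_cvg (eps : nat -> R) (st : nat -> state) :
  (forall k, 0 <= eps k) -> cvgn (series eps) ->
  (forall k, sgs_step (eps k) (st k) (st k.+1)) ->
  (exists t, pd_kkt As A Q grad b MV MZ t) ->
  (forall k t, pd_kkt As A Q grad b MV MZ t ->
     inner (pd_gap Q grad (st k) t) (pd_gap Q grad (st k) t) <=
     2 * alpha / sigma * inner (pd_x (st k) - pd_x t) (pd_gap Q grad (st k) t)) ->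
  exists2 l, pd_kkt As A Q grad b MV MZ l &
  [/\ pd_v (st k) @[k --> \oo] --> pd_v l, pd_w (st k) @[k --> \oo] --> pd_w l,
      pd_y (st k) @[k --> \oo] --> pd_y l, pd_z (st k) @[k --> \oo] --> pd_z l
    & pd_x (st k) @[k --> \oo] --> pd_x l].
Proof.
move=> eps0 eps_cvg steps kkt gaps.
have [S [K [C [[Ssa Spsd Ksa Kpd C0] toprox]]]] := sgs_prox_step.
have [mu [c [mu0 c0 wr wq]]] := step_weights alpha01 tau_bounds.
have [t0 _] := andP tau_bounds.
have Ceps k : 0 <= C * eps k by exact: mulr_ge0.
have Ceps_cvg : cvgn (series (fun k => C * eps k)).
  exact: (@is_cvg_seriesZ _ _ C eps_cvg).
exact: (prox_admm_cvg adjA adjLU Qsa Qpsd Ssa Spsd Ksa Kpd MV_mono MZ_mono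
  sgs_y_bound alpha01 sigma_gt0 t0 mu0 c0 wr wq Ceps Ceps_cvg
  (fun k => toprox _ _ _ (steps k)) gaps grad_continuous MV_closed MZ_closed kkt).
Qed.

End SymmetricGaussSeidel.

(** * Subgradients and Fenchel conjugates *)

Section Subgradients.
Context {R : realType} {m n : nat}.
Implicit Types (f : 'M[R]_(m, n) -> \bar R) (u d g x : 'M[R]_(m, n)).

(* Convexity along segments, phrased through finite upper bounds so that no
   sum of opposite infinities occurs. *)
Definition segment_convex f : Prop := forall u u' (a b s : R),
  (f u <= a%:E)%E -> (f u' <= b%:E)%E -> 0 <= s <= 1 ->
  (f (u + s *: (u' - u))%R <= (a + s * (b - a))%:E)%E.

Lemma fenchel_segment_convex f : segment_convex (fenchel f).
Proof.
move=> u u' a b s fa fb /andP[s0 s1]; apply: ge_ereal_sup => _ [x _ <-].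
have ha : ((inner x u)%:E - f x <= a%:E)%E.
  by apply: le_trans fa; apply: ereal_sup_ubound; exists x.
have hb : ((inner x u')%:E - f x <= b%:E)%E.
  by apply: le_trans fb; apply: ereal_sup_ubound; exists x.
case: (f x) ha hb => [c| |] //=; last by move=> _ _; rewrite addeNy leNye.
rewrite -!EFinD !lee_fin => ha hb.
rewrite !innerE.
have h1 : 0 <= (1 - s) * (a - (inner x u - c)).
  by rewrite mulr_ge0 ?subr_ge0.
have h2 : 0 <= s * (b - (inner x u' - c)) by rewrite mulr_ge0 ?subr_ge0.
lra.
Qed.

Lemma segment_convex_opp f :
  segment_convex f -> segment_convex (fun u => f (- u)).
Proof.
move=> fc u u' a b s fa fb s01.
have -> : - (u + s *: (u' - u)) = - u + s *: (- u' - - u).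
  by apply/matrixP => i j; rewrite !mxE; ring.
exact: fc.
Qed.

Lemma indicator_range_convex (Q : {linear 'M[R]_(m, n) -> 'M[R]_(m, n)}) :
  segment_convex (indicator (range Q)).
Proof.
move=> u u' a b s; rewrite /indicator.
case: asboolP => // -[x _ <-]; case: asboolP => // -[x' _ <-].
rewrite !lee_fin => a0 b0 /andP[s0 s1].
rewrite asboolT; last first.
  exists (x + s *: (x' - x)) => //.
  by rewrite linearD linearZ_LR (linearB Q).
rewrite lee_fin.
have h1 : 0 <= (1 - s) * a by rewrite mulr_ge0 ?subr_ge0.
have h2 : 0 <= s * b by rewrite mulr_ge0.
lra.
Qed.

(* Comparing both functions along a short segment, the quadratic term is of
   second order and only the linear one survives. *)
Lemma subdiff_add_quadratic f (F : 'M[R]_(m, n) -> R) (k : 'M[R]_(m, n) -> R)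
    u g G :
  segment_convex f ->
  (forall d s, F (u + s *: d) = F u + s * inner G d + s ^+ 2 * k d) ->
  subdiff (fun u => f u + (F u)%:E)%E u g -> subdiff f u (g - G).
Proof.
move=> fc FE [fin le_sub].
have fu : f u \is a fin_num by move: fin; rewrite fin_numD => /andP[].
split => // u'; set d := u' - u.
have := le_sub u'; case fu' : (f u') => [b| |] h; [|exact: leey|]; last first.
  by move: fu h; case: (f u).
move: {h} fu le_sub; case fuE : (f u) => [a| |] // _ le_sub.
rewrite -EFinD lee_fin leNgt; apply/negP => lt_b.
  set eta := a + inner (g - G) d - b.
  have eta0 : 0 < eta by rewrite subr_gt0.
  (* Short enough for the second-order term to stay below half of [eta]: [s * k d <= eta / 2]. *)
  pose s := Num.min 1 (eta / (2 * (`|k d| + 1))).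
  have k1 : 0 < `|k d| + 1 by rewrite ltr_wpDl.
  have s0 : 0 < s by rewrite lt_min ltr01 divr_gt0// mulr_gt0.
  have s1 : s <= 1 by rewrite ge_min lexx.
  have s01 : 0 <= s <= 1 by rewrite ltW.
  have hs := fc u u' a b s; rewrite fuE fu' !lexx in hs.
  have {}hs := hs isT isT s01.
  have h1 := le_sub (u + s *: d).
  have {h1} : ((a + F u + inner g (u + s *: d - u))%:E <=
      (a + s * (b - a) + F (u + s *: d))%:E)%E.
    rewrite EFinD [(a + F u)%:E]EFinD; apply: le_trans h1 _.
    by rewrite [leRHS]EFinD; exact: leeD hs (lexx _).
  rewrite lee_fin [u + _]addrC addrK [_ + u]addrC innerZr FE => h1.
  have h2 : s * eta <= s * (s * k d).
    by rewrite /eta innerDl innerNl; lra.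
  rewrite ler_pM2l// in h2.
  have h3 : s * k d <= s * (`|k d| + 1).
    by rewrite ler_pM2l//; apply: le_trans (ler_norm _) _; rewrite lerDl.
  have h4 : s * (`|k d| + 1) <= eta / 2.
    have : s <= eta / (2 * (`|k d| + 1)) by rewrite ge_min lexx orbT.
    rewrite -(ler_pM2r k1) => /le_trans; apply.
    by rewrite le_eqVlt; apply/orP; left; apply/eqP; field; rewrite gt_eqF.
have h5 := le_trans h2 (le_trans h3 h4).
by clear - eta0 h5; lra.
Qed.

Lemma subdiff_opp f u g :
  subdiff (fun u => f (- u)) u g -> subdiff f (- u) (- g).
Proof.
move=> [fin h]; split => // u'; have := h (- u'); rewrite opprK.
by rewrite innerNl -innerNr !opprD !opprK.
Qed.

Lemma subdiff_monotone f u g u' g' :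
  subdiff f u g -> subdiff f u' g' -> 0 <= inner (g - g') (u - u').
Proof.
move=> [fu h] [fu' h'].
have := h u'; have := h' u; move: fu fu'.
case: (f u) => [a| |] //; case: (f u') => [b| |] // _ _.
rewrite -!EFinD !lee_fin !innerE; lra.
Qed.

(** The normal cone of a subspace is its orthogonal complement, here the kernel of [Q]; the test
    point is [u + Q (Q g)]. *)
Lemma subdiff_indicator_range (Q : {linear 'M[R]_(m, n) -> 'M[R]_(m, n)}) u g :
  self_adjoint Q -> subdiff (indicator (range Q)) u g -> range Q u /\ Q g = 0.
Proof.
move=> Qsa [fin h].
have uW : range Q u by move: fin; rewrite /indicator; case: asboolP.
split => //; apply: inner_eq0; rewrite Qsa.
have [x _ xu] := uW.
have := h (u + Q (Q g)); rewrite /indicator !asboolT//; last first.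
  by exists (x + Q g) => //; rewrite linearD xu.
rewrite add0e lee_fin [u + _]addrC addrK => h1.
have := inner_ge0 (Q g); rewrite Qsa => h2.
by apply/eqP; rewrite eq_le h1 h2.
Qed.

(** A conjugate is a supremum of affine functions, so the subgradient inequality passes to the limit
    for each of them ([key]), and the supremum is taken afterwards. *)
Lemma subdiff_fenchel_closed f (T : Type) (F : set_system T)
    (u g : T -> 'M[R]_(m, n)) ul gl : ProperFilter F ->
  (forall k, subdiff (fenchel f) (u k) (g k)) ->
  u @ F --> ul -> g @ F --> gl -> subdiff (fenchel f) ul gl.
Proof.
move=> FF sub hu hg.
have key x u' : ((inner x ul)%:E - f x + (inner gl (u' - ul)%R)%:E <= fenchel f u')%E.
  case fu' : (fenchel f u') => [b| |]; [|exact: leey|]; last first.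
    have [k _] := @filter_ex _ F _ _ filterT.
    by have [+ /(_ u')] := sub k; rewrite fu'; case: (fenchel f (u k)).
  case fx : (f x) => [a| |] /=; [|by rewrite leNye|]; last first.
    have [k _] := @filter_ex _ F _ _ filterT.
    have [+ _] := sub k.
    suff -> : fenchel f (u k) = +oo%E by [].
    by apply/eqP; rewrite -leye_eq; apply: ereal_sup_ubound; exists x; rewrite ?fx.
  rewrite -!EFinD lee_fin.
  have lim : inner x (u k) - a + inner (g k) (u' - u k) @[k --> F] -->
      inner x ul - a + inner gl (u' - ul).
    apply: cvgD; first by apply: cvgB; [apply: cvg_inner => //|]; exact: cvg_cst.
    by apply: cvg_inner => //; apply: mx_cvgB => //; exact: cvg_cst.
  apply: (cvgr_to_le lim).
  apply: nearW => k; have [fin /(_ u')] := sub k.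
  have : ((inner x (u k))%:E - f x <= fenchel f (u k))%E.
    by apply: ereal_sup_ubound; exists x.
  rewrite fx fu'; move: fin; case: (fenchel f (u k)) => [c| |] // _.
  rewrite -!EFinD !lee_fin; lra.
have [k0 _] := @filter_ex _ F _ _ filterT.
have fin : fenchel f ul \is a fin_num.
  have [fin0 _] := sub k0; rewrite fin_numE; apply/andP; split.
    (* A conjugate equal to [-oo] somewhere has [f] identically [+oo], and is then [-oo] also at
       [u k0]. *)
    apply/negP => /eqP fNy.
    have fy x : f x = +oo%E.
      have : ((inner x ul)%:E - f x <= fenchel f ul)%E.
        by apply: ereal_sup_ubound; exists x.
      by rewrite fNy; case: (f x).
    suff : fenchel f (u k0) = -oo%E by move: fin0 => /[swap] ->.
    apply/eqP; rewrite -leeNy_eq; apply: ge_ereal_sup => _ [x _ <-].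
    by rewrite fy.
  apply/negP => /eqP fy.
  (* At [u k0] the conjugate is finite, so [key] bounds all the affine terms at [ul] by one real
     number. *)
  have h : (fenchel f ul <= (fine (fenchel f (u k0)) - inner gl (u k0 - ul))%:E)%E.
    apply: ge_ereal_sup => _ [x _ <-]; have := key x (u k0).
    rewrite -[X in (_ <= X)%E](fineK fin0); case: (f x) => [c| |] //=.
      by rewrite -!EFinD !lee_fin; lra.
    by move=> _; rewrite addeNy leNye.
  by rewrite fy in h.
split => // u'; rewrite -(fineK fin).
case fu' : (fenchel f u') => [b| |]; [|exact: leey|]; last first.
  have h : (fenchel f ul <= -oo)%E.
    apply: ge_ereal_sup => _ [x _ <-]; have := key x u'.
    by rewrite fu'; case: (f x).
  by move: fin h; case: (fenchel f ul).
have h : (fenchel f ul <= (b - inner gl (u' - ul))%:E)%E.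
  apply: ge_ereal_sup => _ [x _ <-]; have := key x u'.
  rewrite fu'; case: (f x) => [c| |] //=.
    by rewrite -!EFinD !lee_fin; lra.
  by move=> _; rewrite addeNy leNye.
by rewrite -EFinD lee_fin; move: h; rewrite -(fineK fin) lee_fin; lra.
Qed.

End Subgradients.

(** * Block vectors *)

Section Blocks.
Context {R : realType} {N : nat} {d : 'I_N -> nat} {n : nat}.
Notation full := 'M[R]_(\sum_(i < N) d i, n).
Notation tuple_of := (forall i, 'M[R]_(d i, n)).
Implicit Types (X Y Z : full).

Lemma submxcolZ k X t : submxcol (k *: X) t = k *: submxcol X t.
Proof. by apply/matrixP => i j; rewrite !mxE. Qed.

Lemma submxcolBE X Y t : submxcol (X - Y) t = submxcol X t - submxcol Y t.
Proof. by apply/matrixP => i j; rewrite !mxE. Qed.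

Definition blockE := (submxcolBE, @submxcolD R N d n, submxcolZ,
  @submxcol0 R N d n).

Lemma inner_blocks X Y :
  inner X Y = \sum_(t < N) inner (submxcol X t) (submxcol Y t).
Proof.
have innerE p (A B : 'M[R]_(p, n)) : inner A B = \tr (A^T *m B).
  rewrite /inner /mxtrace exchange_big; apply: eq_bigr => i _.
  by rewrite mxE; apply: eq_bigr => j _; rewrite mxE.
rewrite innerE -{1}(submxcolK X) -{1}(submxcolK Y) tr_mxcol mul_mxrow_mxcol.
by rewrite raddf_sum; apply: eq_bigr => t _ /=; rewrite innerE.
Qed.

(** The factor [N], cruder than its square root, only rescales the tolerances and preserves their
    summability. *)
Lemma enorm_block_le X eps : 0 <= eps ->
  (forall t, enorm (submxcol X t) <= eps) -> enorm X <= N%:R * eps.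
Proof.
move=> e0 hX; apply: enorm_le; first exact: mulr_ge0.
rewrite inner_blocks; apply: (@le_trans _ _ (\sum_(t < N) eps ^+ 2)).
  apply: ler_sum => t _; rewrite -enorm_sqr.
  by rewrite ler_pXn2r ?nnegrE ?enorm_ge0.
rewrite sumr_const card_ord -[leLHS]mulr_natl exprMn; apply: ler_wpM2r; first exact: sqr_ge0.
by rewrite -natrX ler_nat; case: (N) => // k; rewrite -[leqLHS]expn1 leq_pexp2l.
Qed.

(** The inclusion of a block; it is adjoint to [submxcol] by [inner_single], which is how blocks of
    operators are computed below. *)
Definition single t (u : 'M[R]_(d t, n)) : full :=
  \mxcol_s eqtype.dfwith (fun i => 0 : 'M[R]_(d i, n)) u s.

Lemma single_same t (u : 'M[R]_(d t, n)) : submxcol (single u) t = u.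
Proof. by rewrite mxcolK dfwith_in. Qed.

Lemma single_other t s (u : 'M[R]_(d t, n)) :
  t != s -> submxcol (single u) s = 0.
Proof. by move=> ts; rewrite mxcolK dfwith_out. Qed.

Lemma inner_single t (u : 'M[R]_(d t, n)) X :
  inner (single u) X = inner u (submxcol X t).
Proof.
rewrite inner_blocks (bigD1 t)//= single_same big1 ?addr0// => s st.
by rewrite single_other 1?eq_sym// inner0l.
Qed.

Lemma single_linear t : linear (@single t).
Proof.
move=> k u v; apply/mxcolP => s; rewrite !blockE.
have [<-|ts] := eqVneq t s; first by rewrite !single_same.
by rewrite !single_other// scaler0 addr0.
Qed.

Lemma single0 t : single (0 : 'M[R]_(d t, n)) = 0.
Proof.
apply/mxcolP => s; rewrite submxcol0.
have [<-|ts] := eqVneq t s; first by rewrite !single_same.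
by rewrite single_other.
Qed.

Lemma mxcol_dfwith (v : tuple_of) t (u e : 'M[R]_(d t, n)) k :
  \mxcol_s eqtype.dfwith v (u + k *: e) s =
  \mxcol_s eqtype.dfwith v u s + k *: single e.
Proof.
apply/mxcolP => s; rewrite !blockE !mxcolK.
have [<-|ts] := eqVneq t s; first by rewrite !dfwith_in.
by rewrite !dfwith_out// scaler0 addr0.
Qed.

Lemma mask_sum (P : pred 'I_N) X :
  \mxcol_s (if P s then submxcol X s else 0) =
  \sum_(s | P s) single (submxcol X s).
Proof.
apply/mxcolP => t; rewrite mxcolK submxcol_sum.
case: ifPn => Pt.
  rewrite (bigD1 t)//= single_same big1 ?addr0// => s /andP[_ st].
  by rewrite single_other.
rewrite big1// => s Ps; rewrite single_other//.
by apply: contraNneq Pt => <-.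
Qed.

Variable H : {linear full -> full}.
Hypothesis Hsa : self_adjoint H.

Definition gs_diag X : full :=
  \mxcol_t submxcol (H (single (submxcol X t))) t.
Definition gs_lower X : full :=
  \mxcol_(t < N) submxcol (H (\mxcol_(s < N) (if (s < t)%N then submxcol X s else 0))) t.
Definition gs_upper X : full :=
  \mxcol_(t < N) submxcol (H (\mxcol_(s < N) (if (t < s)%N then submxcol X s else 0))) t.

Lemma mask_linear (P : pred 'I_N) :
  linear (fun X => \mxcol_s (if P s then submxcol X s else 0) : full).
Proof.
move=> k X Y; apply/mxcolP => s; rewrite !blockE !mxcolK !blockE; case: ifP => _ //.
by rewrite scaler0 addr0.
Qed.

Lemma gs_diag_linear : linear gs_diag.
Proof.
move=> k X Y; apply/mxcolP => t.
by rewrite !blockE !mxcolK !blockE single_linear linearP !blockE.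
Qed.

Lemma gs_lower_linear : linear gs_lower.
Proof.
move=> k X Y; apply/mxcolP => t.
rewrite !blockE !mxcolK -!blockE -linearP; congr (submxcol (H _) t).
exact: (mask_linear (fun s => s < t)%N).
Qed.

Lemma gs_upper_linear : linear gs_upper.
Proof.
move=> k X Y; apply/mxcolP => t.
rewrite !blockE !mxcolK -!blockE -linearP; congr (submxcol (H _) t).
exact: (mask_linear (fun s => t < s)%N).
Qed.

(** The form in which a Gauss-Seidel sweep meets [H] at stage [t]: earlier blocks, the current block
    and later blocks come from three different vectors. *)
Lemma gs_mix X Y Z t :
  submxcol (gs_diag X + gs_lower Y + gs_upper Z) t =
  submxcol (H (\mxcol_(s < N) (if (s < t)%N then submxcol Y s
                         else if s == t then submxcol X s else submxcol Z s))) t.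
Proof.
rewrite !blockE !mxcolK -!submxcolD -!linearD; congr (submxcol (H _) t).
apply/mxcolP => s; rewrite !blockE [in RHS]mxcolK.
rewrite [X in _ + X + _ = _]mxcolK [X in _ + X = _]mxcolK.
have [->|ts] := eqVneq t s; first by rewrite ltnn single_same !addr0.
rewrite single_other// add0r.
by case: ltngtP => [_|_|/val_inj st]; rewrite ?addr0 ?add0r//; rewrite st eqxx in ts.
Qed.

Lemma gs_split X : H X = gs_diag X + gs_lower X + gs_upper X.
Proof.
apply/mxcolP => t; rewrite gs_mix; congr (submxcol (H _) t).
rewrite -[LHS]submxcolK; apply/eq_mxcolP => s.
by case: ifP => // _; case: ifP.
Qed.

(** Both sides are the sum over [s < t] of [H] paired between the blocks [X_s] and [Y_t]. *)
Lemma gs_adjoint X Y : inner (gs_lower X) Y = inner X (gs_upper Y).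
Proof.
have lhs : inner (gs_lower X) Y = \sum_(t < N) \sum_(s < N | (s < t)%N)
    inner (H (single (submxcol X s))) (single (submxcol Y t)).
  rewrite inner_blocks; apply: eq_bigr => t _.
  rewrite mxcolK mask_sum linear_sum submxcol_sum.
  elim/big_rec2 : _ => [|s a b _ ih]; first by rewrite inner0l.
  by rewrite innerDl ih innerC -inner_single innerC.
have rhs : inner X (gs_upper Y) = \sum_(s < N) \sum_(t < N | (s < t)%N)
    inner (single (submxcol X s)) (H (single (submxcol Y t))).
  rewrite inner_blocks; apply: eq_bigr => s _.
  rewrite mxcolK mask_sum linear_sum submxcol_sum.
  elim/big_rec2 : _ => [|t a b _ ih]; first by rewrite inner0r.
  by rewrite innerDr ih -inner_single.
rewrite lhs rhs (exchange_big_dep xpredT)//=.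
by apply: eq_bigr => s _; apply: eq_bigr => t _; rewrite Hsa.
Qed.

Lemma gs_diag_self_adjoint : self_adjoint gs_diag.
Proof.
move=> X Y; rewrite !inner_blocks; apply: eq_bigr => t _.
by rewrite !mxcolK -[RHS]inner_single [LHS]innerC -[LHS]inner_single [LHS]innerC Hsa.
Qed.

Lemma gs_diag_pos_def :
  (forall t (u : 'M[R]_(d t, n)), u != 0 -> 0 < inner (single u) (H (single u))) ->
  pos_def gs_diag.
Proof.
move=> Hp X X0.
have e t : inner (submxcol X t) (submxcol (gs_diag X) t) =
    inner (single (submxcol X t)) (H (single (submxcol X t))).
  by rewrite mxcolK inner_single.
have ge0 t : 0 <= inner (submxcol X t) (submxcol (gs_diag X) t).
  rewrite e; have [->|/Hp/ltW//] := eqVneq (submxcol X t) 0.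
  by rewrite single0 inner0l.
have [t Xt] : exists t, submxcol X t != 0.
  apply/existsP; apply: contra_neqT X0; rewrite negb_exists => /forallP h.
  by apply/mxcolP => t; rewrite submxcol0; apply/eqP/negPn/h.
rewrite inner_blocks (bigD1 t)//=; apply: ltr_wpDr.
  by apply: sumr_ge0.
by rewrite e; exact: Hp.
Qed.

End Blocks.

(** * The stochastic program as a single block problem *)

Section StageOperators.
Context {R : realType} (P : msp R).
Notation T := (stages P).
Notation N := (branch P).
Notation xf := 'M[R]_(\sum_(t < T) #|node N t|, xdim P).
Notation yf := 'M[R]_(\sum_(t < T) #|node N t|, bdim P).

Lemma A_linear t : linear (@A_ R P t).
Proof.
move=> k x y; apply/row_matrixP => i.
have rowE p q (a b : 'M[R]_(p, q)) r : row r (k *: a + b) = k *: row r a + row r b.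
  exact: linearP.
by rewrite rowE !rowK /at_node rowE linearP.
Qed.

Lemma B_linear t : linear (@B_ R P t).
Proof.
move=> k x y; apply/row_matrixP => i.
have rowE p q (a b : 'M[R]_(p, q)) r : row r (k *: a + b) = k *: row r a + row r b.
  exact: linearP.
by rewrite rowE !rowK /at_node rowE linearP.
Qed.

Lemma A_adjP t (x : xspace P t) y : inner (A_ x) y = inner x (adj (@A_ R P t) y).
Proof. exact: (adjP (linear_pack (@A_linear t))). Qed.

Lemma B_adjP t (x : xspace P t) y : inner (B_ x) y = inner x (adj (@B_ R P t) y).
Proof. exact: (adjP (linear_pack (@B_linear t))). Qed.

Lemma A_adj_linear t : linear (adj (@A_ R P t)).
Proof. exact: (adj_is_linear (linear_pack (@A_linear t))). Qed.

Lemma B_adj_linear t : linear (adj (@B_ R P t)).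
Proof. exact: (adj_is_linear (linear_pack (@B_linear t))). Qed.

Lemma A_adj0 t : adj (@A_ R P t) 0 = 0.
Proof. exact: (linear0 (linear_pack (@A_adj_linear t))). Qed.

Lemma B_adj0 t : adj (@B_ R P t) 0 = 0.
Proof. exact: (linear0 (linear_pack (@B_adj_linear t))). Qed.

(** [Badj_next] matches on [idP], so the equation is produced by a dependent match; the two proofs
    of the bound are identified by irrelevance. *)
Lemma Badj_nextE (y : ytuple P) (t : 'I_T) (lt_tT : (t.+1 < T)%N) :
  Badj_next y t = adj (@B_ R P t) (y (Ordinal lt_tT)).
Proof.
rewrite /Badj_next; refine (match @idP (t.+1 < T)%N as r return
  match r with ReflectT l => _ | ReflectF _ => 0 end = _ with
  ReflectT l => _ | ReflectF nl => False_ind _ (nl lt_tT) end).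
by rewrite (bool_irrelevance l lt_tT).
Qed.

Lemma Badj_next_last (y : ytuple P) (t : 'I_T) :
  ~ (t.+1 < T)%N -> Badj_next y t = 0.
Proof.
rewrite /Badj_next => ge; refine (match @idP (t.+1 < T)%N as r return
  match r with ReflectT l => _ | ReflectF _ => 0 end = 0 with
  ReflectT l => False_ind _ (ge l) | ReflectF nl => erefl end).
Qed.

Lemma Badj_next_eq0 (y : ytuple P) (t : 'I_T) :
  (forall s : 'I_T, s = t.+1 :> nat -> y s = 0) -> Badj_next y t = 0.
Proof.
move=> y0; have [lt|ge] := boolP (t.+1 < T)%N; last first.
  by apply: Badj_next_last; apply/negP.
by rewrite (Badj_nextE _ lt) y0// B_adj0.
Qed.

Definition stage_adj (y : yf) : xf :=
  \mxcol_(t < T) (adj (@A_ R P t) (submxcol y t)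
                  + Badj_next (fun s => submxcol y s) t).

Lemma stage_adj_linear : linear stage_adj.
Proof.
move=> k x y; apply/mxcolP => t; rewrite !blockE !mxcolK !blockE.
rewrite A_adj_linear scalerDr addrACA.
congr (_ + _); have [lt|ge] := boolP (t.+1 < T)%N; last first.
  by rewrite !Badj_next_last ?scaler0 ?addr0//; exact/negP.
by rewrite !(Badj_nextE _ lt) !blockE B_adj_linear.
Qed.

Let As : {linear yf -> xf} := linear_pack stage_adj_linear.

(** The adjoint is taken as primitive because it is what the algorithm contains. The constraint map
    is its adjoint, and its rows are computed afterwards by testing against single blocks. *)
Definition stage_map : {linear xf -> yf} := linear_pack (adj_is_linear As).

Lemma stage_mapP x y : inner (stage_map x) y = inner x (stage_adj y).
Proof. by rewrite innerC -(adjP As) innerC. Qed.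

Lemma stage_adj_self (t : 'I_T) (u : yspace P t) :
  submxcol (stage_adj (single u)) t = adj (@A_ R P t) u.
Proof.
rewrite mxcolK single_same Badj_next_eq0 ?addr0// => s st.
by rewrite single_other//; apply/eqP => ts; rewrite ts in st; move: st => /n_Sn.
Qed.

Lemma stage_adj_prev (t : nat) (lt_tT : (t.+1 < T)%N) (u : yspace P t.+1) :
  submxcol (stage_adj (single (u : yspace P (Ordinal lt_tT))))
    (Ordinal (ltnW lt_tT)) = adj (@B_ R P t) u.
Proof.
rewrite mxcolK single_other; last by rewrite -val_eqE /= gtn_eqF.
rewrite A_adj0 add0r.
by rewrite (@Badj_nextE _ (Ordinal (ltnW lt_tT)) lt_tT) single_same.
Qed.

Lemma stage_adj_other (t s : 'I_T) (u : yspace P t) :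
  s != t -> s.+1 != t :> nat -> submxcol (stage_adj (single u)) s = 0.
Proof.
move=> st sSt; rewrite mxcolK single_other 1?eq_sym//.
rewrite A_adj0 add0r.
apply: Badj_next_eq0 => r rs; rewrite single_other//.
by apply: contra_neq sSt => ->.
Qed.

Lemma stage_map_first x (t : 'I_T) : t = 0%N :> nat ->
  submxcol (stage_map x) t = A_ (submxcol x t).
Proof.
move=> t0; apply: innerP => u.
rewrite [LHS]innerC -inner_single [LHS]innerC stage_mapP inner_blocks (bigD1 t)//=.
rewrite stage_adj_self big1 ?addr0 => [|s st].
  by rewrite -A_adjP.
by rewrite stage_adj_other ?inner0r// t0.
Qed.

Lemma stage_map_next x t (lt_tT : (t.+1 < T)%N) :
  submxcol (stage_map x) (Ordinal lt_tT) =
  B_ (submxcol x (Ordinal (ltnW lt_tT)) : xspace P t)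
  + A_ (submxcol x (Ordinal lt_tT) : xspace P t.+1).
Proof.
apply: innerP => u.
rewrite [LHS]innerC -inner_single [LHS]innerC stage_mapP inner_blocks.
rewrite (bigD1 (Ordinal lt_tT))//= stage_adj_self.
rewrite (bigD1 (Ordinal (ltnW lt_tT)))/=; last by rewrite -val_eqE /= ltn_eqF.
rewrite stage_adj_prev big1 ?addr0 => [|s /andP[st ss]]; last first.
  by rewrite stage_adj_other ?inner0r.
rewrite [RHS]innerDl addrC.
by congr (_ + _); [exact: esym (@B_adjP t _ u)|exact: esym (@A_adjP t.+1 _ u)].
Qed.

Lemma stage_gram_linear : linear (fun y => stage_map (stage_adj y)).
Proof. by move=> k x y; rewrite stage_adj_linear linearP. Qed.

Definition stage_gram : {linear yf -> yf} := linear_pack stage_gram_linear.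

Lemma stage_gram_self_adjoint : self_adjoint stage_gram.
Proof. by move=> x y; rewrite [LHS]stage_mapP innerC -stage_mapP innerC. Qed.

(** The diagonal blocks of the Gram operator are [A_1 A_1^*] and [A_t A_t^* + B_t B_t^*], exactly
    the operators of the constraint qualification. The full Gram operator may be singular. *)
Lemma stage_gram_block_pos (t : 'I_T) (u : yspace P t) :
  constraint_qualification P -> u != 0 ->
  0 < inner (single u) (stage_gram (single u)).
Proof.
move=> [cq0 cq] u0; rewrite inner_single.
case: t u u0 => -[|t] lt u u0.
  by rewrite stage_map_first// stage_adj_self; exact: cq0.
rewrite stage_map_next stage_adj_prev stage_adj_self addrC.
exact: (cq t lt).
Qed.

Definition stage_grad (x : xf) : xf :=
  \mxcol_(t < T) gradient (@h_ R P t) (submxcol x t).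

(** Along a basis vector of block [t] the difference quotients of [h_full] coincide with those of
    the stage cost, so their limits do too. *)
Lemma gradient_h_full x : gradient (@h_full R P) x = stage_grad x.
Proof.
apply/mxcolP => t; rewrite mxcolK; apply/matrixP => i j; rewrite !mxE.
have deltaE : delta_mx (@tagnat.Rank _ (fun s : 'I_T => #|node N s|) t i) j =
    single (delta_mx i j : 'M[R]_(#|node N t|, xdim P)) :> xf.
  apply/innerP => z; rewrite inner_single.
  have e p q (A : 'M[R]_(p, q)) a b : inner (delta_mx a b) A = A a b.
    rewrite /inner (bigD1 a)//= (bigD1 b)//= mxE !eqxx mul1r !big1 ?addr0//.
      by move=> c ca; rewrite big1// => l _; rewrite mxE (negbTE ca) mul0r.
    by move=> c cb; rewrite mxE eqxx (negbTE cb) mul0r.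
  by rewrite !e mxE.
have hE (k : R) : h_full (k *: delta_mx (@tagnat.Rank _ (fun s : 'I_T => #|node N s|) t i) j + x)
    - h_full x = h_ (k *: delta_mx i j + submxcol x t : xspace P t) - h_ (submxcol x t).
  rewrite deltaE /h_full -sumrB (bigD1 t)//= [X in _ + X = _]big1 ?addr0 => [|s st].
    by rewrite !blockE single_same.
  by rewrite !blockE single_other 1?eq_sym// scaler0 add0r subrr.
rewrite /derive /=; under eq_fun => k do rewrite hE.
by [].
Qed.

End StageOperators.

(** * Continuity of the stacked gradient *)

Section StageGradient.
Context {R : realType} (P : msp R).
Notation T := (stages P).
Notation N := (branch P).
Notation xf := 'M[R]_(\sum_(t < T) #|node N t|, xdim P).

(** Only one node contributes to the difference quotient; differentiability lets the factor
    [prob P t] leave the limit. *)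
Lemma gradient_h_ t (x : xspace P t) (i : 'I_#|node N t|) j :
  differentiable (hfun (enum_val i) : _ -> R^o) (row i x) ->
  gradient (@h_ R P t) x i j =
  prob P t * gradient (hfun (enum_val i)) (row i x) 0 j.
Proof.
move=> dh; rewrite !mxE.
have hE (s : R) : h_ (s *: delta_mx i j + x) - h_ x =
    prob P t * (hfun (enum_val i) (s *: delta_mx 0 j + row i x)
                - hfun (enum_val i) (row i x)).
  rewrite /h_ -mulrBr -sumrB; congr (_ * _).
  rewrite (bigD1 (enum_val i))//= [X in _ + X = _]big1 ?addr0 => [|k ki].
    rewrite /at_node enum_valK; congr (hfun _ _ - _).
    by apply/rowP => b; rewrite !mxE eqxx.
  rewrite /at_node (_ : row _ (_ + _) = row (enum_rank k) x) ?subrr//.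
  apply/rowP => b; rewrite !mxE (_ : enum_rank k == i = false) ?mulr0 ?add0r//.
  by apply: contraNF ki => /eqP <-; rewrite enum_rankK.
rewrite /derive /=; under eq_fun => s do rewrite hE.
apply: cvg_lim; first exact: norm_hausdorff.
under eq_fun => s do rewrite -[_ *: _]/(_ * _) mulrCA.
apply: cvgM; first exact: cvg_cst.
exact: (@diff_derivable _ _ _ (hfun (enum_val i) : _ -> R^o) _ (delta_mx 0 j) dh).
Qed.

Lemma stage_grad_continuous : msp_standing P -> continuous (@stage_grad R P).
Proof.
move=> [_ hP] x; apply/(@mx_cvgP R _ (nbhs x) (nbhs_filter x)) => a j.
pose t := tagnat.sig1 a; pose i : 'I_#|node N t| := tagnat.sig2 a.
have e (y : xf) : stage_grad y a j =
    prob P t * gradient (hfun (enum_val i)) (row i (submxcol y t)) 0 j.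
  rewrite mxE gradient_h_//.
  by have [_ [_ + _ _] _] := hP t (enum_val i); apply.
rewrite e (_ : (fun y : xf => stage_grad y a j) = (fun y : xf => prob P t *
    gradient (hfun (enum_val i)) (row i (submxcol y t)) 0 j)); last first.
  by apply/funext.
apply: cvgM; first exact: cvg_cst.
have [_ [_ _ gc _] _] := hP t (enum_val i).
have rc : row i (submxcol y t) @[y --> x] --> row i (submxcol x t).
  apply/(@mx_cvgP R _ (nbhs x) (nbhs_filter x)) => b c; rewrite !mxE.
  rewrite (_ : (fun y : xf => _) = (fun y : xf => y (tagnat.Rank t i) c)); last first.
    by apply/funext => y; rewrite !mxE.
  exact: coord_continuous.
have := cvg_comp _ _ rc (gc (row i (submxcol x t))).
by move=> /(@mx_cvgP R _ (nbhs x) (nbhs_filter x))/(_ 0 j).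
Qed.

End StageGradient.

Lemma cvg_submxcol {R : realType} {T : Type} {G : set_system T} {FG : Filter G}
    {N : nat} {d : 'I_N -> nat} {n : nat} (u : T -> 'M[R]_(\sum_(i < N) d i, n))
    (l : 'M[R]_(\sum_(i < N) d i, n)) t :
  u @ G --> l -> submxcol (u k) t @[k --> G] --> submxcol l t.
Proof.
move=> /mx_cvgP ul; apply/mx_cvgP => i j; rewrite mxE.
rewrite (_ : (fun k => _) = (fun k => u k (tagnat.Rank t i) j)); first exact: ul.
by apply/funext => k; rewrite mxE.
Qed.

(** * Subdifferential graphs of stacked conjugates *)

Section ConjugateGraph.
Context {R : realType} {N : nat} {d : 'I_N -> nat} {n : nat}.
Notation full := 'M[R]_(\sum_(i < N) d i, n).
Variable phi : forall t, 'M[R]_(d t, n) -> \bar R.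
Arguments phi : clear implicits.

Definition conj_graph (v x : full) : Prop :=
  forall t, subdiff (fenchel (phi t)) (- submxcol v t) (submxcol x t).

Lemma conj_graph_mono v x v' x' :
  conj_graph v x -> conj_graph v' x' -> inner (x - x') (v - v') <= 0.
Proof.
move=> h h'; rewrite inner_blocks; apply: sumr_le0 => t _.
have := subdiff_monotone (h t) (h' t).
by rewrite !blockE -opprD innerNr oppr_ge0.
Qed.

Lemma conj_graph_closed (G : set_system nat) (v x : nat -> full) (vl xl : full) :
  ProperFilter G -> (forall k, conj_graph (v k) (x k)) ->
  v @ G --> vl -> x @ G --> xl -> conj_graph vl xl.
Proof.
move=> PG h hv hx t.
apply: (@subdiff_fenchel_closed _ _ _ _ _ G
  (fun k => - submxcol (v k) t) (fun k => submxcol (x k) t)).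
- by move=> k; exact: h.
- by apply: mx_cvgN; exact: cvg_submxcol.
- exact: cvg_submxcol.
Qed.

End ConjugateGraph.

(** * From the blockwise algorithm to the stacked iteration *)

Section StageAlgorithm.
Context {R : realType} (P : msp R).
Notation T := (stages P).
Notation N := (branch P).
Notation xf := 'M[R]_(\sum_(t < T) #|node N t|, xdim P).
Notation yf := 'M[R]_(\sum_(t < T) #|node N t|, bdim P).
Variable Q : forall t : 'I_T, {linear xspace P t -> xspace P t}.
Variable sigma : R.
Notation xsingle := (@single R T (fun t : 'I_T => #|node N t|) (xdim P) _).
Notation ysingle := (@single R T (fun t : 'I_T => #|node N t|) (bdim P) _).
Hypothesis sigma_gt0 : 0 < sigma.
Hypothesis Qmin : minorization Q.

Lemma Qdiag_linear : linear (Qdiag Q : xf -> xf).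
Proof. by move=> k x y; apply/mxcolP => t; rewrite !blockE !mxcolK !blockE linearP. Qed.

Let Qd : {linear xf -> xf} := linear_pack Qdiag_linear.

Lemma Qdiag_self_adjoint : self_adjoint Qd.
Proof.
move=> x y; rewrite !inner_blocks; apply: eq_bigr => t _.
by rewrite !mxcolK; have [] := Qmin t.
Qed.

Lemma Qdiag_pos_semidef : pos_semidef Qd.
Proof.
move=> x; rewrite inner_blocks; apply: sumr_ge0 => t _.
by rewrite mxcolK; have [] := Qmin t.
Qed.

Lemma range_QdiagP (w : xf) :
  range Qd w <-> forall t, range (Q t) (submxcol w t).
Proof.
split=> [[u _ <-] t|h]; first by exists (submxcol u t); rewrite //= mxcolK.
exists (\mxcol_(t < T) sval (cid2 (h t))) => //.
apply/mxcolP => t; rewrite /= !mxcolK.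
by case: (cid2 (h t)).
Qed.

Lemma Qdiag_block (x : xf) t : submxcol (Qd x) t = Q t (submxcol x t).
Proof. exact: mxcolK. Qed.

Lemma stage_grad_block (x : xf) t :
  submxcol (stage_grad x) t = gradient (@h_ R P t) (submxcol x t).
Proof. exact: mxcolK. Qed.

Lemma stage_adj_block (y : ytuple P) t :
  submxcol (stage_adj (\mxcol_s y s)) t = adj (@A_ R P t) (y t) + Badj_next y t.
Proof.
rewrite /stage_adj mxcolK mxcolK; congr (_ + Badj_next _ _).
by apply: functional_extensionality_dep => s; rewrite mxcolK.
Qed.

Definition stage_b : yf := \mxcol_(t < T) b_ P t.

Lemma stage_b_block t : submxcol stage_b t = b_ P t.
Proof. exact: mxcolK. Qed.

Definition stage_slack (y : yf) (v z w x : xf) : xf :=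
  stage_adj y + v + z - (stage_grad x - Qd x) - Qd w.

Definition stage_st (p : iterate P) : primal_dual R _ _ _ _ :=
  @PrimalDual R _ _ _ _ (\mxcol_(t < T) it_v p t) (\mxcol_(t < T) it_w p t)
    (\mxcol_(t < T) it_y p t) (\mxcol_(t < T) it_z p t) (\mxcol_(t < T) it_x p t).

Lemma stage_slackE (x v w z : xtuple P) (y : ytuple P) t :
  submxcol (stage_slack (\mxcol_s y s) (\mxcol_s v s) (\mxcol_s z s)
    (\mxcol_s w s) (\mxcol_s x s)) t = dual_residual Q x v w y z t.
Proof.
rewrite /stage_slack !(submxcolBE, submxcolD) stage_adj_block stage_grad_block.
by rewrite !Qdiag_block !mxcolK.
Qed.

(** The part of [augL_fin] that varies with the dual variables. The shifted residual [e] is a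
    separate argument because it moves along a line whenever one block does. *)
Definition augL_quad (w : xf) (y : yf) (e : xf) : R :=
  2^-1 * inner w (Qd w) - inner stage_b y + sigma / 2 * inner e e.

Lemma augL_finE (x : xtuple P) : exists c : R, forall (v w z : xtuple P) y,
  augL_fin Q sigma x v w y z x = c +
  augL_quad (\mxcol_s w s) (\mxcol_s y s)
    (stage_slack (\mxcol_s y s) (\mxcol_s v s) (\mxcol_s z s)
      (\mxcol_s w s) (\mxcol_s x s) + sigma^-1 *: \mxcol_s x s).
Proof.
exists (\sum_(t < T) (- h_ (x t) - 2^-1 * inner (x t) (Q t (x t))
  + inner (gradient (@h_ R P t) (x t)) (x t) - (2 * sigma)^-1 * enorm (x t) ^+ 2)).
move=> v w z y; rewrite /augL_fin /augL_quad !inner_blocks !big_distrr /=.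
rewrite -sumrB -!big_split; apply: eq_bigr => t _ /=.
rewrite submxcolD submxcolZ stage_slackE enorm_sqr Qdiag_block /stage_b !mxcolK.
ring.
Qed.

Let addl_congr3 (a b e f g : R) : g = b + e + f -> a + g = a + b + e + f.
Proof. by move=> ->; rewrite !addrA. Qed.

Lemma augL_quad_line_e w y e de s : augL_quad w y (e + s *: de) =
  augL_quad w y e + s * (sigma * inner e de) + s ^+ 2 * (sigma / 2 * inner de de).
Proof. by rewrite /augL_quad !innerE (innerC de e); field. Qed.

Lemma augL_quad_line_w w y e dw de s :
  augL_quad (w + s *: dw) y (e + s *: de) =
  augL_quad w y e + s * (inner (Qd w) dw + sigma * inner e de)
  + s ^+ 2 * (2^-1 * inner dw (Qd dw) + sigma / 2 * inner de de).
Proof.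
rewrite /augL_quad (linearD Qd) linearZ_LR !innerE (innerC de e).
by rewrite -(Qdiag_self_adjoint w dw) (innerC dw (Qd w)); field.
Qed.

Lemma augL_quad_line_y w y e dy de s :
  augL_quad w (y + s *: dy) (e + s *: de) =
  augL_quad w y e + s * (sigma * inner e de - inner stage_b dy)
  + s ^+ 2 * (sigma / 2 * inner de de).
Proof. by rewrite /augL_quad !innerE (innerC de e); field. Qed.

Lemma slack_gradient (x v w z : xtuple P) (y : ytuple P) t :
  sigma *: submxcol (stage_slack (\mxcol_s y s) (\mxcol_s v s) (\mxcol_s z s)
    (\mxcol_s w s) (\mxcol_s x s) + sigma^-1 *: \mxcol_s x s) t =
  x t + sigma *: (submxcol (stage_adj (\mxcol_s y s)) t + v t + z t
                  - c_ Q (x t) - Q t (w t)).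
Proof.
rewrite submxcolD submxcolZ scalerDr scalerA divff ?gt_eqF// scale1r addrC.
rewrite stage_slackE /dual_residual -stage_adj_block; congr (_ + _).
by rewrite mxcolK.
Qed.

(** On each line in block [t] the smooth part is a quadratic polynomial, so [subdiff_add_quadratic]
    replaces it by its gradient. Since [e] carries the shift [sigma^-1 x], that gradient [sigma e]
    is [x] plus [sigma] times the residual. *)
Lemma argmin_v eps x (v w : xtuple P) y z (t : 'I_T) u :
  approx_argmin eps (@augL_v R P Q sigma x v w y z x t) u ->
  exists g, enorm g <= eps /\ subdiff (fenchel (@theta_ R P t)) (- u)
    (x t + sigma *: (submxcol (stage_adj (\mxcol_s y s)) t + u + z t
                  - c_ Q (x t) - Q t (w t)) - g).
Proof.
move=> [g sub le_g]; exists g; split => //.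
have [c cE] := augL_finE x.
have line (d : xspace P t) (s : R) : augL_fin Q sigma x (eqtype.dfwith v (u + s *: d)) w y z x =
    augL_fin Q sigma x (eqtype.dfwith v u) w y z x
    + s * inner (x t + sigma *: (submxcol (stage_adj (\mxcol_s y s)) t + u + z t
                  - c_ Q (x t) - Q t (w t))) d
    + s ^+ 2 * (sigma / 2 * inner (xsingle d) (xsingle d)).
  rewrite !cE mxcol_dfwith; apply: addl_congr3.
  pose e : xf := stage_slack (\mxcol_s y s) (\mxcol_s eqtype.dfwith v u s)
    (\mxcol_s z s) (\mxcol_s w s) (\mxcol_s x s) + sigma^-1 *: \mxcol_s x s.
  rewrite -/e.
  rewrite (_ : stage_slack _ _ _ _ _ + _ = e + s *: xsingle d); last first.
    by rewrite /e /stage_slack; apply/matrixP => i j; rewrite !mxE; ring.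
  rewrite augL_quad_line_e; congr (_ + _ * _ + _).
  rewrite (innerC e) inner_single innerC -innerZl /e slack_gradient.
  by rewrite dfwith_in.
have := subdiff_add_quadratic (segment_convex_opp (@fenchel_segment_convex _ _ _ (@theta_ R P t))) line sub.
by move=> /subdiff_opp; rewrite opprB.
Qed.

Lemma argmin_z eps x (v w : xtuple P) y z (t : 'I_T) u :
  approx_argmin eps (@augL_z R P Q sigma x v w y z x t) u ->
  exists g, enorm g <= eps /\ subdiff (fenchel (indicator (@K_ R P t))) (- u)
    (x t + sigma *: (submxcol (stage_adj (\mxcol_s y s)) t + v t + u
                  - c_ Q (x t) - Q t (w t)) - g).
Proof.
move=> [g sub le_g]; exists g; split => //.
have [c cE] := augL_finE x.
have line (d : xspace P t) (s : R) : augL_fin Q sigma x v w y (eqtype.dfwith z (u + s *: d)) x =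
    augL_fin Q sigma x v w y (eqtype.dfwith z u) x
    + s * inner (x t + sigma *: (submxcol (stage_adj (\mxcol_s y s)) t + v t + u
                  - c_ Q (x t) - Q t (w t))) d
    + s ^+ 2 * (sigma / 2 * inner (xsingle d) (xsingle d)).
  rewrite !cE mxcol_dfwith; apply: addl_congr3.
  pose e : xf := stage_slack (\mxcol_s y s) (\mxcol_s v s)
    (\mxcol_s eqtype.dfwith z u s) (\mxcol_s w s) (\mxcol_s x s) + sigma^-1 *: \mxcol_s x s.
  rewrite -/e.
  rewrite (_ : stage_slack _ _ _ _ _ + _ = e + s *: xsingle d); last first.
    by rewrite /e /stage_slack; apply/matrixP => i j; rewrite !mxE; ring.
  rewrite augL_quad_line_e; congr (_ + _ * _ + _).
  rewrite (innerC e) inner_single innerC -innerZl /e slack_gradient.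
  by rewrite dfwith_in.
have := subdiff_add_quadratic (segment_convex_opp (@fenchel_segment_convex _ _ _ (indicator (@K_ R P t)))) line sub.
by move=> /subdiff_opp; rewrite opprB.
Qed.

(** The smooth gradient [q] lies in the range of [Q] and differs from the error [g] by an element of
    the kernel. Hence [q] is the orthogonal projection of [g] onto the range, and is no longer than
    [g]. *)
Lemma argmin_w eps x (v w : xtuple P) y z (t : 'I_T) u :
  approx_argmin eps (@augL_w R P Q sigma x v w y z x t) u ->
  range (Q t) u /\ enorm (Q t u - Q t
    (x t + sigma *: (submxcol (stage_adj (\mxcol_s y s)) t + v t + z t
                  - c_ Q (x t) - Q t u))) <= eps.
Proof.
move=> [g sub le_g]; have [Qsa _ _] := Qmin t.
have [c cE] := augL_finE x.
set X := x t + _.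
have line (d : xspace P t) (s : R) : augL_fin Q sigma x v (eqtype.dfwith w (u + s *: d)) y z x =
    augL_fin Q sigma x v (eqtype.dfwith w u) y z x
    + s * inner (Q t u - Q t X) d
    + s ^+ 2 * (2^-1 * inner (xsingle d) (Qd (xsingle d))
                + sigma / 2 * inner (- Qd (xsingle d)) (- Qd (xsingle d))).
  rewrite !cE mxcol_dfwith; apply: addl_congr3.
  pose e : xf := stage_slack (\mxcol_s y s) (\mxcol_s v s)
    (\mxcol_s z s) (\mxcol_s eqtype.dfwith w u s) (\mxcol_s x s) + sigma^-1 *: \mxcol_s x s.
  rewrite -/e.
  rewrite (_ : stage_slack _ _ _ _ _ + _ = e + s *: - Qd (xsingle d)); last first.
    rewrite /e /stage_slack (linearD Qd) linearZ_LR.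
    by apply/matrixP => i j; rewrite !mxE; ring.
  rewrite augL_quad_line_w; congr (_ + _ * _ + _).
  have h1 : inner (Qd (\mxcol_s eqtype.dfwith w u s)) (xsingle d) = inner (Q t u) d.
    by rewrite innerC inner_single Qdiag_block mxcolK dfwith_in innerC.
  have h2 : sigma * inner e (Qd (xsingle d)) = inner (Q t X) d.
    rewrite -Qdiag_self_adjoint innerC inner_single Qdiag_block -innerZr innerC.
    rewrite -linearZ_LR; congr (inner (Q t _) _).
    by rewrite /e slack_gradient dfwith_in.
  by rewrite h1 innerNr mulrN h2 innerDl innerNl.
have [uW Qg] := subdiff_indicator_range Qsa
  (subdiff_add_quadratic (@indicator_range_convex _ _ _ (Q t)) line sub).
split => //; apply: le_trans le_g.
set q := Q t u - Q t X in Qg *.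
have qg : inner q q = inner q g.
  have qE : q = Q t (u - X) by rewrite linearB.
  rewrite {2}qE -Qsa (_ : Q t q = Q t g) ?Qsa -?qE 1?innerC//.
  by apply/esym/subr0_eq; rewrite -linearB.
have := inner_le q g; rewrite -qg -enorm_sqr.
have [->|q0] := eqVneq (enorm q) 0; first by rewrite enorm_ge0.
by rewrite expr2 ler_pM2l// lt_neqAle eq_sym q0 enorm_ge0.
Qed.

(** The objective is smooth in [y]; a zero function is added so that [subdiff_add_quadratic]
    applies. Its only subgradient is 0, so the gradient equals the error vector. *)
Lemma argmin_y eps x (v w : xtuple P) y z (t : 'I_T) u :
  approx_argmin eps (@augL_y R P Q sigma x v w y z x t) u ->
  enorm (submxcol (stage_map P (\mxcol_s x s + sigma *:
    stage_slack (\mxcol_s eqtype.dfwith y u s) (\mxcol_s v s) (\mxcol_s z s)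
      (\mxcol_s w s) (\mxcol_s x s))) t - b_ P t) <= eps.
Proof.
move=> [g sub le_g].
have [c cE] := augL_finE x.
set X := \mxcol_s x s + _.
have line (d : yspace P t) (s : R) : augL_fin Q sigma x v w (eqtype.dfwith y (u + s *: d)) z x =
    augL_fin Q sigma x v w (eqtype.dfwith y u) z x
    + s * inner (submxcol (stage_map P X) t - b_ P t) d
    + s ^+ 2 * (sigma / 2 * inner (stage_adj (ysingle d)) (stage_adj (ysingle d))).
  rewrite !cE mxcol_dfwith; apply: addl_congr3.
  pose e : xf := stage_slack (\mxcol_s eqtype.dfwith y u s) (\mxcol_s v s)
    (\mxcol_s z s) (\mxcol_s w s) (\mxcol_s x s) + sigma^-1 *: \mxcol_s x s.
  have slackE : stage_slack (\mxcol_s eqtype.dfwith y u s + s *: ysingle d)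
      (\mxcol_s v s) (\mxcol_s z s) (\mxcol_s w s) (\mxcol_s x s)
      + sigma^-1 *: \mxcol_s x s = e + s *: stage_adj (ysingle d).
    have sE (a b : yf) : stage_adj (a + s *: b) = stage_adj a + s *: stage_adj b.
      by rewrite addrC stage_adj_linear addrC.
    rewrite /e /stage_slack sE.
    by apply/matrixP => i j; rewrite !mxE; ring.
  apply: etrans (congr1 (augL_quad _ _) slackE) _.
  rewrite augL_quad_line_y; congr (_ + _ * _ + _).
  rewrite [RHS]innerDl innerNl; congr (_ - _); last first.
    by rewrite innerC inner_single stage_b_block innerC.
  rewrite -innerZl -stage_mapP innerC inner_single innerC.
  congr (inner (submxcol _ t) _).
  congr (stage_map P _); rewrite /e /X scalerDr scalerA divff ?gt_eqF// scale1r.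
  by rewrite addrC.
have cst0 : segment_convex (fun _ : yspace P t => 0%E : \bar R).
  move=> a b r1 r2 s; rewrite !lee_fin => r10 r20 /andP[s0 s1].
  have h1 : 0 <= (1 - s) * r1 by rewrite mulr_ge0 ?subr_ge0.
  have h2 : 0 <= s * r2 by rewrite mulr_ge0.
  lra.
have sub0 : subdiff (fun u => 0 + (augL_fin Q sigma x v w (eqtype.dfwith y u) z x)%:E)%E u g.
  by move: sub; congr (subdiff _ _ _); apply/funext => u'; rewrite add0e.
have [_ h] := subdiff_add_quadratic cst0 line sub0.
suff -> : submxcol (stage_map P X) t - b_ P t = g by [].
apply/esym/subr0_eq/inner_eq0.
have := h (u + (g - (submxcol (stage_map P X) t - b_ P t))).
rewrite add0e lee_fin [u + _]addrC addrK => h1.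
by apply/eqP; rewrite eq_le h1 inner_ge0.
Qed.

Let As : {linear yf -> xf} := linear_pack (@stage_adj_linear R P).
Let D : {linear yf -> yf} := linear_pack (gs_diag_linear (stage_gram P)).
Let L : {linear yf -> yf} := linear_pack (gs_lower_linear (stage_gram P)).
Let U : {linear yf -> yf} := linear_pack (gs_upper_linear (stage_gram P)).
Let MV : xf -> xf -> Prop := conj_graph (fun t : 'I_T => @theta_ R P t).
Let MZ : xf -> xf -> Prop := conj_graph (fun t : 'I_T => indicator (@K_ R P t)).
Definition stage_kkt := pd_kkt As (stage_map P) Qd (@stage_grad R P) stage_b MV MZ.

Lemma kkt_stageP p : kkt_set Q p <-> stage_kkt (stage_st p).
Proof.
split=> [[h0 h1 h2]|[hb hg hv hz [hw hq]]].
  split.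
  - apply/mxcolP => -[[|t] lt]; rewrite [RHS]mxcolK.
      by rewrite stage_map_first// mxcolK; exact: h0.
    by rewrite stage_map_next /= !mxcolK; exact: h1.
  - apply/mxcolP => t; have [h _ _ _ _] := h2 t.
    rewrite stage_grad_block !submxcolD stage_adj_block !mxcolK.
    by apply/subr0_eq; rewrite -[RHS]h; apply/matrixP => i j; rewrite !mxE; ring.
  - by move=> t; rewrite !mxcolK; have [_ h _ _ _] := h2 t.
  - by move=> t; rewrite !mxcolK; have [_ _ h _ _] := h2 t.
  - split; first by apply/range_QdiagP => t; rewrite mxcolK; have [_ _ _ h _] := h2 t.
    by apply/mxcolP => t; rewrite !Qdiag_block !mxcolK; have [_ _ _ _ h] := h2 t.
split.
- move=> t t0; have := congr1 (fun y => submxcol y t) hb.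
  by rewrite stage_map_first// [submxcol stage_b t]mxcolK mxcolK.
- move=> t lt; have := congr1 (fun y => submxcol y (Ordinal lt)) hb.
  by rewrite stage_map_next [submxcol stage_b _]mxcolK /= !mxcolK.
- move=> t; split.
  + have := congr1 (fun y => submxcol y t) hg.
    rewrite stage_grad_block !submxcolD stage_adj_block !mxcolK => ->.
    by apply/matrixP => i j; rewrite !mxE; ring.
  + by have := hv t; rewrite !mxcolK.
  + by have := hz t; rewrite !mxcolK.
  + by have /range_QdiagP/(_ t) := hw; rewrite mxcolK.
  + have := congr1 (fun y => submxcol y t) hq.
    by rewrite !Qdiag_block !mxcolK.
Qed.

Lemma step_block (x v z w : xf) (y : yf) t :
  submxcol (x + sigma *: (stage_adj y + v + z - (stage_grad x - Qd x) - Qd w)) t =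
  submxcol x t + sigma *: (submxcol (stage_adj y) t + submxcol v t + submxcol z t
    - c_ Q (submxcol x t) - Q t (submxcol w t)).
Proof.
rewrite submxcolD submxcolZ !(submxcolBE, submxcolD) stage_grad_block.
by rewrite !Qdiag_block.
Qed.

(** By [gs_mix], the row of the splitting at [t] is the Gram operator on the spliced tuple. The
    triple [(lo, mid, hi)] is [(yt, yt, y)] in the forward sweep and [(yt, y', y')] in the backward
    one. *)
Lemma step_y_block (lo mid hi : ytuple P) (x v z w : xtuple P) t eps :
  enorm (submxcol (stage_map P (\mxcol_s x s + sigma *:
    stage_slack (\mxcol_s eqtype.dfwith (splice lo hi t) (mid t) s)
      (\mxcol_s v s) (\mxcol_s z s) (\mxcol_s w s) (\mxcol_s x s))) t - b_ P t)
    <= eps ->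
  enorm (submxcol (stage_map P (\mxcol_s x s + sigma *:
      (\mxcol_s v s + \mxcol_s z s
       - (stage_grad (\mxcol_s x s) - Qd (\mxcol_s x s)) - Qd (\mxcol_s w s)))
    - stage_b + sigma *: (D (\mxcol_s mid s) + L (\mxcol_s lo s) + U (\mxcol_s hi s)))
    t) <= eps.
Proof.
congr (enorm _ <= _).
rewrite [RHS]submxcolD submxcolBE submxcolZ [submxcol stage_b t]mxcolK.
rewrite [X in _ = _ + _ *: X](@gs_mix _ _ _ _ (stage_gram P)).
set ymix := \mxcol_s eqtype.dfwith _ _ s.
have -> : (\mxcol_(s < T) (if (s < t)%N then submxcol (\mxcol_s lo s) s
    else if s == t then submxcol (\mxcol_s mid s) s
    else submxcol (\mxcol_s hi s) s)) = ymix.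
  apply/eq_mxcolP => s; rewrite !mxcolK.
  have [->|ts] := eqVneq t s; first by rewrite ltnn dfwith_in.
  by rewrite dfwith_out.
rewrite addrAC -submxcolZ -submxcolD; congr (submxcol _ t - _).
have SZ k u : stage_map P (k *: u) = k *: stage_map P u by exact: linearZ_LR.
rewrite -[sigma *: stage_gram P ymix]SZ -(linearD (stage_map P)).
congr (stage_map P _); rewrite /stage_slack.
by apply/matrixP => i j; rewrite !mxE; ring.
Qed.

Lemma slmdd_step_sgs eps tau p p' : 0 <= eps -> slmdd_step Q sigma tau eps p p' ->
  sgs_step As (stage_map P) Qd D L U (@stage_grad R P) stage_b MV MZ sigma tau
    (T%:R * eps) (stage_st p) (stage_st p').
Proof.
move=> eps0 [wt [yt [[h1a h1b h1c] [h2a h2b h2c h3]]]].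
pose gv t := sval (cid (argmin_v (h1b t))).
have gvP t := svalP (cid (argmin_v (h1b t))).
pose gz t := sval (cid (argmin_z (h2b t))).
have gzP t := svalP (cid (argmin_z (h2b t))).
exists (\mxcol_t wt t), (\mxcol_t yt t), (\mxcol_t gv t), (\mxcol_t gz t).
rewrite /stage_st; cbn [pd_v pd_w pd_y pd_z pd_x]; split.
- split; apply: enorm_block_le => // t; rewrite mxcolK.
    by have [] := gvP t.
  by have [] := gzP t.
- split.
  + apply: enorm_block_le => // t; have [_] := argmin_w (h1a t).
    by rewrite submxcolBE !Qdiag_block step_block !mxcolK.
  + move=> t; have [_] := gvP t.
    by rewrite submxcolBE step_block !mxcolK; exact.
  + apply: enorm_block_le => // t; have [_] := argmin_w (h1c t).
    by rewrite submxcolBE !Qdiag_block step_block !mxcolK.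
  + by apply/range_QdiagP => t; have [] := argmin_w (h1c t); rewrite mxcolK.
- split.
  + apply: enorm_block_le => // t.
    exact: (step_y_block (argmin_y (h2a t))).
  + move=> t; have [_] := gzP t.
    by rewrite submxcolBE step_block !mxcolK; exact.
  + apply: enorm_block_le => // t.
    exact: (step_y_block (argmin_y (h2c t))).
- apply/mxcolP => t; rewrite submxcolD submxcolZ !mxcolK h3.
  rewrite -stage_slackE; congr (_ + _ *: submxcol _ t).
  by rewrite /pd_residual /stage_slack /=; apply/matrixP => i j; rewrite !mxE; ring.
Qed.

End StageAlgorithm.

Theorem theorem3p6 (R : realType) (P : msp R)
  (Q : forall t : 'I_(stages P), {linear xspace P t -> xspace P t})
  (alpha sigma tau : R) (eps : nat -> R) (varpi : nat -> iterate P)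
  (Px : nat -> iterate P -> {linear xfull P -> xfull P}) :
  msp_standing P ->
  constraint_qualification P ->
  minorization Q ->
  0 < alpha < 1 ->
  0 < sigma ->
  0 < tau <= (1 + Num.sqrt (5 - 4 * alpha)) / 2 ->
  (forall k, 0 <= eps k) ->
  cvgn (series eps) ->
  kkt_set Q !=set0 ->
  (forall k pbar, kkt_set Q pbar ->
     mean_value_hessian Q (stack (it_x (varpi k))) (stack (it_x pbar))
       (Px k pbar)) ->
  (forall k pbar, kkt_set Q pbar ->
     loewner_le (fun x => Px k pbar x - Qdiag Q x)
       (fun x => (2 * alpha / sigma) *: x)) ->
  (forall k, slmdd_step Q sigma tau (eps k) (varpi k) (varpi k.+1)) ->
  exists2 pbar, kkt_set Q pbar & iterates_cvg varpi pbar.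
Proof.
move=> std cq Qmin alpha01 sigma_gt0 tau01 eps0 eps_cvg [p0 kkt0] mvh lle steps.
pose Qd := linear_pack (Qdiag_linear Q).
pose unst (l : primal_dual R _ _ _ _) : iterate P := @Iterate R P
  (fun t => submxcol (pd_v l) t) (fun t => submxcol (pd_w l) t)
  (fun t => submxcol (pd_y l) t) (fun t => submxcol (pd_z l) t)
  (fun t => submxcol (pd_x l) t).
have unstK l : stage_st (unst l) = l.
  by case: l => v w y z x; rewrite /stage_st /unst /= !submxcolK.
(* By the mean value identity the gap is [P_x - Q] applied to [x - xbar], and
   [0 <= P_x - Q <= (2 alpha / sigma) I] makes that operator cocoercive. *)
have gaps k l : stage_kkt Q l ->
    inner (pd_gap Qd (@stage_grad R P) (stage_st (varpi k)) l)
      (pd_gap Qd (@stage_grad R P) (stage_st (varpi k)) l) <=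
    2 * alpha / sigma * inner (pd_x (stage_st (varpi k)) - pd_x l)
      (pd_gap Qd (@stage_grad R P) (stage_st (varpi k)) l).
  move=> kl; have kp : kkt_set Q (unst l) by apply/(kkt_stageP Q (unst l)); rewrite unstK.
  have [Hsa _ mv low] := mvh k _ kp; have up := lle k _ kp.
  set Hk := Px k (unst l) in Hsa mv low up.
  have Gl : linear (fun x : xfull P => Hk x - Qd x).
    move=> s x y; rewrite (linearP Hk) (linearP Qd).
    by apply/matrixP => i j; rewrite !mxE; ring.
  have gapE : pd_gap Qd (@stage_grad R P) (stage_st (varpi k)) l =
      linear_pack Gl (pd_x (stage_st (varpi k)) - pd_x l).
    rewrite /pd_gap /= -!gradient_h_full; congr (_ - _).
    by rewrite -[pd_x l]submxcolK; exact: mv.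
  rewrite gapE; apply: psd_cocoercive.
  - move=> x y /=; rewrite innerDl innerNl innerDr innerNr.
    by rewrite Hsa (Qdiag_self_adjoint Qmin x y).
  - by move=> x; exact: low.
  - by have [a0 _] := andP alpha01; rewrite divr_gt0// mulr_gt0.
  - move=> x; have := up x; rewrite innerDr innerNr innerZr subr_ge0; exact.
have epsT k : 0 <= (stages P)%:R * eps k by exact: mulr_ge0.
have [l kl [hv hw hy hz hx]] := sgs_admm_cvg
  (As := linear_pack (@stage_adj_linear R P)) (A := stage_map P) (Q := Qd)
  (D := linear_pack (gs_diag_linear (stage_gram P)))
  (L := linear_pack (gs_lower_linear (stage_gram P)))
  (U := linear_pack (gs_upper_linear (stage_gram P)))
  (MV := conj_graph (fun t : 'I_(stages P) => @theta_ R P t))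
  (MZ := conj_graph (fun t : 'I_(stages P) => indicator (@K_ R P t)))
  (b := stage_b P)
  (@stage_mapP R P) (gs_split (stage_gram P))
  (gs_adjoint (@stage_gram_self_adjoint R P))
  (gs_diag_self_adjoint (@stage_gram_self_adjoint R P))
  (gs_diag_pos_def (fun t u u0 => stage_gram_block_pos cq u0))
  (Qdiag_self_adjoint Qmin) (Qdiag_pos_semidef Qmin) sigma_gt0
  (@conj_graph_mono _ _ _ _ _) (@conj_graph_mono _ _ _ _ _)
  (@conj_graph_closed _ _ _ _ _) (@conj_graph_closed _ _ _ _ _)
  (stage_grad_continuous std) alpha01 tau01
  epsT (@is_cvg_seriesZ _ _ (stages P)%:R eps_cvg)
  (fun k => slmdd_step_sgs sigma_gt0 Qmin (eps0 k) (steps k))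
  (ex_intro _ _ (proj1 (kkt_stageP Q p0) kkt0)) gaps.
exists (unst l); first by apply/(kkt_stageP Q (unst l)); rewrite unstK.
move=> t.
have blk m (u : nat -> forall s : 'I_(stages P), 'M[R]_(#|node (branch P) s|, m))
    (lu : 'M[R]_(\sum_(s < stages P) #|node (branch P) s|, m)) :
    \mxcol_s u k s @[k --> \oo] --> lu -> u k t @[k --> \oo] --> submxcol lu t.
  move=> ul; rewrite (_ : (fun k => u k t) = (fun k => submxcol (\mxcol_s u k s) t)).
    exact: cvg_submxcol.
  by apply/funext => k; rewrite mxcolK.
split.
- exact: (blk _ (fun k => it_v (varpi k)) _ hv).
- exact: (blk _ (fun k => it_w (varpi k)) _ hw).
- exact: (blk _ (fun k => it_y (varpi k)) _ hy).
- exact: (blk _ (fun k => it_z (varpi k)) _ hz).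
- exact: (blk _ (fun k => it_x (varpi k)) _ hx).
Qed.
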